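(* Let $K$ be an algebraically closed field of characteristic $p\ge 0$ and let $f\in K[[x,y]]$ be reduced. Then $$\tilde\gamma(f)\;\geq\; 2\delta(f)-r(f)+1.$$ Equality holds if and only if the characteristic $p$ is intersection multiplicity good (im-good) for $f$.
   Context: For $f,g\in K[[x,y]]$, $i(f,g):=\dim_K K[[x,y]]/\langle f,g\rangle\in\mathbb{N}\cup\{\infty\}$; $f_x,f_y$ are the partial derivatives. $f$ is reduced if it is nonzero and has no multiple irreducible factor. For reduced $f$: $\delta(f):=\dim_K \bar R/R$, where $R=K[[x,y]]/\langle f\rangle$ and $\bar R$ is its normalization; $r(f)$ is the number of branches (irreducible factors) of $f$. The number $\tilde\gamma(f)=\tilde\gamma_{x,y}(f)$ of a reduced $f$ (with respect to the fixed coordinates $x,y$) is defined by: (1) $\tilde\gamma(x):=0$, $\tilde\gamma(y):=0$; (2) if $f$ is irreducible and convenient (i.e. $i(f,x),i(f,y)<\infty$), then $\tilde\gamma(f):=\min\{i(f,f_x)-i(f,y)+1,\ i(f,f_y)-i(f,x)+1\}$; (3) if $f=f_1\cdots f_r$ with $f_i$ irreducible, then $\tilde\gamma(f):=\sum_{i=1}^r\big(\tilde\gamma(f_i)+\sum_{j\ne i}i(f_i,f_j)\big)-r+1$. One has $\tilde\gamma(u)=1$ and $\tilde\gamma(u f)=\tilde\gamma(f)$ for every unit $u$ (in particular $\tilde\gamma(ux)=\tilde\gamma(uy)=0$). With $f=f_1\cdots f_r$, $f_i$ irreducible, $p$ is intersection multiplicity good (im-good) for $f$ if for all $i$, either $i(f_i,x)\ne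 0\pmod p$ or $i(f_i,y)\neq 0\pmod p$ (for $p=0$ this always holds). *)

(* Defs.v *)
From HB Require Import structures.
From mathcomp Require Import all_boot all_order all_algebra.
From mathcomp Require Import boolp classical_sets constructive_ereal.

Set Implicit Arguments.
Unset Strict Implicit.
Unset Printing Implicit Defensive.
Import Order.TTheory GRing.Theory Num.Theory.
Local Open Scope ring_scope.
Local Open Scope quotient_scope.
Local Open Scope classical_set_scope.

(* [f i j] is the coefficient of x^i y^j in f. *)
Record fps2 (K : Type) := FPS2 { fps2_coef :> nat -> nat -> K }.

Lemma fps2P (K : Type) (f g : fps2 K) : (forall i j, f i j = g i j) -> f = g.
Proof.
by case: f g => [f] [g] /= fg; congr FPS2; apply/funext => i; apply/funext.
Qed.

HB.instance Definition _ (K : Type) := gen_eqMixin (fps2 K).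
HB.instance Definition _ (K : Type) := gen_choiceMixin (fps2 K).

Section Fps2Ring.
Variable K : comNzRingType.
Implicit Types f g h : fps2 K.

Definition fps2_const (c : K) : fps2 K :=
  FPS2 (fun i j => c *+ ((i == 0%N) && (j == 0%N))).
Definition fps2_add f g := FPS2 (fun i j => f i j + g i j).
Definition fps2_opp f := FPS2 (fun i j => - f i j).
Definition fps2_mul f g : fps2 K :=
  FPS2 (fun m n => \sum_(i < m.+1) \sum_(j < n.+1)
                     f i j * g (m - i)%N (n - j)%N).

Fact fps2_addA : associative fps2_add.
Proof. by move=> f g h; apply: fps2P => i j /=; rewrite addrA. Qed.
Fact fps2_addC : commutative fps2_add.
Proof. by move=> f g; apply: fps2P => i j /=; rewrite addrC. Qed.
Fact fps2_add0 : left_id (fps2_const 0) fps2_add.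
Proof. by move=> f; apply: fps2P => i j /=; rewrite mul0rn add0r. Qed.
Fact fps2_addN : left_inverse (fps2_const 0) fps2_opp fps2_add.
Proof. by move=> f; apply: fps2P => i j /=; rewrite mul0rn addNr. Qed.

HB.instance Definition _ :=
  GRing.isZmodule.Build (fps2 K) fps2_addA fps2_addC fps2_add0 fps2_addN.

(* The ring axioms are transferred from {poly {poly K}} by truncation. *)
Let agree N f (P : {poly {poly K}}) :=
  forall i j, (i < N)%N -> (j < N)%N -> P`_i`_j = f i j.
Let trunc N f : {poly {poly K}} := \poly_(i < N) \poly_(j < N) f i j.

Let agree_trunc N f : agree N f (trunc N f).
Proof. by move=> i j iN jN; rewrite coef_poly iN coef_poly jN. Qed.

Let agreeM N f g P Q :
  agree N f P -> agree N g Q -> agree N (fps2_mul f g) (P * Q).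
Proof.
move=> fP gQ m n mN nN /=; rewrite coefM coef_sum.
apply: eq_bigr => i _; rewrite coefM; apply: eq_bigr => j _.
rewrite fP ?gQ //; first exact: leq_ltn_trans (leq_subr _ _) mN.
- exact: leq_ltn_trans (leq_subr _ _) nN.
- by apply: leq_ltn_trans mN; rewrite -ltnS.
- by apply: leq_ltn_trans nN; rewrite -ltnS.
Qed.

Let agree_eq f g : (forall N, exists2 P, agree N f P & agree N g P) -> f = g.
Proof.
move=> fg; apply: fps2P => i j.
have [P fP gP] := fg (maxn i j).+1.
by rewrite -fP ?gP // ltnS ?leq_maxl ?leq_maxr.
Qed.

Fact fps2_mulA : associative fps2_mul.
Proof.
move=> f g h; apply: agree_eq => N.
exists (trunc N f * (trunc N g * trunc N h)); last rewrite mulrA.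
- by do !apply: agreeM => //; exact: agree_trunc.
- by do !apply: agreeM => //; exact: agree_trunc.
Qed.
Fact fps2_mulC : commutative fps2_mul.
Proof.
move=> f g; apply: agree_eq => N.
exists (trunc N f * trunc N g); last rewrite mulrC.
- by do !apply: agreeM => //; exact: agree_trunc.
- by do !apply: agreeM => //; exact: agree_trunc.
Qed.
Fact fps2_mul1 : left_id (fps2_const 1) fps2_mul.
Proof.
move=> f; apply: agree_eq => N.
exists (1 * trunc N f); last by rewrite mul1r; exact: agree_trunc.
apply: agreeM; last exact: agree_trunc.
move=> i j _ _ /=; rewrite coef1; case: (i == 0%N) => /=.
  by rewrite coef1.
by rewrite coef0.
Qed.
Fact fps2_mulDl : left_distributive fps2_mul fps2_add.
Proof.
move=> f g h; apply: fps2P => m n /=.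
rewrite -big_split; apply: eq_bigr => i _ /=.
by rewrite -big_split; apply: eq_bigr => j _ /=; rewrite mulrDl.
Qed.
Fact fps2_1neq0 : fps2_const 1 != 0.
Proof.
apply/eqP => /(congr1 (fun f : fps2 K => f 0%N 0%N)) /=.
by rewrite mul0rn mulr1n; apply/eqP; exact: oner_neq0.
Qed.

HB.instance Definition _ := GRing.Zmodule_isComNzRing.Build (fps2 K)
  fps2_mulA fps2_mulC fps2_mul1 fps2_mulDl fps2_1neq0.

Definition fps2_unit : pred (fps2 K) := fun u => `[< exists v, v * u = 1 >].
Definition fps2_inv (u : fps2 K) : fps2 K :=
  if pselect (exists v, v * u = 1) is left ex then sval (cid ex) else u.

Fact fps2_mulVr : {in fps2_unit, left_inverse 1 fps2_inv *%R}.
Proof.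
move=> u /asboolP ex; rewrite /fps2_inv.
by case: pselect => [ex'|/(_ ex)//]; case: (cid ex').
Qed.
Fact fps2_unitPl (u v : fps2 K) : v * u = 1 -> fps2_unit u.
Proof. by move=> vu; apply/asboolP; exists v. Qed.
Fact fps2_inv_out : {in [predC fps2_unit], fps2_inv =1 id}.
Proof.
move=> u /asboolPn nex; rewrite /fps2_inv.
by case: pselect => // /nex.
Qed.

HB.instance Definition _ := GRing.ComNzRing_hasMulInverse.Build (fps2 K)
  fps2_mulVr fps2_unitPl fps2_inv_out.

Fact fps2_const_zmod : zmod_morphism fps2_const.
Proof. by move=> a b; apply: fps2P => i j /=; rewrite mulrnBl. Qed.
Fact fps2_const_monoid : monoid_morphism fps2_const.
Proof.
split=> // a b; apply: fps2P => m n /=.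
rewrite big_ord_recl [X in _ + X]big1 ?addr0 => [|i _]; last first.
  by apply: big1 => j _ /=; rewrite mulr0n mul0r.
rewrite big_ord_recl [X in _ + X]big1 ?addr0 => [|j _ /=]; last first.
  by rewrite mulr0n mul0r.
rewrite /=.
by rewrite !subn0 mulr1n mulrnAr.
Qed.
HB.instance Definition _ :=
  GRing.isZmodMorphism.Build K (fps2 K) fps2_const fps2_const_zmod.
HB.instance Definition _ :=
  GRing.isMonoidMorphism.Build K (fps2 K) fps2_const fps2_const_monoid.

Definition fps2_x : fps2 K :=
  FPS2 (fun i j => ((i == 1%N) && (j == 0%N))%:R).
Definition fps2_y : fps2 K :=
  FPS2 (fun i j => ((i == 0%N) && (j == 1%N))%:R).
Definition fps2_dx f : fps2 K := FPS2 (fun i j => f i.+1 j *+ i.+1).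
Definition fps2_dy f : fps2 K := FPS2 (fun i j => f i j.+1 *+ j.+1).

End Fps2Ring.

Arguments fps2_x {K}.
Arguments fps2_y {K}.

(* A/<f>; this is the zero ring when f is a unit, so the ideal quotient of
   the library, which is restricted to proper ideals, does not apply. *)
Section PrincipalQuotient.
Variables (A : comPzRingType) (f : A).

Definition pideal : {pred A} := fun a => `[< exists b, a = b * f >].

Fact pideal_zmod_closed : zmod_closed pideal.
Proof.
split=> [|a b /asboolP[a' ->] /asboolP[b' ->]]; apply/asboolP.
  by exists 0; rewrite mul0r.
by exists (a' - b'); rewrite mulrBl.
Qed.
HB.instance Definition _ := GRing.isZmodClosed.Build A pideal pideal_zmod_closed.

Definition pquot : Type := Quotient.quot pideal.
HB.instance Definition _ := GRing.Zmodule.on pquot.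
HB.instance Definition _ := EqQuotient.on pquot.

Definition to_pquot (a : A) : pquot := \pi_pquot a.

Fact to_pquotP (a b : A) : to_pquot a = to_pquot b <-> a - b \in pideal.
Proof.
rewrite Quotient.idealrBE; split=> [/eqP //|/eqP]; exact.
Qed.

Fact to_pquot_zmod : zmod_morphism to_pquot.
Proof. by move=> a b; rewrite /to_pquot [LHS]raddfB. Qed.
HB.instance Definition _ :=
  GRing.isZmodMorphism.Build A pquot to_pquot to_pquot_zmod.

Definition pquot_one : pquot := to_pquot 1.
Definition pquot_mul (u v : pquot) : pquot := to_pquot (repr u * repr v).

Fact to_pquotM (a b : A) :
  to_pquot (a * b) = pquot_mul (to_pquot a) (to_pquot b).
Proof.
have /to_pquotP/asboolP[a' ha] : to_pquot a = to_pquot (repr (to_pquot a)).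
  by rewrite /to_pquot reprK.
have /to_pquotP/asboolP[b' hb] : to_pquot b = to_pquot (repr (to_pquot b)).
  by rewrite /to_pquot reprK.
apply/to_pquotP/asboolP.
set c := repr _ in ha *; set d := repr _ in hb *.
exists (a' * b + c * b'); rewrite mulrDl -mulrA (mulrC b) mulrA -ha.
by rewrite -mulrA -hb mulrBl mulrBr addrA subrK.
Qed.

Let to_pquotK (u : pquot) : exists a, u = to_pquot a.
Proof. by exists (repr u); rewrite /to_pquot reprK. Qed.

Fact pquot_mulA : associative pquot_mul.
Proof.
move=> u v w; have [a ->] := to_pquotK u; have [b ->] := to_pquotK v.
by have [c ->] := to_pquotK w; rewrite -!to_pquotM mulrA.
Qed.
Fact pquot_mulC : commutative pquot_mul.
Proof. by move=> u v; rewrite /pquot_mul mulrC. Qed.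
Fact pquot_mul1 : left_id pquot_one pquot_mul.
Proof. by move=> u; have [a ->] := to_pquotK u; rewrite -to_pquotM mul1r. Qed.
Fact pquot_mulDl : left_distributive pquot_mul +%R.
Proof.
move=> u v w; have [a ->] := to_pquotK u; have [b ->] := to_pquotK v.
by have [c ->] := to_pquotK w; rewrite -raddfD -!to_pquotM -raddfD mulrDl.
Qed.

HB.instance Definition _ := GRing.Zmodule_isComPzRing.Build pquot
  pquot_mulA pquot_mulC pquot_mul1 pquot_mulDl.

Fact to_pquot_monoid : monoid_morphism to_pquot.
Proof. by split=> // a b; exact: to_pquotM. Qed.
HB.instance Definition _ :=
  GRing.isMonoidMorphism.Build A pquot to_pquot to_pquot_monoid.

End PrincipalQuotient.

(* The total ring of fractions: R localized at its nonzerodivisors. *)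
Section TotalFractions.
Variable R : comPzRingType.

Definition nonzerodiv : pred R := fun s => `[< GRing.lreg s >].
Local Notation S := {s : R | nonzerodiv s}.

Fact nonzerodiv1 : nonzerodiv 1. Proof. by apply/asboolP; exact: lreg1. Qed.
Fact nonzerodivM s t : nonzerodiv s -> nonzerodiv t -> nonzerodiv (s * t).
Proof. by move=> /asboolP hs /asboolP ht; apply/asboolP; exact: lregM. Qed.
Let one_S : S := Sub 1 nonzerodiv1.
Let mul_S (s t : S) : S := Sub (val s * val t) (nonzerodivM (valP s) (valP t)).
Let S_lreg (s : S) : GRing.lreg (val s).
Proof. exact/asboolP/(valP s). Qed.

Definition ratio_equiv (z w : R * S) : bool := z.1 * val w.2 == w.1 * val z.2.

Fact ratio_equiv_is_equiv : equiv_class_of ratio_equiv.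
Proof.
split=> [z|z w|w z t]; rewrite /ratio_equiv; first exact: eqxx.
  exact: eq_sym.
move=> /eqP zw /eqP wt; apply/eqP; apply: (S_lreg (s := w.2)).
by rewrite mulrCA [val w.2 * _]mulrC mulrA zw -mulrA [val z.2 * _]mulrC mulrA
           wt -mulrA [val w.2 * _]mulrC mulrA mulrAC mulrC mulrA.
Qed.
Canonical ratio_equiv_equiv := EquivRelPack ratio_equiv_is_equiv.
Canonical ratio_equiv_encModRel := defaultEncModRel ratio_equiv.

Definition tfrac : Type := {eq_quot ratio_equiv}.
HB.instance Definition _ := Choice.on tfrac.
HB.instance Definition _ := EqQuotient.on tfrac.

Definition mk_tfrac (a : R) (s : S) : tfrac := \pi_tfrac (a, s).

Fact mk_tfracP a s b t : mk_tfrac a s = mk_tfrac b t <-> a * val t = b * val s.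
Proof.
by split=> [/eqquotP/eqP | h] //; apply/eqquotP/eqP.
Qed.

Let tfracK u : exists a s, u = mk_tfrac a s.
Proof.
by exists (repr u).1, (repr u).2; rewrite /mk_tfrac -surjective_pairing reprK.
Qed.

Definition tofrac (a : R) : tfrac := mk_tfrac a one_S.
Definition tfrac_opp (u : tfrac) : tfrac :=
  mk_tfrac (- (repr u).1) (repr u).2.
Definition tfrac_add (u v : tfrac) : tfrac :=
  mk_tfrac ((repr u).1 * val (repr v).2 + (repr v).1 * val (repr u).2)
           (mul_S (repr u).2 (repr v).2).
Definition tfrac_mul (u v : tfrac) : tfrac :=
  mk_tfrac ((repr u).1 * (repr v).1) (mul_S (repr u).2 (repr v).2).

Let repr_mk a s : (repr (mk_tfrac a s)).1 * val s =
                  a * val (repr (mk_tfrac a s)).2.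
Proof.
by apply/mk_tfracP; rewrite {1}/mk_tfrac -surjective_pairing reprK.
Qed.

Fact tfrac_oppE a s : tfrac_opp (mk_tfrac a s) = mk_tfrac (- a) s.
Proof. by apply/mk_tfracP; rewrite !mulNr repr_mk. Qed.
Fact tfrac_addE a s b t : tfrac_add (mk_tfrac a s) (mk_tfrac b t) =
  mk_tfrac (a * val t + b * val s) (mul_S s t).
Proof.
apply/mk_tfracP => /=; rewrite !mulrDl.
rewrite mulrACA repr_mk [val _ * val t]mulrC; congr (_ + _).
  by rewrite mulrACA; congr (_ * _); rewrite mulrC.
by rewrite [val s * _]mulrC mulrACA repr_mk [val _ * val s]mulrC mulrACA
           [val (repr (mk_tfrac b t)).2 * _]mulrC.
Qed.
Fact tfrac_mulE a s b t : tfrac_mul (mk_tfrac a s) (mk_tfrac b t) =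
  mk_tfrac (a * b) (mul_S s t).
Proof.
by apply/mk_tfracP => /=; rewrite mulrACA !repr_mk mulrACA.
Qed.

Fact tfrac_addA : associative tfrac_add.
Proof.
move=> u v w; have [a [s ->]] := tfracK u; have [b [t ->]] := tfracK v.
have [c [r ->]] := tfracK w; rewrite !tfrac_addE; apply/mk_tfracP => /=.
rewrite [val s * (_ * _)]mulrA; congr (_ * _).
rewrite !mulrDl -!mulrA -addrA; congr (_ + (_ + _)).
  by rewrite [val s * _]mulrC.
by rewrite [val s * _]mulrC.
Qed.
Fact tfrac_addC : commutative tfrac_add.
Proof.
move=> u v; have [a [s ->]] := tfracK u; have [b [t ->]] := tfracK v.
by rewrite !tfrac_addE; apply/mk_tfracP => /=; rewrite addrC [val s * _]mulrC.
Qed.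
Fact tfrac_add0 : left_id (tofrac 0) tfrac_add.
Proof.
move=> u; have [a [s ->]] := tfracK u; rewrite tfrac_addE.
by apply/mk_tfracP => /=; rewrite mul0r add0r mulr1 mul1r.
Qed.
Fact tfrac_addN : left_inverse (tofrac 0) tfrac_opp tfrac_add.
Proof.
move=> u; have [a [s ->]] := tfracK u; rewrite tfrac_oppE tfrac_addE.
by apply/mk_tfracP => /=; rewrite mulNr addNr !mul0r.
Qed.
HB.instance Definition _ := GRing.isZmodule.Build tfrac
  tfrac_addA tfrac_addC tfrac_add0 tfrac_addN.

Fact tfrac_mulA : associative tfrac_mul.
Proof.
move=> u v w; have [a [s ->]] := tfracK u; have [b [t ->]] := tfracK v.
have [c [r ->]] := tfracK w; rewrite !tfrac_mulE.
by apply/mk_tfracP => /=; rewrite !mulrA.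
Qed.
Fact tfrac_mulC : commutative tfrac_mul.
Proof.
move=> u v; have [a [s ->]] := tfracK u; have [b [t ->]] := tfracK v.
by rewrite !tfrac_mulE; apply/mk_tfracP => /=; rewrite mulrC [_ * a]mulrC
  ![a * _]mulrC [val t * _]mulrC mulrC.
Qed.
Fact tfrac_mul1 : left_id (tofrac 1) tfrac_mul.
Proof.
move=> u; have [a [s ->]] := tfracK u; rewrite tfrac_mulE.
by apply/mk_tfracP => /=; rewrite !mul1r.
Qed.
Fact tfrac_mulDl : left_distributive tfrac_mul tfrac_add.
Proof.
move=> u v w; have [a [s ->]] := tfracK u; have [b [t ->]] := tfracK v.
have [c [r ->]] := tfracK w.
rewrite !(tfrac_addE, tfrac_mulE); apply/mk_tfracP => /=.
have -> : a * c * (val t * val r) + b * c * (val s * val r) =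
          (a * val t + b * val s) * c * val r.
  by rewrite !mulrDl -!mulrA; congr (_ * _ + _ * _); rewrite mulrCA.
rewrite -!mulrA; congr (_ * (_ * _)).
by rewrite mulrCA; congr (_ * _); rewrite mulrCA.
Qed.
HB.instance Definition _ := GRing.Zmodule_isComPzRing.Build tfrac
  tfrac_mulA tfrac_mulC tfrac_mul1 tfrac_mulDl.

Fact tofrac_zmod : zmod_morphism tofrac.
Proof.
move=> a b; rewrite [RHS]/GRing.add /= [X in tfrac_add _ X]tfrac_oppE.
by rewrite tfrac_addE; apply/mk_tfracP; rewrite /= !mulr1.
Qed.
HB.instance Definition _ := GRing.isZmodMorphism.Build R tfrac tofrac tofrac_zmod.
Fact tofrac_monoid : monoid_morphism tofrac.
Proof.
split=> // a b; rewrite [RHS]tfrac_mulE.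
by apply/mk_tfracP; rewrite /= !mulr1.
Qed.
HB.instance Definition _ :=
  GRing.isMonoidMorphism.Build R tfrac tofrac tofrac_monoid.

(* The integral closure of R in its total ring of fractions. *)
Definition normalization : set tfrac :=
  [set z | exists n (c : 'I_n -> R),
     z ^+ n + \sum_(i < n) tofrac (c i) * z ^+ i = 0].

End TotalFractions.

(* dim_K V/W for K-subspaces W <= V of a K-algebra M with structure map iota,
   with value +oo when V/W is not finite dimensional. *)
Section QuotientDimension.
Variables (K : fieldType) (M : comPzRingType) (iota : {rmorphism K -> M}).

Definition quot_basis (V W : set M) (n : nat) (e : 'I_n -> M) : Prop :=
  [/\ forall i, V (e i),
      forall c : 'I_n -> K,
        W (\sum_(i < n) iota (c i) * e i) -> forall i, c i = 0
    & forall v, V v ->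
        exists c : 'I_n -> K, W (v - \sum_(i < n) iota (c i) * e i)].

Definition quot_dim (V W : set M) : \bar int :=
  if pselect (exists n (e : 'I_n -> M), quot_basis V W e) is left ex
  then (Posz (sval (cid ex)))%:E else +oo%E.

End QuotientDimension.

Section PlaneCurves.
Variable K : closedFieldType.
Implicit Types f g q : fps2 K.
Local Open Scope ereal_scope.

Definition irreducible q : Prop :=
  [/\ (q != 0)%R, q \isn't a GRing.unit
    & forall a b, q = (a * b)%R -> a \is a GRing.unit \/ b \is a GRing.unit].

Definition reduced f : Prop :=
  (f != 0)%R /\ forall q, irreducible q -> ~ exists a, f = (a * q ^+ 2)%R.

Definition int_mult f g : \bar int :=
  quot_dim (@fps2_const K : {rmorphism K -> fps2 K}) [set: fps2 K]
    [set h | exists a b, h = (a * f + b * g)%R].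

Definition delta f : \bar int :=
  quot_dim (@tofrac (pquot f) \o @to_pquot _ f \o @fps2_const K)
    (@normalization (pquot f)) (range (@tofrac (pquot f))).

(* The empty factorization of a unit makes r(u) = 0 and gammat u = 1. *)
Definition factorization f (s : seq (fps2 K)) : Prop :=
  (forall q, q \in s -> irreducible q) /\
  (f = (\prod_(q <- s) q)%R \/ f \is a GRing.unit /\ s = [::]).

(* K[[x,y]] is factorial, so a factorization of f != 0 exists and is unique up
   to order and unit factors. *)
Definition branches f : seq (fps2 K) := xget [::] (factorization f).
Definition nbranches f : nat := size (branches f).

Definition convenient f : bool :=
  (int_mult f fps2_x < +oo) && (int_mult f fps2_y < +oo).

(* The irreducible series that are not convenient are those associated to x or
   to y. *)
Definition gammat_irr f : \bar int :=
  if convenient f then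
    mine (int_mult f (fps2_dx f) - int_mult f fps2_y + 1)
         (int_mult f (fps2_dy f) - int_mult f fps2_x + 1)
  else 0.

Definition gammat f : \bar int :=
  let s := branches f in
  \sum_(i < size s)
     (gammat_irr s`_i + \sum_(j < size s | j != i) int_mult s`_i s`_j)
  - (Posz (size s))%:E + 1.

Definition nonzero_mod (p : nat) (m : \bar int) : Prop :=
  exists2 n : nat, m = (Posz n)%:E & ~~ (p %| n)%N.

(* An infinite i(f_i, x) does not matter: f_i is then associated to x and
   i(f_i, y) = 1, and symmetrically. *)
Definition im_good (p : nat) f : Prop :=
  forall q, q \in branches f ->
    nonzero_mod p (int_mult q fps2_x) \/ nonzero_mod p (int_mult q fps2_y).

End PlaneCurves.

Definition has_characteristic (K : fieldType) (p : nat) : Prop :=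
  (p = 0%N /\ [pchar K] =i pred0) \/ p \in [pchar K].

(* Main.v *)
From HB Require Import structures.
Require Import Defs.
From mathcomp Require Import all_boot all_order all_algebra.
From mathcomp Require Import boolp classical_sets constructive_ereal.
From mathcomp Require Import zify ring.

Set Implicit Arguments.
Unset Strict Implicit.
Unset Printing Implicit Defensive.
Import Order.TTheory GRing.Theory Num.Theory.
Local Open Scope ring_scope.

(* For a branch f of order n in y, put A = K[[x]] and R = A[y]/(f), with fraction
   field L. Weierstrass preparation shows that the integral closure of A in L is
   a discrete valuation ring with residue field K, free over A with basis
   1, t, ..., t^(n-1), where t is a uniformizer with Eisenstein minimal
   polynomial P. If M expresses the powers of y in this basis then
   delta(f) = ord det M, and comparing the discriminants of the two power bases
   gives N(f_y) = (det M)^2 N(P'(t)) up to a unit, that is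
     i(f, f_y) = 2 delta(f) + v(P'(t)),
   where v(P'(t)) >= n - 1, with equality iff the characteristic does not divide
   n = i(f, x). Exchanging x and y and taking the minimum yields the theorem for
   one branch.

   The general case follows from delta(fg) = delta(f) + delta(g) + i(f, g) for
   coprime f, g, since both sides of the inequality are then sums over the
   branches of the same intersection numbers and of the local contributions. *)

(** * Power series *)

Section PowerSeriesRing.
Variable K : fieldType.
Implicit Types f g h : fps2 K.

(** When p divides n, f_y may be a multiple of f and L may be inseparable over K((x)). The
    discriminant identity is therefore proved for monic polynomials over a commutative ring, from an
    explicit dual basis, and an infinite i(f, f_y) is handled in the extended integers. Intersection
    numbers enter as i(f, g) = ord N(g): K[[x,y]]/(f, g) is the cokernel of multiplication by g on
    the free K[[x]]-module R, which gives finiteness and additivity at once. One index computation,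
    the codimension of a sublattice as the order of the transition determinant, serves both delta
    and i(f, g). The minimum over the two coordinates is harmless because delta does not depend on
    them: both terms have the same lower bound 2 delta, and p fails to be good on a branch exactly
    when both bounds are strict. Branches associated to x or y are smooth and contribute 0. Since
    delta is defined in the total ring of fractions, it is moved to whichever model is convenient: a
    field for one branch, a product of two rings for coprime factors. *)

Lemma fps2E0 i j : (0 : fps2 K) i j = 0.
Proof. by rewrite /= mul0rn. Qed.

Lemma fps2E1 i j : (1 : fps2 K) i j = ((i == 0%N) && (j == 0%N))%:R.
Proof. by []. Qed.

Lemma fps2ED f g i j : (f + g) i j = f i j + g i j.
Proof. by []. Qed.

Lemma fps2EB f g i j : (f - g) i j = f i j - g i j.
Proof. by []. Qed.

Lemma fps2EM f g m n : (f * g) m n =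
  \sum_(i < m.+1) \sum_(j < n.+1) f i j * g (m - i)%N (n - j)%N.
Proof. by []. Qed.

Lemma fps2E_sum (I : Type) (r : seq I) (P : pred I) (F : I -> fps2 K) i j :
  (\sum_(k <- r | P k) F k) i j = \sum_(k <- r | P k) F k i j.
Proof. by elim/big_ind2: _ => // [|_ a _ b <- <-]; rewrite ?fps2E0. Qed.

Lemma fps2E_xM f i j : (fps2_x * f) i j = if i is i'.+1 then f i' j else 0.
Proof.
rewrite fps2EM; case: i => [|i].
  by rewrite big_ord_recl big_ord0 big1 ?addr0 // => k _; rewrite /= mul0r.
rewrite big_ord_recl [X in X + _]big1 => [|k _]; last by rewrite /= mul0r.
rewrite add0r big_ord_recl [X in _ + X]big1 ?addr0 => [|k _]; last first.
  by rewrite big1 // => l _; rewrite /= mul0r.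
rewrite big_ord_recl [X in _ + X]big1 ?addr0 => [|k _]; last by rewrite /= mul0r.
by rewrite /= mul1r subn0 subn1.
Qed.

Lemma fps2E_yM f i j : (fps2_y * f) i j = if j is j'.+1 then f i j' else 0.
Proof.
rewrite fps2EM big_ord_recl [X in _ + X]big1 ?addr0 => [|k _]; last first.
  by rewrite big1 // => l _; rewrite /= mul0r.
case: j => [|j]; first by rewrite big_ord_recl big_ord0 /= mul0r addr0.
rewrite big_ord_recl big_ord_recl [X in _ + (_ + X)]big1 => [|k _].
  by rewrite /= mul0r add0r mul1r addr0 !subn0 subn1.
by rewrite /= mul0r.
Qed.

Lemma fps2E_cM c f i j : (fps2_const c * f) i j = c * f i j.
Proof.
rewrite fps2EM big_ord_recl [X in _ + X]big1 ?addr0 => [|k _]; last first.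
  by rewrite big1 // => l _; rewrite /= mul0r.
rewrite big_ord_recl /= !subn0 mulr1n [X in _ + X]big1 ?addr0 // => k _.
by rewrite /= mul0r.
Qed.

Lemma fps2E_xnM n f i j :
  (fps2_x ^+ n * f) i j = if (n <= i)%N then f (i - n)%N j else 0.
Proof.
elim: n i => [|n IH] i; first by rewrite expr0 mul1r subn0.
by rewrite exprS -mulrA fps2E_xM; case: i => // i; rewrite IH.
Qed.

Lemma fps2E_ynM n f i j :
  (fps2_y ^+ n * f) i j = if (n <= j)%N then f i (j - n)%N else 0.
Proof.
elim: n j => [|n IH] j; first by rewrite expr0 mul1r subn0.
by rewrite exprS -mulrA fps2E_yM; case: j => // j; rewrite IH.
Qed.

Lemma fps2_xnE n i j :
  (fps2_x ^+ n : fps2 K) i j = ((i == n) && (j == 0%N))%:R.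
Proof.
rewrite -[_ ^+ _]mulr1 fps2E_xnM fps2E1; case: leqP => [le|lt].
  by rewrite subn_eq0 (eqn_leq i) le andbT.
by rewrite ltn_eqF.
Qed.

Lemma fps2_ynE n i j :
  (fps2_y ^+ n : fps2 K) i j = ((i == 0%N) && (j == n))%:R.
Proof.
rewrite -[_ ^+ _]mulr1 fps2E_ynM fps2E1; case: leqP => [le|lt].
  by rewrite subn_eq0 (eqn_leq j) le andbT.
by rewrite [j == n]ltn_eqF // andbF.
Qed.

Lemma FPS2E (F : nat -> nat -> K) i j : FPS2 F i j = F i j.
Proof. by []. Qed.

#[local] Arguments fps2_coef : simpl never.

Definition fps2_shx n f : fps2 K := FPS2 (fun i j => f (n + i)%N j).

Lemma fps2_shxP n f :
  (forall i j, (i < n)%N -> f i j = 0) -> f = fps2_x ^+ n * fps2_shx n f.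
Proof.
move=> f0; apply: fps2P => i j; rewrite fps2E_xnM; case: leqP => [le|/f0 //].
by rewrite FPS2E subnKC.
Qed.

(** The exponent (m, n) is the lexicographically least one of f. Such leading terms multiply, which
    makes the ring a domain and gives uniqueness in Weierstrass division. *)
Lemma fps2_lexmin f : f != 0 -> exists m n,
  [/\ f m n != 0, forall i j, (i < m)%N -> f i j = 0
    & forall j, (j < n)%N -> f m j = 0].
Proof.
move=> f0.
have ex : exists m, `[< exists n, f m n != 0 >].
  apply: contrapT => h; case/eqP: f0; apply: fps2P => i j; rewrite fps2E0.
  apply/eqP/negPn/negP => fij; apply: h; exists i; apply/asboolP.
  by exists j.
have [m /asboolP ex2 mmin] := ex_minnP ex.
have [n fn nmin] := ex_minnP ex2.
exists m, n; split=> // [i j im|j jn].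
  apply/eqP/negPn/negP => fij; move: im; rewrite ltnNge mmin //.
  by apply/asboolP; exists j.
by apply/eqP/negPn/negP => fij; move: jn; rewrite ltnNge nmin.
Qed.

Fact fps2_mul_eq0 f g : f * g = 0 -> (f == 0) || (g == 0).
Proof.
move=> fg; apply/orP; case: (eqVneq f 0) => [|f0]; [by left|right].
apply/negPn/negP => g0.
have [m [n [fmn fm fn]]] := fps2_lexmin f0.
have [m' [n' [gmn gm gn]]] := fps2_lexmin g0.
have := congr1 (fun h : fps2 K => h (m + m')%N (n + n')%N) fg.
rewrite fps2E0 fps2EM.
have hm : (m < (m + m').+1)%N by rewrite ltnS leq_addr.
have hn : (n < (n + n').+1)%N by rewrite ltnS leq_addr.
rewrite (bigD1 (Ordinal hm)) //= [X in _ + X]big1 ?addr0; last first.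
  move=> i; rewrite -val_eqE /= => im; rewrite big1 // => j _.
  case: (ltngtP i m) im => // [lt|gt] _; first by rewrite fm // mul0r.
  by rewrite gm ?mulr0 //; have := ltn_ord i; lia.
rewrite (bigD1 (Ordinal hn)) //= [X in _ + X]big1 ?addr0; last first.
  move=> j; rewrite -val_eqE /= => jn.
  case: (ltngtP j n) jn => // [lt|gt] _; first by rewrite fn // mul0r.
  by rewrite addKn gn ?mulr0 //; have := ltn_ord j; lia.
by rewrite !addKn => /eqP; rewrite mulf_eq0 (negPf fmn) (negPf gmn).
Qed.

HB.instance Definition _ :=
  GRing.ComUnitRing_isIntegral.Build (fps2 K) fps2_mul_eq0.

Definition fps2_c0 f : K := f 0%N 0%N.

Fact fps2_c0_zmod : zmod_morphism fps2_c0.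
Proof. by []. Qed.
Fact fps2_c0_monoid : monoid_morphism fps2_c0.
Proof.
split=> [|f g]; first by rewrite /fps2_c0 fps2E1.
by rewrite /fps2_c0 fps2EM !big_ord_recl !big_ord0 !addr0.
Qed.
HB.instance Definition _ :=
  GRing.isZmodMorphism.Build (fps2 K) K fps2_c0 fps2_c0_zmod.
HB.instance Definition _ :=
  GRing.isMonoidMorphism.Build (fps2 K) K fps2_c0 fps2_c0_monoid.

Lemma fps2_mulx_inj n f g : fps2_x ^+ n * f = fps2_x ^+ n * g -> f = g.
Proof.
move=> h; apply: fps2P => i j.
have := congr1 (fun h : fps2 K => h (n + i)%N j) h.
by rewrite !fps2E_xnM leq_addr addKn.
Qed.

Lemma fps2_eq_modx f g : (forall N, exists h, f - g = fps2_x ^+ N * h) -> f = g.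
Proof.
move=> h; apply/eqP; rewrite -subr_eq0; apply/eqP/fps2P => i j.
by have [k ->] := h i.+1; rewrite fps2E_xnM ltnn fps2E0.
Qed.

(* One step of a division modulo a power of the base variable can be iterated:
   the quotients and remainders are summed with powers of x as coefficients. *)
Definition fps2_rows (q : nat -> fps2 K) : fps2 K :=
  FPS2 (fun i j => q i 0%N j).

Definition xfree f := forall i j, f i.+1 j = 0.

Lemma fps2_rowsE (q : nat -> fps2 K) N : (forall k, xfree (q k)) ->
  exists h, fps2_rows q = \sum_(k < N) fps2_x ^+ k * q k + fps2_x ^+ N * h.
Proof.
move=> qfree; exists (fps2_shx N (fps2_rows q)).
apply: fps2P => i j; rewrite fps2ED fps2E_sum fps2E_xnM !FPS2E.
case: leqP => [le|lt].
  rewrite subnKC // big1 ?add0r // => k _. rewrite fps2E_xnM leqNgt.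
  case: ltnP => //= ki; have := ltn_ord k => kN.
  have : (0 < i - k)%N by rewrite subn_gt0 (leq_trans kN).
  by case: (i - k)%N => // l _; apply: qfree.
rewrite addr0 (bigD1 (Ordinal lt)) //= fps2E_xnM leqnn subnn.
rewrite big1 ?addr0 // => k; rewrite -val_eqE /= fps2E_xnM => ki.
case: leqP => // le; have : (0 < i - k)%N by rewrite subn_gt0 ltn_neqAle ki.
by case: (i - k)%N => // l _; apply: qfree.
Qed.

Lemma xfreeM f g : xfree f -> xfree g -> xfree (f * g).
Proof.
move=> ff gf i j; rewrite fps2EM big1 // => k _; rewrite big1 // => l _.
case: k => -[|k] /= _; last by rewrite ff mul0r.
by rewrite subn0 gf mulr0.
Qed.

End PowerSeriesRing.

#[local] Arguments fps2_coef : simpl never.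

(** * Weierstrass division *)

Section Weierstrass.
Variable K : fieldType.
Implicit Types f g h : fps2 K.

(** The order of f(0, y) in K[[y]], which will turn out to be i(f, x). *)
Definition yregular n f := (forall j, (j < n)%N -> f 0%N j = 0) /\ f 0%N n != 0.

Lemma fps2E0M f g n :
  (f * g) 0%N n = \sum_(j < n.+1) f 0%N j * g 0%N (n - j)%N.
Proof. by rewrite fps2EM big_ord_recl big_ord0 addr0. Qed.

Definition fps2_shy n f : fps2 K := FPS2 (fun i j => f i (n + j)%N).

(** Division by a unit of K[[y]]: the coefficients of the quotient come one at a time, by clearing
    the constant term with a multiple of u and dividing by y. *)
Lemma xfree_div (u g : fps2 K) : u 0%N 0%N != 0 ->
  exists2 q : fps2 K, xfree q & forall j, (q * u) 0%N j = g 0%N j.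
Proof.
move=> u0.
pose c h := h 0%N 0%N / u 0%N 0%N.
pose next h := fps2_shy 1 (h - fps2_const (c h) * u).
have nextP h j : h 0%N j =
    (fps2_const (c h) * u + fps2_y * next h) 0%N j.
  rewrite fps2ED fps2E_cM fps2E_yM; case: j => [|j].
    by rewrite addr0 divfK.
  by rewrite FPS2E fps2EB fps2E_cM addrC subrK.
pose s k := iter k next g.
pose q : fps2 K := FPS2 (fun i j => if i is _.+1 then 0 else c (s j)).
exists q => [//|j]; pose r N : fps2 K := \sum_(k < N) fps2_y ^+ k * fps2_const (c (s k)).
have sP N l : g 0%N l = (r N * u + fps2_y ^+ N * s N) 0%N l.
  elim: N l => [|N IH] l.
    by rewrite /r big_ord0 mul0r add0r expr0 mul1r.
  rewrite IH /r big_ord_recr /= mulrDl -addrA !fps2ED; congr (_ + _).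
  rewrite -mulrA exprSr -mulrA -fps2ED -mulrDr !fps2E_ynM.
  by case: leqP => // _; apply: nextP.
rewrite (sP j.+1) fps2ED fps2E_ynM ltnn addr0 !fps2E0M.
apply: eq_bigr => k _; congr (_ * _).
rewrite fps2E_sum (bigD1 (Ordinal (ltn_ord k))) //= big1 => [|l].
  rewrite fps2E_ynM leqnn subnn [fps2_const _ _ _]FPS2E.
  by rewrite eqxx mulr1n addr0.
rewrite -val_eqE /= => lk; rewrite fps2E_ynM; case: leqP => // le.
rewrite [fps2_const _ _ _]FPS2E subn_eq0 leqNgt ltn_neqAle lk le.
by rewrite mulr0n.
Qed.

Definition fps2_row0 f : fps2 K := FPS2 (fun i j => if i is _.+1 then 0 else f 0%N j).

Lemma fps2_row0P f : f = fps2_row0 f + fps2_x * fps2_shx 1 f.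
Proof.
apply: fps2P => -[|i] j; rewrite fps2ED fps2E_xM [fps2_row0 _ _ _]FPS2E.
  by rewrite addr0.
by rewrite add0r FPS2E.
Qed.

Lemma xfree_eq f g : xfree f -> xfree g -> (forall j, f 0%N j = g 0%N j) -> f = g.
Proof. by move=> ff gf fg; apply: fps2P => -[|i] j; rewrite ?ff ?gf. Qed.

(** At x = 0, f is y^n times a unit of K[[y]], so dividing there amounts to cutting g(0, y) at y^n;
    the error is divisible by x. *)
Lemma weierstrass_step n f g : yregular n f -> exists q r g',
  [/\ g = q * f + r + fps2_x * g', xfree q, xfree r
    & forall i j, (n <= j)%N -> r i j = 0].
Proof.
move=> [f0 fn]; pose u := fps2_shy n (fps2_row0 f).
have uE : u 0%N 0%N != 0 by rewrite FPS2E addn0.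
have fE : fps2_row0 f = fps2_y ^+ n * u.
  apply: xfree_eq => // [i j|j]; rewrite fps2E_ynM; first by case: leqP.
  by rewrite !FPS2E; case: leqP => [le|/f0 //]; rewrite subnKC.
have [q qx qE] := xfree_div (fps2_shy n (fps2_row0 g)) uE.
have {}qE : q * u = fps2_shy n (fps2_row0 g) by apply: xfree_eq => //; exact: xfreeM.
pose r : fps2 K := FPS2 (fun i j => if (n <= j)%N then 0 else fps2_row0 g i j).
have gE : fps2_row0 g = r + fps2_y ^+ n * (q * u).
  apply: fps2P => i j; rewrite fps2ED fps2E_ynM qE [r _ _]FPS2E.
  by case: leqP => [le|]; rewrite ?addr0 // add0r !FPS2E subnKC.
exists q, r, (fps2_shx 1 g - q * fps2_shx 1 f); split=> //.
- rewrite {1}[g]fps2_row0P gE.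
  have -> : q * f = q * (fps2_y ^+ n * u + fps2_x * fps2_shx 1 f).
    by rewrite -fE -fps2_row0P.
  by ring.
- by move=> i j; rewrite FPS2E; case: leqP.
by move=> i j nj; rewrite FPS2E nj.
Qed.

Lemma weierstrass_div n f g : yregular n f -> exists q r,
  g = q * f + r /\ forall i j, (n <= j)%N -> r i j = 0.
Proof.
move=> freg.
have /choice[F FP] h : exists p : fps2 K * fps2 K * fps2 K,
    [/\ h = p.1.1 * f + p.1.2 + fps2_x * p.2, xfree p.1.1, xfree p.1.2
      & forall i j, (n <= j)%N -> p.1.2 i j = 0].
  by have [q [r [g' ?]]] := weierstrass_step h freg; exists (q, r, g').
pose s k := iter k (fun h => (F h).2) g.
pose q k := (F (s k)).1.1; pose r k := (F (s k)).1.2.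
have sP N : g = (\sum_(k < N) fps2_x ^+ k * q k) * f
    + \sum_(k < N) fps2_x ^+ k * r k + fps2_x ^+ N * s N.
  elim: N => [|N IH]; first by rewrite !big_ord0 mul0r !add0r expr0 mul1r.
  have E : s N = q N * f + r N + fps2_x * s N.+1 by have [] := FP (s N).
  by rewrite [LHS]IH [in LHS]E !big_ord_recr exprSr /= -/(s N) -/(s N.+1); ring.
exists (fps2_rows q), (fps2_rows r); split; last first.
  by move=> i j nj; rewrite FPS2E; have [_ _ _ ->] := FP (s i).
apply: fps2_eq_modx => N; rewrite {1}(sP N).
have [k|h ->] := @fps2_rowsE _ q N; first by have [] := FP (s k).
have [k|h' ->] := @fps2_rowsE _ r N; first by have [] := FP (s k).
by exists (s N - h * f - h'); ring.
Qed.

(** If q had least exponent (m, l), then q f would have a nonzero coefficient at (m, l + n), where r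
    vanishes. *)
Lemma weierstrass_uniq n f q r : yregular n f ->
  q * f + r = 0 -> (forall i j, (n <= j)%N -> r i j = 0) -> q = 0 /\ r = 0.
Proof.
move=> [f0 fn] qfr rn.
suff q0 : q = 0 by split=> //; move: qfr; rewrite q0 mul0r add0r.
apply: contrapT => /eqP /fps2_lexmin [m [l [qml qm ql]]].
have := congr1 (fun h : fps2 K => h m (l + n)%N) qfr.
rewrite fps2E0 fps2ED rn ?leq_addl // addr0 fps2EM.
rewrite big_ord_recr big1 ?add0r => [|i _]; last first.
  by rewrite big1 // => j _; rewrite qm ?mul0r //=; exact: ltn_ord.
have hl : (l < (l + n).+1)%N by rewrite ltnS leq_addr.
rewrite (bigD1 (Ordinal hl)) //= subnn addKn big1 ?addr0 => [|j].
  by rewrite add0r => /eqP; rewrite mulf_eq0 (negPf qml) (negPf fn).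
move=> jl; have : j != l :> nat by [].
case: ltngtP => // [lt|gt] _; first by rewrite ql ?mul0r.
by rewrite f0 ?mulr0 //; have := ltn_ord j; lia.
Qed.

Lemma fps2_unitP f : reflect (f 0%N 0%N != 0) (f \is a GRing.unit).
Proof.
apply: (iffP idP) => [|f0].
  by rewrite -[f _ _]/(fps2_c0 f) -unitfE; apply: rmorph_unit.
(* Division by a series of order 0 in y leaves no remainder. *)
have [|q [r [E r0]]] := @weierstrass_div 0 f 1; first by split.
apply/unitrPr; exists q; rewrite mulrC E.
have -> : r = 0 by apply: fps2P => i j; rewrite fps2E0 r0.
by rewrite addr0.
Qed.

Lemma yregular_unitM n f u : u \is a GRing.unit -> yregular n f -> yregular n (u * f).
Proof.
move=> /fps2_unitP u0 [f0 fn]; split=> [j jn|]; rewrite fps2E0M.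
  rewrite big1 // => k _; rewrite f0 ?mulr0 //; have := ltn_ord k; lia.
rewrite big_ord_recl big1 ?addr0 => [|k _]; first by rewrite !subn0 mulf_neq0.
by rewrite /= f0 ?mulr0 // /bump; have := ltn_ord k; lia.
Qed.

Lemma yregular_xNdvd f : ~ (exists h, f = fps2_x * h) -> exists n, yregular n f.
Proof.
move=> xf; have ex : exists n, f 0%N n != 0.
  apply: contrapT => ex; apply: xf; exists (fps2_shx 1 f).
  rewrite -[X in X * _]expr1; apply: fps2_shxP => -[|//] j _.
  by apply/eqP/negPn/negP => fj; apply: ex; exists j.
have [n fn nmin] := ex_minnP ex; exists n; split=> // j jn.
by apply/eqP/negPn/negP => fj; move: jn; rewrite ltnNge nmin.
Qed.

End Weierstrass.

(* K[[x]] is realized as the subring of K[[x,y]] of the series without y. *)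
Section Fps1.
Variable K : fieldType.
Implicit Types f g h : fps2 K.

Definition yfree : {pred fps2 K} := fun f => `[< forall i j, f i j.+1 = 0 >].

(** The substitution y = 0. It is multiplicative and K[[x]] is the set of its fixed points, whence
    the closure of K[[x]] under division. *)
Definition fps2_y0 f : fps2 K := FPS2 (fun i j => if j is _.+1 then 0 else f i 0%N).

Lemma fps2_y0M f g : fps2_y0 (f * g) = fps2_y0 f * fps2_y0 g.
Proof.
apply: fps2P => i j; rewrite [LHS]FPS2E !fps2EM; case: j => [|j].
  by apply: eq_bigr => k _; rewrite !big_ord_recl !big_ord0.
rewrite big1 // => k _; rewrite big1 // => -[[|l] lj] _; rewrite !FPS2E ?mul0r //=.
by rewrite mulr0.
Qed.

Lemma yfreeP f : reflect (fps2_y0 f = f) (f \in yfree).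
Proof.
apply: (iffP idP) => [/asboolP ff|<-]; last by apply/asboolP => i j.
by apply: fps2P => i [|j]; rewrite FPS2E ?ff.
Qed.

Fact yfree_divring : divring_closed yfree.
Proof.
split=> [|f g /yfreeP ff /yfreeP gf|f g /yfreeP ff /yfreeP gf].
- by apply/asboolP => i j; rewrite fps2E1 andbF.
- by apply/yfreeP; rewrite -ff -gf; apply: fps2P => i [|j]; rewrite !FPS2E ?subr0.
have [gu|gnu] := boolP (g \is a GRing.unit).
  apply/yfreeP; apply: (mulIr gu); rewrite -[X in _ * X = _]gf -fps2_y0M.
  by rewrite !divrK.
by rewrite (invr_out gnu); apply/yfreeP; rewrite fps2_y0M ff gf.
Qed.
HB.instance Definition _ := GRing.isDivringClosed.Build (fps2 K) yfree yfree_divring.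

Record fps1 := Fps1 { fps1_val : fps2 K; _ : fps1_val \in yfree }.
HB.instance Definition _ := [isSub for fps1_val].
HB.instance Definition _ := [Choice of fps1 by <:].
HB.instance Definition _ := [SubChoice_isSubIntegralDomain of fps1 by <:].

Implicit Types a b u : fps1.

Lemma fps1_valS a i j : val a i j.+1 = 0.
Proof. by move: a => [f /= /asboolP ->]. Qed.

Lemma fps1P a b : (forall i, val a i 0%N = val b i 0%N) -> a = b.
Proof.
by move=> ab; apply/val_inj/fps2P => i [|j]; rewrite ?ab // !fps1_valS.
Qed.

Fact fps1_of_subproof (c : nat -> K) :
  FPS2 (fun i j => if j is _.+1 then 0 else c i) \in yfree.
Proof. by apply/asboolP. Qed.
Definition fps1_of (c : nat -> K) : fps1 := Fps1 (fps1_of_subproof c).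

Fact fps1_X_subproof : fps2_x \in yfree.
Proof. by apply/asboolP => i j; rewrite FPS2E andbF. Qed.
Definition fps1_X : fps1 := Fps1 fps1_X_subproof.

Fact fps1_const_subproof c : fps2_const c \in yfree.
Proof. by apply/asboolP => i j; rewrite FPS2E andbF. Qed.
Definition fps1_const c : fps1 := Fps1 (fps1_const_subproof c).

Fact fps1_const_zmod : zmod_morphism fps1_const.
Proof. by move=> c d; apply: val_inj; rewrite /= raddfB. Qed.
Fact fps1_const_monoid : monoid_morphism fps1_const.
Proof. by split=> [|c d]; apply: val_inj; rewrite /= ?rmorph1 ?rmorphM. Qed.
HB.instance Definition _ :=
  GRing.isZmodMorphism.Build K fps1 fps1_const fps1_const_zmod.
HB.instance Definition _ :=
  GRing.isMonoidMorphism.Build K fps1 fps1_const fps1_const_monoid.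

Definition fps1_c0 a : K := fps2_c0 (val a).

Fact fps1_c0_zmod : zmod_morphism fps1_c0.
Proof. by []. Qed.
Fact fps1_c0_monoid : monoid_morphism fps1_c0.
Proof. by split=> [|a b]; rewrite /fps1_c0 ?rmorph1 // !rmorphM. Qed.
HB.instance Definition _ := GRing.isZmodMorphism.Build fps1 K fps1_c0 fps1_c0_zmod.
HB.instance Definition _ := GRing.isMonoidMorphism.Build fps1 K fps1_c0 fps1_c0_monoid.

Lemma fps1_c0E a : fps1_c0 a = val a 0%N 0%N. Proof. by []. Qed.
Lemma fps1_c0X : fps1_c0 fps1_X = 0. Proof. by []. Qed.
Lemma fps1_c0_const c : fps1_c0 (fps1_const c) = c.
Proof. by rewrite fps1_c0E FPS2E mulr1n. Qed.

Definition fps1_sh n a : fps1 := fps1_of (fun i => val a (n + i)%N 0%N).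

Lemma fps1_shP n a : (forall i, (i < n)%N -> val a i 0%N = 0) ->
  a = fps1_X ^+ n * fps1_sh n a.
Proof.
move=> a0; apply: val_inj; rewrite rmorphM rmorphXn /=.
rewrite [LHS](@fps2_shxP _ n) => [|i [|j] lt]; rewrite ?fps1_valS ?a0 //.
by congr (_ * _); apply: fps2P => i [|j]; rewrite !FPS2E ?fps1_valS.
Qed.

Lemma fps1_c0_eq0 a : fps1_c0 a = 0 -> exists b, a = fps1_X * b.
Proof.
move=> a0; exists (fps1_sh 1 a); rewrite -[X in X * _]expr1.
by apply: fps1_shP => -[|].
Qed.

Lemma fps1_X_neq0 : fps1_X != 0.
Proof.
apply/eqP => /(congr1 (fun a => val a 1%N 0%N)); rewrite rmorph0 fps2E0 FPS2E /=.
by move/eqP; rewrite oner_eq0.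
Qed.

Lemma fps1_mulX_eq0 n a : fps1_X ^+ n * a = 0 -> a = 0.
Proof.
by move/eqP; rewrite mulf_eq0 expf_eq0 (negPf fps1_X_neq0) andbF => /eqP.
Qed.

Lemma fps1_unitE a : (a \is a GRing.unit) = (fps1_c0 a != 0).
Proof.
apply/idP/idP => [/(rmorph_unit fps1_c0)|a0]; first by rewrite unitfE.
have /fps2_unitP au : val a 0%N 0%N != 0 by [].
have vf : (val a)^-1 \in yfree.
  by rewrite -[_^-1]mul1r rpred_div ?rpred1 //; case: (a).
apply/unitrPr; exists (Fps1 vf); apply: val_inj.
by rewrite rmorphM rmorph1 /= divrr.
Qed.

(** The x-adic order is a relation, so that 0 has no order. *)
Definition fps1_ord a k := exists2 u, u \is a GRing.unit & a = fps1_X ^+ k * u.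

Lemma fps1_ord_ex a : a != 0 -> exists k, fps1_ord a k.
Proof.
move=> a0; have ex : exists n, val a n 0%N != 0.
  apply: contrapT => ex; case/eqP: a0; apply: fps1P => i.
  by rewrite rmorph0 fps2E0; apply/eqP/negPn/negP => ai; apply: ex; exists i.
have [n an nmin] := ex_minnP ex; exists n, (fps1_sh n a).
  by rewrite fps1_unitE fps1_c0E FPS2E addn0.
apply: fps1_shP => i lt; apply/eqP/negPn/negP => ai.
by move: lt; rewrite ltnNge nmin.
Qed.

Lemma fps1_ord_uniq a k l : fps1_ord a k -> fps1_ord a l -> k = l.
Proof.
wlog kl : k l / (k <= l)%N => [W ak al|].
  by case/orP: (leq_total k l) => kl; [apply: W|apply/esym/W].
move=> [u uu ->] [v vu /eqP]; rewrite -(subnKC kl) exprD -mulrA -subr_eq0 -mulrBr.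
move=> /eqP/fps1_mulX_eq0/eqP; rewrite subr_eq0 => /eqP uE.
case: (posnP (l - k)) => [|lk]; first by lia.
move: uu; case: (l - k)%N lk uE => // m _ uE.
by rewrite uE fps1_unitE exprS -mulrA rmorphM /= fps1_c0X mul0r eqxx.
Qed.

Lemma fps1_ordM a b k l :
  fps1_ord a k -> fps1_ord b l -> fps1_ord (a * b) (k + l).
Proof.
move=> [u uu ->] [v vu ->]; exists (u * v); first by rewrite unitrM uu.
by rewrite exprD mulrACA.
Qed.

Lemma fps1_ordX k : fps1_ord (fps1_X ^+ k) k.
Proof. by exists 1; rewrite ?unitr1 ?mulr1. Qed.

Lemma fps1_ord0 a : fps1_ord a 0 <-> a \is a GRing.unit.
Proof.
split=> [[u uu ->]|au]; first by rewrite expr0 mul1r.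
by exists a; rewrite ?expr0 ?mul1r.
Qed.

Lemma fps1_ord_neq0 a k : fps1_ord a k -> a != 0.
Proof.
move=> [u uu ->]; rewrite mulf_neq0 ?expf_neq0 ?fps1_X_neq0 //.
by apply: contraTneq uu => ->; rewrite unitr0.
Qed.

Lemma fps1_trunc (c : nat -> K) N : exists b,
  fps1_of c = \sum_(k < N) fps1_X ^+ k * fps1_const (c k) + fps1_X ^+ N * b.
Proof.
elim: N c => [|N IH] c.
  by exists (fps1_of c); rewrite big_ord0 expr0 mul1r add0r.
have [b bE] := IH (fun i => c i.+1); exists b.
have -> : fps1_of c = fps1_const (c 0%N) + fps1_X * fps1_of (fun i => c i.+1).
  apply: fps1P => i; rewrite rmorphD rmorphM /= fps2ED fps2E_xM !FPS2E.
  by case: i => [|i]; rewrite ?addr0 ?mulr0n ?add0r ?FPS2E.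
rewrite bE big_ord_recl expr0 mul1r mulrDr mulr_sumr addrA exprS mulrA.
by congr (_ + _ + _); apply: eq_bigr => k _; rewrite mulrA -exprS.
Qed.

Definition toO (p : {poly fps1}) : fps2 K := (map_poly val p).[fps2_y].

Fact toO_zmod : zmod_morphism toO.
Proof. by move=> p q; rewrite /toO rmorphB /= hornerD hornerN. Qed.
Fact toO_monoid : monoid_morphism toO.
Proof.
by split=> [|p q]; rewrite /toO ?rmorph1 ?hornerC // rmorphM hornerM.
Qed.
HB.instance Definition _ :=
  GRing.isZmodMorphism.Build {poly fps1} (fps2 K) toO toO_zmod.
HB.instance Definition _ :=
  GRing.isMonoidMorphism.Build {poly fps1} (fps2 K) toO toO_monoid.

Lemma toO_C a : toO a%:P = val a.
Proof. by rewrite /toO map_polyC hornerC. Qed.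

Lemma toO_X : toO 'X = fps2_y.
Proof. by rewrite /toO map_polyX hornerX. Qed.

Lemma toOE p i j : toO p i j = val p`_j i 0%N.
Proof.
elim/poly_ind: p i j => [|p c IH] i j.
  by rewrite rmorph0 coef0 rmorph0 !fps2E0.
rewrite rmorphD rmorphM /= toO_C toO_X mulrC fps2ED fps2E_yM coefD coefC coefMX.
case: j => [|j]; first by rewrite !add0r.
by rewrite IH fps1_valS !addr0.
Qed.

Lemma toO_inj : injective toO.
Proof.
move=> p q pq; apply/polyP => j; apply: fps1P => i; by rewrite -!toOE pq.
Qed.

Lemma toO_ge n (p : {poly fps1}) i j : (size p <= n)%N -> (n <= j)%N -> toO p i j = 0.
Proof.
by move=> pn nj; rewrite toOE nth_default ?(leq_trans pn) // rmorph0 fps2E0.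
Qed.

Lemma toO_poly n f : (forall i j, (n <= j)%N -> f i j = 0) ->
  exists2 p : {poly fps1}, (size p <= n)%N & toO p = f.
Proof.
move=> f0; exists (\poly_(j < n) fps1_of (fun i => f i j)); first exact: size_poly.
apply: fps2P => i j; rewrite toOE coef_poly; case: ltnP => [//|/f0 ->].
by rewrite rmorph0 fps2E0.
Qed.

Lemma toO_c0 p j : toO p 0%N j = (map_poly fps1_c0 p)`_j.
Proof. by rewrite toOE coef_map. Qed.

(** Divide y^n by f and take W = y^n - p, which equals q f. At x = 0 the product q f has order at
    least n, so p vanishes there; comparing the coefficients of y^n shows that q is a unit. *)
Lemma weierstrass_poly n f : yregular n f -> exists (W : {poly fps1}) q,
  [/\ W \is monic, size W = n.+1, map_poly fps1_c0 W = 'X^n,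
     q \is a GRing.unit & toO W = q * f].
Proof.
move=> freg; have [q [r [E rn]]] := weierstrass_div (fps2_y ^+ n) freg.
have [p sp pr] := toO_poly rn; pose W := 'X^n - p.
have WE : toO W = q * f by rewrite rmorphB rmorphXn /= toO_X E -pr addrK.
have sW : size W = n.+1 by rewrite size_polyDl size_polyXn // size_polyN.
have p0 : map_poly fps1_c0 p = 0.
  apply/polyP => j; rewrite coef0 -toO_c0.
  have [jn|nj] := ltnP j n; last by rewrite pr rn.
  have := congr1 (fun g : fps2 K => g 0%N j) WE.
  rewrite fps2E0M big1 => [|k _].
    rewrite rmorphB rmorphXn /= toO_X fps2EB fps2_ynE /= ltn_eqF // sub0r.
    by move/eqP; rewrite oppr_eq0 => /eqP.
  by case: freg => f0 _; rewrite f0 ?mulr0 //; have := ltn_ord k; lia.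
have W0 : map_poly fps1_c0 W = 'X^n by rewrite rmorphB /= map_polyXn p0 subr0.
have qu : q \is a GRing.unit.
  apply/fps2_unitP; have := congr1 (fun g : fps2 K => g 0%N n) WE.
  rewrite toO_c0 W0 coefXn eqxx fps2E0M big_ord_recl big1 => [|k _].
    by rewrite subn0 addr0 => /esym h; apply: contra_eq_neq h => ->; rewrite mul0r eq_sym oner_eq0.
  by case: freg => f0 _; rewrite f0 ?mulr0 //= /bump; have := ltn_ord k; lia.
exists W, q; split=> //.
by rewrite monicE /lead_coef sW /= coefB coefXn eqxx nth_default ?subr0.
Qed.

Lemma weierstrass_poly_div n f g : yregular n f ->
  exists q (p : {poly fps1}), g = q * f + toO p /\ (size p <= n)%N.
Proof.
move=> freg; have [q [r [E rn]]] := weierstrass_div g freg.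
by have [p sp pr] := toO_poly rn; exists q, p; rewrite pr.
Qed.

Lemma weierstrass_poly_uniq n f q (p : {poly fps1}) : yregular n f -> (size p <= n)%N ->
  toO p = q * f -> p = 0.
Proof.
move=> freg sp E; apply: toO_inj; rewrite rmorph0.
have [||_ //] := @weierstrass_uniq _ n f (- q) (toO p) freg.
  by rewrite E mulNr addNr.
by move=> i j; apply: toO_ge.
Qed.

Lemma yregular_toO n (W : {poly fps1}) : map_poly fps1_c0 W = 'X^n -> yregular n (toO W).
Proof.
move=> W0; split=> [j jn|]; rewrite toO_c0 W0 coefXn ?eqxx ?oner_eq0 //.
by rewrite ltn_eqF.
Qed.

End Fps1.

Arguments fps1_X {K}.

(** * Irreducible series are prime *)

Section Gauss.
Variable K : fieldType.
Notation A := (fps1 K).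
Notation X := (@fps1_X K).
Notation red := (map_poly (@fps1_c0 K)).
Implicit Types p q d W : {poly A}.

Lemma red_eq0 p : red p = 0 -> exists q, p = X%:P * q.
Proof.
move=> p0; exists (\poly_(j < size p) fps1_sh 1 p`_j); apply/polyP => j.
rewrite coefCM coef_poly; case: ltnP => [_|le]; last first.
  by rewrite mulr0 nth_default.
rewrite -[X in X * _]expr1; apply: fps1_shP => -[|//] _.
have /= := congr1 (fun q : {poly K} => q`_j) p0.
by rewrite coef_map coef0.
Qed.

Lemma content p : p != 0 -> exists k q, p = (X ^+ k)%:P * q /\ red q != 0.
Proof.
move=> p0; have /fps2_lexmin [m [n [mn mmin _]]] : toO p != 0.
  by apply: contra_neq p0 => p0; apply: toO_inj; rewrite p0 rmorph0.
exists m, (\poly_(j < size p) fps1_sh m p`_j); split.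
  apply/polyP => j; rewrite coefCM coef_poly; case: ltnP => [_|le]; last first.
    by rewrite mulr0 nth_default.
  by apply: fps1_shP => i /mmin; rewrite -toOE.
apply/eqP => /(congr1 (fun q : {poly K} => q`_n)) /=.
rewrite coef_map coef0 coef_poly; case: ltnP => [_|le].
  by rewrite /= fps1_c0E FPS2E addn0 -toOE; apply/eqP.
by move: mn; rewrite (toO_ge _ le) // eqxx.
Qed.

(** Modulo x the coefficients lie in the field K, so x divides q whenever it divides q d with d
    primitive. *)
Lemma gauss m p q d : red d != 0 -> (X ^+ m)%:P * p = q * d ->
  exists q', p = q' * d.
Proof.
move=> d0; elim: m q => [|m IH] q; first by rewrite expr0 mul1r; exists q.
rewrite exprS rmorphM -mulrA => E.
have /red_eq0 [q1 q1E] : red q = 0.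
  apply/eqP; have := congr1 red E; rewrite !rmorphM /= map_polyC /= fps1_c0X.
  by move/eqP; rewrite polyC0 mul0r eq_sym mulf_eq0 (negPf d0) orbF.
apply: (IH q1); move: E; rewrite q1E -mulrA; apply: mulfI.
by rewrite polyC_eq0 fps1_X_neq0.
Qed.

(** An ideal of K[[x]][T] closed under division by x is the trace of an ideal of K((x))[T]. Its
    generator is the primitive part of an element of least degree: pseudo-division leaves no
    remainder and [gauss] removes the powers of x. *)
Lemma saturated_principal (J : {poly A} -> Prop) W :
  (forall a b, J a -> J b -> J (a - b)) -> (forall q a, J a -> J (q * a)) ->
  (forall a, J (X%:P * a) -> J a) -> W != 0 -> J W ->
  exists2 d, J d /\ red d != 0 & forall a, J a -> exists q, a = q * d.
Proof.
move=> JB JM JX W0 JW.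
have ex : exists n, `[< exists d, [/\ J d, d != 0 & size d = n] >].
  by exists (size W); apply/asboolP; exists W.
have [n /asboolP[d [Jd d0 dn]] nmin] := ex_minnP ex.
have JXn m a : J ((X ^+ m)%:P * a) -> J a.
  elim: m a => [|m IH] a; first by rewrite expr0 mul1r.
  by rewrite exprS rmorphM -mulrA => /JX/IH.
have [k [d' [dE d'0]]] := content d0.
exists d'; first by split=> //; apply: (JXn k); rewrite -dE.
move=> a Ja; have := Pdiv.Idomain.divp_eq a d.
set r := modp a d; set q := divp a d; set s := scalp a d => E.
have r0 : r = 0.
  apply: contrapT => /eqP r0; have := Pdiv.Idomain.ltn_modp a d.
  rewrite d0 -/r dn ltnNge => /negP; apply; apply: nmin; apply/asboolP.
  exists r; split=> //; have -> : r = (lead_coef d ^+ s)%:P * a - q * d.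
    by rewrite mul_polyC E addrC addKr.
  by apply: JB; apply: JM.
(* The multiplier created by pseudo-division is a power of x times a unit. *)
have [l [u uu lE]] : exists l, fps1_ord (lead_coef d ^+ s) l.
  by apply: fps1_ord_ex; rewrite expf_neq0 // lead_coef_eq0.
have [|q' q'E] := @gauss l (u%:P * a) ((X ^+ k)%:P * q) d' d'0.
have -> : (X ^+ l)%:P * (u%:P * a) = lead_coef d ^+ s *: a.
    by rewrite lE -mul_polyC rmorphM mulrA.
  by rewrite E r0 addr0 {1}dE; ring.
exists (u^-1%:P * q'); rewrite -mulrA -q'E mulrA -rmorphM mulVr //.
by rewrite rmorph1 mul1r.
Qed.

End Gauss.

Section Prime.
Variable K : closedFieldType.
Implicit Types f g h : fps2 K.

Definition divides f g := exists b, g = b * f.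

Definition prime_fps2 f :=
  ~ f \is a GRing.unit /\ f != 0 /\
  forall g h, divides f (g * h) -> divides f g \/ divides f h.

Lemma dividesB f g h : divides f g -> divides f h -> divides f (g - h).
Proof. by move=> [a ->] [b ->]; exists (a - b); rewrite mulrBl. Qed.
Lemma dividesD f g h : divides f g -> divides f h -> divides f (g + h).
Proof. by move=> [a ->] [b ->]; exists (a + b); rewrite mulrDl. Qed.
Lemma dividesMl f g h : divides f h -> divides f (g * h).
Proof. by move=> [b ->]; exists (g * b); rewrite mulrA. Qed.
Lemma divides_refl f : divides f f.
Proof. by exists 1; rewrite mul1r. Qed.
Lemma divides_unitM f g u : u \is a GRing.unit -> divides f (u * g) -> divides f g.
Proof. by move=> uu [b bE]; exists (u^-1 * b); rewrite -mulrA -bE mulKr. Qed.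

(** If r is the remainder of g modulo f, then x r is that of x g, so it vanishes by uniqueness. *)
Lemma yregular_divides_x n f g : yregular n f -> divides f (fps2_x * g) -> divides f g.
Proof.
move=> freg [c E]; have [q [r [gE rn]]] := weierstrass_div g freg.
have [||_ xr0] := @weierstrass_uniq _ n f (fps2_x * q - c) (fps2_x * r) freg.
- have : fps2_x * g - c * f = 0 by rewrite E subrr.
  by rewrite gE => <-; ring.
- by move=> i j nj; rewrite fps2E_xM; case: i => // i; apply: rn.
exists q; have -> : g = q * f + r by [].
suff -> : r = 0 by rewrite addr0.
by apply: (@fps2_mulx_inj _ 1); rewrite expr1 xr0 mulr0.
Qed.

(** The polynomials p with f dividing p h form a saturated ideal containing the Weierstrass
    polynomial of f. Its generator d thus divides f: if d is a unit then f divides h, and if d is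
    associated to f then f divides g, whose remainder lies in the ideal. *)
Lemma irreducible_prime_yregular n f : yregular n f -> irreducible f -> prime_fps2 f.
Proof.
move=> freg [f0 fnu firr]; split; first exact/negP.
split=> // g h fgh.
have [W [q [Wm sW _ qu WE]]] := weierstrass_poly freg.
pose J p := divides f (toO p * h).
have [|||||d [Jd d0] dgen] := @saturated_principal _ J W.
- move=> a b Ja Jb; have E : toO (a - b) * h = toO a * h - toO b * h.
    by rewrite toO_zmod mulrBl.
  rewrite /J E; exact: dividesB Ja Jb.
- by move=> p a Ja; rewrite /J rmorphM -mulrA; apply: dividesMl.
- move=> a; rewrite /J rmorphM /= toO_C -mulrA.
  exact: yregular_divides_x freg.
- by rewrite -size_poly_gt0 sW.
- by rewrite /J WE; exists (q * h); rewrite mulrAC.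
have [q1 q1E] : exists q1, W = q1 * d.
  by apply: dgen; rewrite /J WE; exists (q * h); rewrite mulrAC.
have fE : f = (q^-1 * toO q1) * toO d.
  have E : toO W = toO q1 * toO d by rewrite q1E rmorphM.
  by rewrite -mulrA -E WE mulKr.
have [u1|u2] := firr _ _ fE; last by right; apply: divides_unitM u2 Jd.
left; have [q2 [p [gE _]]] := weierstrass_poly_div g freg.
have [q3 q3E] : exists q3, p = q3 * d.
  apply: dgen; rewrite /J; have -> : toO p * h = g * h - q2 * h * f.
    by rewrite gE; ring.
  by apply: dividesB => //; exists (q2 * h).
rewrite gE; apply: dividesD; first by exists q2.
rewrite q3E rmorphM; apply: dividesMl; apply: divides_unitM u1 _.
by rewrite -fE; apply: divides_refl.
Qed.

Definition fps2_swap f : fps2 K := FPS2 (fun i j => f j i).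

Fact fps2_swap_zmod : zmod_morphism fps2_swap.
Proof. by move=> f g; apply: fps2P => i j. Qed.
Fact fps2_swap_monoid : monoid_morphism fps2_swap.
Proof.
split=> [|f g]; apply: fps2P => i j; first by rewrite FPS2E !fps2E1 andbC.
by rewrite FPS2E !fps2EM exchange_big.
Qed.
HB.instance Definition _ :=
  GRing.isZmodMorphism.Build (fps2 K) (fps2 K) fps2_swap fps2_swap_zmod.
HB.instance Definition _ :=
  GRing.isMonoidMorphism.Build (fps2 K) (fps2 K) fps2_swap fps2_swap_monoid.

Lemma fps2_swapK : involutive fps2_swap.
Proof. by move=> f; apply: fps2P. Qed.

Lemma fps2_swap_x : fps2_swap fps2_x = fps2_y.
Proof. by apply: fps2P => i j; rewrite !FPS2E andbC. Qed.
Lemma fps2_swap_y : fps2_swap fps2_y = fps2_x.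
Proof. by rewrite -fps2_swap_x fps2_swapK. Qed.
Lemma fps2_swap_const c : fps2_swap (fps2_const c) = fps2_const c.
Proof. by apply: fps2P => i j; rewrite !FPS2E andbC. Qed.
Lemma fps2_swap_dx f : fps2_swap (fps2_dx f) = fps2_dy (fps2_swap f).
Proof. by apply: fps2P. Qed.

Lemma divides_swap f g : divides (fps2_swap f) (fps2_swap g) <-> divides f g.
Proof.
split=> -[b]; last by move=> ->; exists (fps2_swap b); rewrite rmorphM.
by move/(congr1 fps2_swap); rewrite rmorphM !fps2_swapK => ->; exists (fps2_swap b).
Qed.

Lemma fps2_swap_unit f : (fps2_swap f \is a GRing.unit) = (f \is a GRing.unit).
Proof.
apply/idP/idP; last exact: rmorph_unit.
by move/(rmorph_unit fps2_swap); rewrite /= fps2_swapK.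
Qed.

Lemma irreducible_swap f : irreducible f -> irreducible (fps2_swap f).
Proof.
move=> [f0 fnu firr]; split.
- by apply: contra_neq f0 => f0; rewrite -[f]fps2_swapK f0 rmorph0.
- by rewrite fps2_swap_unit.
move=> a b /(congr1 fps2_swap); rewrite fps2_swapK rmorphM => /firr.
by rewrite !fps2_swap_unit.
Qed.

Lemma irreducible_yregular f : irreducible f ->
  (exists n, yregular n f) \/ exists2 u, u \is a GRing.unit & f = u * fps2_x.
Proof.
move=> [f0 fnu firr]; have [[h fE]|xf] := pselect (exists h, f = fps2_x * h).
  right; have [|hu] := firr _ _ fE; last by exists h; rewrite // mulrC.
  by move=> /fps2_unitP/eqP[].
by left; apply: yregular_xNdvd.
Qed.

Lemma yregular_y : yregular 1 (fps2_y : fps2 K).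
Proof. by split=> [[|//] _|]; rewrite !FPS2E ?eqxx ?oner_neq0. Qed.

Lemma irreducible_prime f : irreducible f -> prime_fps2 f.
Proof.
move=> firr; have [[n freg]|[u uu fE]] := irreducible_yregular firr.
  exact: irreducible_prime_yregular freg firr.
(* The remaining series, associated to x, is turned into one of order 1 in y by exchanging the
   variables. *)
have sreg : yregular 1 (fps2_swap f).
  rewrite fE rmorphM /= fps2_swap_x; apply: yregular_unitM yregular_y.
  by rewrite fps2_swap_unit.
have [sn [s0 sp]] := irreducible_prime_yregular sreg (irreducible_swap firr).
split; first by rewrite -fps2_swap_unit.
split=> [|g h /divides_swap]; first by case: firr.
by rewrite rmorphM => /sp[] /divides_swap; [left|right].
Qed.

End Prime.

(** * Quotient dimensions and lattices over K[[x]] *)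

(** Completing C by zero columns gives a square matrix of determinant 0, which has a nonzero left
    kernel vector over the domain itself. *)
Lemma wide_dependent (F : idomainType) m n (C : 'M[F]_(m, n)) : (n < m)%N ->
  exists2 v : 'rV_m, v != 0 & v *m C = 0.
Proof.
move=> nm; pose D : 'M[F]_m := \matrix_(i, k) oapp (C i) 0 (insub (val k)).
have : \det D == 0.
  rewrite -det_tr; apply/det0P; exists (delta_mx 0 (Ordinal nm)).
    by apply/eqP => /rowP/(_ (Ordinal nm))/eqP; rewrite !mxE !eqxx oner_eq0.
  apply/rowP => i; rewrite -rowE !mxE insubN //= -leqNgt //.
case/det0P => v v0 vD; exists v => //; apply/rowP => k.
have := congr1 (fun B : 'rV_m => B 0 (Ordinal (ltn_trans (ltn_ord k) nm))) vD.
rewrite !mxE => {2}<-; apply: eq_bigr => i _; rewrite mxE /=.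
by rewrite -[X in insub X]/(val k) valK.
Qed.

Section QuotientDim.
Variables (K : fieldType) (M : comPzRingType) (iota : {rmorphism K -> M}).
Implicit Types V W U : set M.

Definition subspace W :=
  [/\ W 0, forall u v, W u -> W v -> W (u + v) & forall c v, W v -> W (iota c * v)].

Definition has_dim V W n := exists e : 'I_n -> M, quot_basis iota V W e.

Lemma subspace_sum W n (F : 'I_n -> M) :
  subspace W -> (forall i, W (F i)) -> W (\sum_i F i).
Proof. by move=> [W0 WD _] WF; apply: big_ind => // i _; apply: WF. Qed.

Lemma subspaceN W v : subspace W -> W v -> W (- v).
Proof. by move=> [_ _ WZ] /(WZ (-1)); rewrite rmorphN1 mulN1r. Qed.

Lemma subspaceB W u v : subspace W -> W u -> W v -> W (u - v).
Proof. by move=> sW Wu Wv; have [_ WD _] := sW; apply: WD => //; apply: subspaceN. Qed.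

(** Steinitz modulo W: more than n vectors, written in the basis e, satisfy a nontrivial relation
    modulo W. *)
Lemma independent_le V W n m (e : 'I_n -> M) (g : 'I_m -> M) :
  subspace W -> quot_basis iota V W e -> (forall i, V (g i)) ->
  (forall c : 'I_m -> K, W (\sum_(i < m) iota (c i) * g i) -> forall i, c i = 0) ->
  (m <= n)%N.
Proof.
move=> sW [Ve _ espan] Vg gind; rewrite leqNgt; apply/negP => nm.
have /choice[C CP] j := espan _ (Vg j).
have [v v0 vC] := wide_dependent (\matrix_(j, i) C j i) nm.
case/eqP: v0; apply/rowP => j; rewrite [RHS]mxE.
apply: (gind (fun j => v 0 j)); have [W0 WD WZ] := sW.
have -> : \sum_(i < m) iota (v 0 i) * g i =
    \sum_(i < m) iota (v 0 i) * (g i - \sum_(k < n) iota (C i k) * e k).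
  apply/eqP; rewrite -subr_eq0 -sumrB.
  under eq_bigr do rewrite mulrBr opprB addrC addrNK mulr_sumr.
  rewrite exchange_big big1 //= => k _.
  under eq_bigr do rewrite mulrA -rmorphM.
  rewrite -mulr_suml -rmorph_sum.
  have := congr1 (fun B : 'rV_n => B 0 k) vC; rewrite !mxE.
  by under eq_bigr do rewrite mxE; move=> ->; rewrite rmorph0 mul0r.
by apply: subspace_sum => // i; apply: WZ.
Qed.

Lemma has_dim_uniq V W n m : subspace W -> has_dim V W n -> has_dim V W m -> n = m.
Proof.
move=> sW [e eb] [g gb]; apply/eqP; rewrite eqn_leq; apply/andP; split.
  by case: (eb) => Ve ei _; apply: independent_le sW gb Ve ei.
by case: (gb) => Vg gi _; apply: independent_le sW eb Vg gi.
Qed.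

Lemma quot_dimE V W n : subspace W -> has_dim V W n -> quot_dim iota V W = (Posz n)%:E.
Proof.
move=> sW dn; rewrite /quot_dim; case: pselect => [ex|[]]; last by exists n.
by case: (cid ex) => m dm /=; rewrite (has_dim_uniq sW dm dn).
Qed.

Lemma quot_dim_infinite V W : subspace W ->
  (forall m, exists2 g : 'I_m -> M, forall i, V (g i) &
     forall c : 'I_m -> K, W (\sum_(i < m) iota (c i) * g i) -> forall i, c i = 0) ->
  quot_dim iota V W = +oo%E.
Proof.
move=> sW h; rewrite /quot_dim; case: pselect => // -[n [e eb]].
have [g Vg gi] := h n.+1.
by have := independent_le sW eb Vg gi; rewrite ltnn.
Qed.

Lemma has_dim0 V : subspace V -> has_dim V V 0.
Proof.
move=> sV; exists (fun=> 0); split=> [[]//|c _ []//|v Vv].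
by exists (fun=> 0); rewrite big_ord0 subr0.
Qed.

Lemma has_dimD V W U n m : subspace W -> subspace U ->
  (forall v, U v -> W v) -> (forall v, W v -> V v) ->
  has_dim V W n -> has_dim W U m -> has_dim V U (n + m).
Proof.
move=> sW sU UW WV [e [Ve ei es]] [g [Wg gi gs]].
pose h k := match split k with inl i => e i | inr j => g j end.
have hE (c : 'I_(n + m) -> K) : \sum_k iota (c k) * h k =
    \sum_i iota (c (lshift m i)) * e i + \sum_j iota (c (rshift n j)) * g j.
  rewrite big_split_ord; congr (_ + _); apply: eq_bigr => i _; congr (_ * _).
    by rewrite /h (unsplitK (inl i)).
  by rewrite /h (unsplitK (inr i)).
have gW (c : 'I_m -> K) : W (\sum_j iota (c j) * g j).
  by apply: subspace_sum => // j; case: sW => _ _ WZ; apply: WZ.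
exists h; split=> [k|c|v Vv].
- by rewrite /h; case: (split k) => // j; apply: WV.
- rewrite hE => Uc.
  have c1 : forall i, c (lshift m i) = 0.
    apply: ei; rewrite -[X in W X](addrK (\sum_j iota (c (rshift n j)) * g j)).
    by apply: subspaceB => //; apply: UW.
  have c2 : forall j, c (rshift n j) = 0.
    apply: gi; move: Uc; rewrite [X in U (X + _)]big1 ?add0r // => i _.
    by rewrite c1 rmorph0 mul0r.
  by move=> k; rewrite -[k]splitK; case: (split k) => i /=.
have [c Wc] := es _ Vv; have [d Ud] := gs _ Wc.
exists (fun k => match split k with inl i => c i | inr j => d j end).
rewrite hE opprD addrA.
under eq_bigr do rewrite (unsplitK (inl _)).
by under [X in _ - X]eq_bigr do rewrite (unsplitK (inr _)).
Qed.

End QuotientDim.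

Section Transport.
Variables (K : fieldType) (M1 M2 : comPzRingType).
Variables (iota1 : {rmorphism K -> M1}) (iota2 : {rmorphism K -> M2}).

(** The hypotheses say that [phi] induces an isomorphism from V1/W1 to V2/W2; a basis is pushed
    forward. *)
Lemma has_dim_transport (phi : {additive M1 -> M2}) (V1 W1 : set M1) (V2 W2 : set M2) n :
  (forall c v, phi (iota1 c * v) = iota2 c * phi v) ->
  subspace iota1 V1 -> subspace iota2 W2 ->
  (forall v, V1 v -> V2 (phi v)) -> (forall v, V1 v -> W2 (phi v) <-> W1 v) ->
  (forall w, V2 w -> exists2 v, V1 v & W2 (w - phi v)) ->
  has_dim iota1 V1 W1 n -> has_dim iota2 V2 W2 n.
Proof.
move=> phiZ sV sW phiV phiW phis [e [Ve ei es]].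
have phiS (c : 'I_n -> K) : phi (\sum_i iota1 (c i) * e i) =
    \sum_i iota2 (c i) * phi (e i).
  by rewrite raddf_sum; apply: eq_bigr => i _.
have eV (c : 'I_n -> K) : V1 (\sum_i iota1 (c i) * e i).
  by apply: (subspace_sum sV) => i; case: sV => _ _ VZ; apply: VZ.
exists (phi \o e); split=> [i|c|w /phis[v Vv Ww]]; first exact: phiV.
  by rewrite -phiS => /phiW -/(_ (eV c)); apply: ei.
have [c Wc] := es _ Vv; exists c; rewrite -phiS.
rewrite -(subrK (phi v) w) -addrA -raddfB; have [_ WD _] := sW; apply: WD => //.
apply/phiW => //. by apply: (subspaceB sV).
Qed.

(** The same induced isomorphism, used backwards: basis vectors are replaced by preimages modulo
    W2. *)
Lemma has_dim_lift (phi : {additive M1 -> M2}) (V1 W1 : set M1) (V2 W2 : set M2) n :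
  (forall c v, phi (iota1 c * v) = iota2 c * phi v) ->
  subspace iota1 V1 -> subspace iota2 W2 ->
  (forall v, V1 v -> V2 (phi v)) -> (forall v, V1 v -> W2 (phi v) <-> W1 v) ->
  (forall w, V2 w -> exists2 v, V1 v & W2 (w - phi v)) ->
  has_dim iota2 V2 W2 n -> has_dim iota1 V1 W1 n.
Proof.
move=> phiZ sV sW phiV phiW phis [e [Ve ei es]].
have /choice[g gP] i : exists v, V1 v /\ W2 (e i - phi v).
  by have [v] := phis _ (Ve i); exists v.
have phiS (c : 'I_n -> K) : phi (\sum_i iota1 (c i) * g i) =
    \sum_i iota2 (c i) * phi (g i).
  by rewrite raddf_sum; apply: eq_bigr => i _.
have gV (c : 'I_n -> K) : V1 (\sum_i iota1 (c i) * g i).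
  by apply: (subspace_sum sV) => i; case: sV (gP i) => _ _ VZ [gi _]; apply: VZ.
have eg (c : 'I_n -> K) : W2 (\sum_i iota2 (c i) * e i - \sum_i iota2 (c i) * phi (g i)).
  rewrite -sumrB; apply: (subspace_sum sW) => i; rewrite -mulrBr.
  by case: sW (gP i) => _ _ WZ [_ gi]; apply: WZ.
have [_ WD _] := sW.
exists g; split=> [i|c|v Vv]; first by case: (gP i).
  move=> /(phiW _ (gV c)); rewrite phiS => Wc; apply: ei.
  by rewrite -(subrK (\sum_i iota2 (c i) * phi (g i)) (\sum__ _)); apply: WD.
have [c Wc] := es _ (phiV _ Vv); exists c; apply/phiW.
  by apply: (subspaceB sV).
rewrite raddfB phiS -(subrK (\sum_i iota2 (c i) * e i) (phi v)) -addrA.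
exact: WD.
Qed.

End Transport.

Section Lattice.
Variables (K : fieldType) (B : comPzRingType) (j : {rmorphism fps1 K -> B}).
Notation A := (fps1 K).
Notation X := (@fps1_X K).
Notation c0 := (@fps1_c0 K).
Variable n : nat.
Implicit Types (e : 'I_n -> B) (a : 'rV[A]_n) (C : 'M[A]_n).

Definition comb a e := \sum_i j (a 0 i) * e i.
Definition lattice e : set B := fun z => exists a, z = comb a e.
Definition free_family e := forall a, comb a e = 0 -> a = 0.
Definition change_basis C e : 'I_n -> B := fun i => comb (row i C) e.

Lemma comb0 e : comb 0 e = 0.
Proof. by rewrite /comb big1 // => i _; rewrite mxE rmorph0 mul0r. Qed.

Lemma combD a b e : comb (a + b) e = comb a e + comb b e.
Proof. by rewrite -big_split; apply: eq_bigr => i _; rewrite mxE rmorphD mulrDl. Qed.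

Lemma combZ c a e : comb (c *: a) e = j c * comb a e.
Proof. by rewrite mulr_sumr; apply: eq_bigr => i _; rewrite mxE rmorphM mulrA. Qed.

Lemma combB a b e : comb (a - b) e = comb a e - comb b e.
Proof. by rewrite combD -scaleN1r combZ rmorphN1 mulN1r. Qed.

Lemma comb_delta i e : comb (delta_mx 0 i) e = e i.
Proof.
rewrite /comb (bigD1 i) //= big1 ?addr0 => [|k ki].
  by rewrite mxE !eqxx rmorph1 mul1r.
by rewrite mxE (negPf ki) andbF rmorph0 mul0r.
Qed.

Lemma comb_change C a e : comb a (change_basis C e) = comb (a *m C) e.
Proof.
rewrite [RHS](_ : _ = \sum_i comb (a 0 i *: row i C) e).
  by apply: eq_bigr => i _; rewrite combZ.
rewrite mulmx_sum_row; elim/big_ind2: _ => [|_ b _ c <- <-|//]; first exact: comb0.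
by rewrite combD.
Qed.

Lemma change_basis_free C e : \det C != 0 -> free_family e ->
  free_family (change_basis C e).
Proof.
move=> C0 ef a; rewrite comb_change => /ef aC.
have : a *m C *m \adj C = 0 by rewrite aC mul0mx.
rewrite -mulmxA mul_mx_adj mul_mx_scalar => /rowP h; apply/rowP => i.
by apply/eqP; have /eqP := h i; rewrite !mxE mulf_eq0 (negPf C0).
Qed.

Notation iota := (j \o @fps1_const K).

Lemma lattice_subspace e : subspace iota (lattice e).
Proof.
split=> [|_ _ [a ->] [b ->]|c _ [a ->]]; first by exists 0; rewrite comb0.
  by exists (a + b); rewrite combD.
by exists (fps1_const c *: a); rewrite combZ.
Qed.

Lemma lattice_change C e z : lattice (change_basis C e) z -> lattice e z.
Proof. by move=> [a ->]; exists (a *m C); rewrite comb_change. Qed.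

(** Induction on the order of det C. If it is positive, the rows of C are dependent modulo x; a
    unimodular operation makes one row divisible by x, and dividing that row by x gives a lattice
    one dimension larger whose determinant has order one less. *)
Lemma lattice_index d e C : free_family e -> fps1_ord (\det C) d ->
  has_dim iota (lattice e) (lattice (change_basis C e)) d.
Proof.
move=> ef; elim: d C => [|d IH] C.
  move=> /fps1_ord0 Cu; have <- : lattice e = lattice (change_basis C e).
    apply/seteqP; split=> z; last exact: lattice_change.
    move=> [a ->]; exists (a *m invmx C); rewrite comb_change.
    by rewrite -mulmxA mulVmx ?mulmx1.
  exact/has_dim0/lattice_subspace.
move=> [u uu CE]; have : \det (map_mx c0 C) == 0.
  by rewrite det_map_mx CE exprS !rmorphM /= fps1_c0X !mul0r.
case/det0P=> w0 w00 w0C.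
have [k wk0] : exists k, w0 0 k != 0.
  apply: contrapT => h; case/eqP: w00; apply/rowP => k; rewrite mxE.
  by apply/eqP/negPn/negP => wk; apply: h; exists k.
(* Normalized to have k-th entry 1, so that replacing row k by this combination is unimodular. *)
pose w := (w0 0 k)^-1 *: w0.
have wk : w 0 k = 1 by rewrite mxE mulVf.
have wC : w *m map_mx c0 C = 0 by rewrite -scalemxAl w0C scaler0.
pose wA : 'rV[A]_n := map_mx (@fps1_const K) w.
pose v : 'rV[A]_n := wA - delta_mx 0 k.
pose q : 'cV[A]_n := delta_mx k 0.
have vq : v *m q = 0.
  have wAk : wA 0 k = 1 by rewrite mxE wk rmorph1.
  by apply/matrixP => a b; rewrite !ord1 -colE mxE mxE wAk !mxE !eqxx subrr.
(* As v q = 0, the matrix q v squares to 0 and Q inverts P; left multiplication by P replaces row k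
   by the combination [wA]. *)
pose P : 'M[A]_n := 1%:M + q *m v; pose Q : 'M[A]_n := 1%:M - q *m v.
have QP : Q *m P = 1%:M.
  rewrite /Q mulmxBl mul1mx {2}/P mulmxDr mulmx1 -mulmxA (mulmxA v) vq mul0mx.
  by rewrite mulmx0 addr0 addrK.
have PC i l : (P *m C) i l = if i == k then (wA *m C) 0 l else C i l.
  rewrite mulmxDl mul1mx mxE -mulmxA [X in _ + X]mxE big_ord1 [q _ _]mxE andbT.
  case: eqP => [->|_]; last by rewrite mul0r addr0.
  by rewrite mul1r mulmxBl -rowE !mxE addrC subrK.
pose C' : 'M[A]_n :=
  \matrix_(i, l) if i == k then fps1_sh 1 ((wA *m C) 0 l) else C i l.
pose D : 'M[A]_n := diag_mx (\row_i if i == k then X else 1).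
have wC0 l : c0 ((wA *m C) 0 l) = 0.
  have := congr1 (fun B : 'rV_n => B 0 l) wC; rewrite !mxE rmorph_sum => {2}<-.
  by apply: eq_bigr => i _; rewrite rmorphM !mxE /= fps1_c0_const.
have PCD : P *m C = D *m C'.
  apply/matrixP => i l; rewrite PC mul_diag_mx mxE [C' _ _]mxE [X in X * _]mxE.
  case: eqP => _; last by rewrite mul1r.
  rewrite -[X in X * _]expr1; apply: fps1_shP => -[|//] _.
  by rewrite -fps1_c0E wC0.
have detP : \det P \is a GRing.unit.
  by apply/unitrPr; exists (\det Q); rewrite mulrC -det_mulmx QP det1.
have detD : \det D = X.
  rewrite det_diag (bigD1 k) //= mxE eqxx big1 ?mulr1 // => i ik.
  by rewrite mxE (negPf ik).
have C'E : fps1_ord (\det C') d.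
  exists (\det P * u); first by rewrite unitrM detP.
  apply: (mulfI (fps1_X_neq0 K)); rewrite -{1}detD -det_mulmx -PCD det_mulmx CE.
  by rewrite exprS; ring.
set e' := change_basis C' e.
have e'f : free_family e' by apply: change_basis_free ef; apply: fps1_ord_neq0 C'E.
have latE z : lattice (change_basis C e) z <->
    exists2 a : 'rV_n, z = comb a e' & c0 (a 0 k) = 0.
  split=> [[b ->]|[a -> ak]].
    exists (b *m Q *m D).
      rewrite !comb_change -[in LHS](mul1mx C) -QP -!mulmxA.
      by rewrite PCD.
    rewrite mxE (bigD1 k) //= big1 ?addr0 => [|i ik]; last first.
      by rewrite [D _ _]mxE (negPf ik) mulr0n mulr0.
    have -> : D k k = X by rewrite !mxE !eqxx.
    by rewrite rmorphM /= fps1_c0X mulr0.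
  pose a' : 'rV[A]_n := \row_i if i == k then fps1_sh 1 (a 0 k) else a 0 i.
  have aE : a = a' *m D.
    apply/rowP => i; rewrite mul_mx_diag !mxE; case: eqP => [->|_]; last by rewrite mulr1.
    rewrite mulrC -[X in X * _]expr1; apply: fps1_shP => -[|//] _.
    by rewrite -fps1_c0E.
  exists (a' *m P); rewrite !comb_change aE -!mulmxA.
  by rewrite PCD.
rewrite -addn1; apply: has_dimD (IH _ C'E) _.
- exact: lattice_subspace.
- exact: lattice_subspace.
- by move=> z /latE[a -> _]; exists a.
- exact: lattice_change.
have deltaZ c : iota c * e' k = comb (fps1_const c *: delta_mx 0 k) e'.
  by rewrite combZ comb_delta.
exists (fun=> e' k); split=> [_|c|z [a ->]].
- by exists (delta_mx 0 k); rewrite comb_delta.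
- rewrite big_ord1 deltaZ => /latE[a aE ak] i; rewrite ord1.
  have /rowP/(_ k) : fps1_const (c 0) *: delta_mx 0 k - a = 0 :> 'rV[A]_n.
    by apply: e'f; rewrite combB aE subrr.
  rewrite !mxE !eqxx mulr1 => /(congr1 c0).
  by rewrite rmorphB /= ak fps1_c0_const subr0 rmorph0.
exists (fun=> c0 (a 0 k)); rewrite big_ord1 deltaZ; apply/latE.
exists (a - fps1_const (c0 (a 0 k)) *: delta_mx 0 k); first by rewrite combB.
by rewrite !mxE !eqxx mulr1 rmorphB /= fps1_c0_const subrr.
Qed.

End Lattice.

(** * Discriminants *)

(* The discriminant of A[T]/(P): the linear form [topcoef] (coefficient of
   T^(n-1)) has dual basis given by the coefficients [euler i] of the Bezoutian
   (P(T) - P(U)) / (T - U), hence the trace of h is topcoef (h P'). *)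
Section Discriminant.
Import Pdiv.CommonRing Pdiv.RingMonic.
Variables (A : comNzRingType) (n : nat) (P : {poly A}).
Hypotheses (Pm : P \is monic) (sP : size P = n.+1).
Implicit Types g h : {poly A}.

Notation rem h := (rmodp h P).

Definition mulmod h : 'M[A]_n := \matrix_(i, k) (rem ('X^i * h))`_k.
Definition topcoef h : A := (rem h)`_n.-1.
Definition euler i : {poly A} := \poly_(m < n - i) P`_(m + i).+1.

Lemma size_rmodp h : (size (rem h) <= n)%N.
Proof.
by rewrite -ltnS -sP ltn_rmodp; apply: monic_neq0.
Qed.

Lemma remE h : rem h = \sum_(k < n) (rem h)`_k *: 'X^k.
Proof. by rewrite -{1}[rem h](coefK) -poly_def; apply/polyP => i; rewrite !coef_poly;
  case: (ltnP i (size (rem h))) => [lt|le]; rewrite ?(leq_trans lt (size_rmodp _)) //;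
  case: ifP => // _; rewrite nth_default. Qed.

Lemma topcoefD g h : topcoef (g + h) = topcoef g + topcoef h.
Proof. by rewrite /topcoef rmodpD // coefD. Qed.

Lemma topcoefZ a h : topcoef (a *: h) = a * topcoef h.
Proof. by rewrite /topcoef rmodpZ // coefZ. Qed.

Lemma topcoef_sum (I : Type) (r : seq I) (Q : pred I) (F : I -> {poly A}) :
  topcoef (\sum_(i <- r | Q i) F i) = \sum_(i <- r | Q i) topcoef (F i).
Proof.
elim/big_rec2: _ => [|i y1 y2 _ <-]; last by rewrite topcoefD.
by rewrite /topcoef rmod0p coef0.
Qed.

Lemma topcoef_rem g h : topcoef (rem g * h) = topcoef (g * h).
Proof. by rewrite /topcoef rmodp_mulml. Qed.

(** For j <= i the product has degree below n, and its coefficient of degree n - 1 is read off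
    directly. For j > i, X^(i+1) times [euler i] is P minus its terms of degree at most i, so the
    remainder has degree below j. *)
Lemma topcoef_exp j i : (j < n)%N -> (i < n)%N ->
  topcoef ('X^j * euler i) = (j == i)%:R.
Proof.
move=> jn iN; have [ji|ij] := leqP j i.
  rewrite /topcoef rmodp_small; last first.
    rewrite sP ltnS (leq_trans (size_polyMleq _ _)) // size_polyXn /=.
    have h : (size (euler i) <= n - i)%N by apply: size_poly.
    by rewrite (leq_trans (leq_add (leqnn j) h)) //; lia.
  rewrite coefXnM coef_poly; case: ifP; first by lia.
  case: eqP => [->|ne] _; last by rewrite ifN //; lia.
  rewrite ifT; last by lia.
  have -> : (n.-1 - i + i).+1 = n by lia.
  by rewrite -[n]/(n.+1.-1) -sP; apply/eqP; rewrite -monicE.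
rewrite gtn_eqF //.
have PE : 'X^(i.+1) * euler i = P - take_poly i.+1 P.
  apply/polyP => m; rewrite coefXnM coefB coef_take_poly coef_poly !ltnS.
  case: (leqP m i) => mi; first by rewrite subrr.
  rewrite subr0; case: ltnP => h; first by congr (P`_ _); lia.
  by rewrite nth_default // sP; lia.
have -> : 'X^j * euler i = 'X^(j - i.+1) * P - 'X^(j - i.+1) * take_poly i.+1 P.
  by rewrite -mulrBr -PE mulrA -exprD subnK.
rewrite /topcoef rmodpB // rmodp_mull // sub0r.
rewrite rmodp_small ?coefN; last first.
  rewrite sP ltnS (leq_trans (size_polyMleq _ _)) // size_polyXn /=.
  rewrite (leq_trans (leq_add (leqnn _) (size_take_poly i.+1 P))) //; lia.
rewrite nth_default ?oppr0 // (leq_trans (size_polyMleq _ _)) // size_polyXn /=.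
rewrite (leq_trans (leq_add (leqnn _) (size_take_poly i.+1 P))) //; lia.
Qed.

Lemma topcoef_euler h (i : 'I_n) : topcoef (h * euler i) = (rem h)`_i.
Proof.
rewrite -topcoef_rem {1}remE mulr_suml topcoef_sum (bigD1 i) //= big1 => [|j ji].
  by rewrite -scalerAl topcoefZ topcoef_exp ?eqxx ?mulr1 ?addr0.
by rewrite -scalerAl topcoefZ topcoef_exp // (negPf (ji : (j != i :> nat))) mulr0.
Qed.

(** The Bezoutian on the diagonal U = T is the derivative of P. *)
Lemma sum_euler : \sum_(i < n) 'X^i * euler i = P^`().
Proof.
apply/polyP => m; rewrite coef_deriv coef_sum.
have [mn|nm] := ltnP m n; last first.
  rewrite nth_default ?mul0rn ?sP // big1 // => i _.
  rewrite coefXnM coef_poly; case: ifP => // _; rewrite ifN //; lia.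
rewrite (eq_bigr (fun i : 'I_n => if (i < m.+1)%N then P`_m.+1 else 0)).
  by rewrite -big_mkcond -(big_ord_widen n (fun=> P`_m.+1) mn) sumr_const card_ord.
move=> i _; rewrite coefXnM ltnS ltnNge; case: leqP => //= im.
by rewrite coef_poly ifT ?subnK //; lia.
Qed.

Lemma tr_mulmod h : \tr (mulmod h) = topcoef (h * P^`()).
Proof.
rewrite -sum_euler mulr_sumr topcoef_sum; apply: eq_bigr => i _.
by rewrite mxE -topcoef_euler mulrCA mulrA.
Qed.

(** The Gram matrix of the trace form is that of multiplication by P' times the Gram matrix H of
    [topcoef], and the dual basis [euler] provides an inverse D of H. *)
Lemma det_trace_form : exists2 u : A, exists v, u * v = 1 &
  \det (\matrix_(i < n, j < n) \tr (mulmod ('X^i * 'X^j))) =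
  \det (mulmod P^`()) * u.
Proof.
pose H : 'M[A]_n := \matrix_(i, j) topcoef ('X^i * 'X^j).
pose D : 'M[A]_n := \matrix_(k, i) (euler i)`_k.
have eulerE (i : 'I_n) : \sum_(k < n) (euler i)`_k *: 'X^k = euler i.
  rewrite -poly_def; apply/polyP => k; rewrite coef_poly.
  case: ltnP => // nk; rewrite nth_default //.
  by rewrite (leq_trans (size_poly _ _)) // (leq_trans (leq_subr _ _)).
have HD : H *m D = 1%:M.
  apply/matrixP => i k; rewrite [RHS]mxE -val_eqE /= -(topcoef_exp (ltn_ord i) (ltn_ord k)).
  rewrite -(eulerE k) mulr_sumr topcoef_sum mxE.
  by apply: eq_bigr => l _; rewrite !mxE -scalerAr topcoefZ mulrC.
exists (\det H); first by exists (\det D); rewrite -det_mulmx HD det1.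
rewrite -det_mulmx; congr (\det _); apply/matrixP => i j.
rewrite mxE tr_mulmod mulrAC -topcoef_rem {1}remE mulr_suml topcoef_sum !mxE.
by apply: eq_bigr => k _; rewrite !mxE -scalerAl topcoefZ.
Qed.

End Discriminant.

(** * The valuation ring of a branch *)

(* A finite extension L of K((x)): "finite" is expressed by the linear
   dependence over K[[x]] of any n + 1 elements of L. *)
Section Valuation.
Variables (K : closedFieldType) (L : fieldType) (j : {rmorphism fps1 K -> L}).
Notation A := (fps1 K).
Notation X := (@fps1_X K).
Notation c0 := (@fps1_c0 K).
Notation red := (map_poly c0).
Notation const := (@fps1_const K).
Variable n : nat.
Hypothesis j_inj : forall a, j a = 0 -> a = 0.
Hypothesis dependent : forall w : nat -> L, exists p : {poly A},
  [/\ p != 0, (size p <= n.+1)%N & \sum_(i < n.+1) j p`_i * w i = 0].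
Implicit Types (p q d W : {poly A}) (z w : L).

Notation int := (integralOver j).
Let ev p z := (map_poly j p).[z].

Let evM p q z : ev (p * q) z = ev p z * ev q z.
Proof. by rewrite /ev rmorphM hornerM. Qed.

Let evB p q z : ev (p - q) z = ev p z - ev q z.
Proof. by rewrite /ev rmorphB hornerD hornerN. Qed.

Let ev_comp p q z : ev (p \Po q) z = ev p (ev q z).
Proof. by rewrite /ev map_comp_poly horner_comp. Qed.

Let evC a z : ev a%:P z = j a.
Proof. by rewrite /ev map_polyC hornerC. Qed.

Let evX z : ev 'X z = z.
Proof. by rewrite /ev map_polyX hornerX. Qed.

Let ev_wide m p z : (size p <= m)%N -> ev p z = \sum_(i < m) j p`_i * z ^+ i.
Proof.
move=> pm; rewrite /ev (horner_coef_wide _ (leq_trans (size_poly _ _) pm)).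
by apply: eq_bigr => i _; rewrite coef_map.
Qed.

Let intM := @integral_mul _ _ j.
Let intD := @integral_add _ _ j.
Let intN := @integral_opp _ _ j.
Let int_j a : int (j a) := integral_id j a.
Let int1 : int 1. Proof. by rewrite -(rmorph1 j). Qed.
Let int0 : int 0. Proof. by rewrite -(rmorph0 j). Qed.
Let intX z m : int z -> int (z ^+ m).
Proof. by move=> iz; elim: m => [|m IH]; rewrite ?expr0 // exprS; apply: intM. Qed.
Let int_sum m (F : 'I_m -> L) : (forall i, int (F i)) -> int (\sum_i F i).
Proof. by move=> iF; apply: big_ind => // *; apply: intD. Qed.

Let jX0 : j X != 0.
Proof. by apply/eqP => /j_inj/eqP; rewrite (negPf (fps1_X_neq0 K)). Qed.

(* Integrality with all lower coefficients divisible by x: z has positive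
   valuation. *)
Definition topnil z := exists k W,
  [/\ (0 < k)%N, W \is monic, red W = 'X^k & ev W z = 0].

Let topnil_int z : topnil z -> int z.
Proof. by move=> [k [W [_ Wm _ Wz]]]; exists W => //; apply/rootP. Qed.

(** The polynomials killing z form a saturated ideal because x is invertible in L; [d] replaces the
    minimal polynomial, normalized to be primitive rather than monic. *)
Lemma annihilator z : exists2 d, ev d z = 0 /\ red d != 0 &
  forall p, ev p z = 0 -> exists q, p = q * d.
Proof.
have [p [p0 sp pz]] := dependent (fun i => z ^+ i).
apply: (@saturated_principal _ _ p) => //.
- by move=> a b az bz; rewrite evB az bz subr0.
- by move=> q a az; rewrite evM az mulr0.
- move=> a /eqP; rewrite evM evC mulf_eq0 (negPf jX0) => /eqP //.
- by rewrite (ev_wide _ sp).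
Qed.

(* The Weierstrass polynomial of d at T = 0 divides d, and its degree cannot be
   smaller than that of d because d generates the annihilator of z. *)
Lemma topnil_root0 z d : ev d z = 0 -> red d != 0 ->
  (forall p, ev p z = 0 -> exists q, p = q * d) -> (red d)`_0 = 0 -> topnil z.
Proof.
move=> dz d0 dgen dc0.
have [|k kreg] := @yregular_xNdvd _ (toO d).
  move=> [h hE]; case/eqP: d0; apply/polyP => i; rewrite coef0 -toO_c0 hE.
  by rewrite fps2E_xM.
have k0 : (0 < k)%N.
  by rewrite lt0n; apply/eqP => k0; case: kreg => _; rewrite k0 toO_c0 dc0 eqxx.
have [W [q [Wm sW W0 qu WE]]] := weierstrass_poly kreg.
exists k, W; split=> //.
pose U := Pdiv.CommonRing.rdivp d W; pose r := Pdiv.CommonRing.rmodp d W.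
have dE : d = U * W + r by apply: Pdiv.RingMonic.rdivp_eq.
have sr : (size r <= k)%N.
  by rewrite -ltnS -sW Pdiv.CommonRing.ltn_rmodp monic_neq0.
have r0 : r = 0.
  apply: (weierstrass_poly_uniq (q := q^-1 - toO U) (yregular_toO W0) sr).
  rewrite mulrBl [X in q^-1 * X]WE mulKr // {1}dE rmorphD rmorphM.
  by rewrite addrC addKr.
move: (dz); rewrite dE r0 addr0 evM => /eqP; rewrite mulf_eq0 => /orP[/eqP Uz|/eqP //].
have [q' q'E] := dgen _ Uz.
have : 1 * U = q' * W * U by rewrite mul1r {1}q'E {1}dE r0 addr0; ring.
have U0 : U != 0 by apply: contraTneq d0 => U0; rewrite dE U0 mul0r add0r r0 rmorph0 eqxx.
move/(mulIf U0)/(congr1 (fun p : {poly A} => size p)); rewrite size_poly1.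
have [->|q'0] := eqVneq q' 0; first by rewrite mul0r size_poly0.
by rewrite size_Mmonic // sW; move: q'0; rewrite -size_poly_gt0; lia.
Qed.

(** Reduce the generator d of the annihilator modulo x. If the reduction has positive degree, a root
    c in the algebraically closed field K is the residue of z. If it is a nonzero constant, z has a
    pole and the reversed polynomial of d annihilates its inverse. *)
Lemma trichotomy z :
  (exists c, topnil (z - j (const c))) \/ (z != 0 /\ topnil z^-1).
Proof.
have [d [dz d0] dgen] := annihilator z.
have [sd|sd] := leqP (size (red d)) 1; last first.
  have [c /rootP dc] := closed_rootP (red d) (negbT (gtn_eqF sd)).
  left; exists c; set z' := _ - _.
  have [d' [d'z d'0] d'gen] := annihilator z'.
  apply: (topnil_root0 d'z d'0 d'gen).
  (* Translating by c identifies the annihilators of z and z - c, so the reduction of d' has the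
     root 0. *)
  have [|q qE] := dgen (d' \Po ('X - (const c)%:P)).
    by rewrite ev_comp evB evX evC.
  have -> : d' = (q * d) \Po ('X + (const c)%:P).
    by rewrite -qE -comp_polyA comp_polyB comp_polyX comp_polyC addrK comp_polyXr.
  rewrite -horner_coef0 comp_polyM rmorphM hornerM /= [X in _ * X](_ : _ = 0) ?mulr0 //.
  rewrite map_comp_poly rmorphD /= map_polyX map_polyC /= fps1_c0_const.
  by rewrite horner_comp hornerD hornerX hornerC add0r.
right.
have rdE : red d = (c0 d`_0)%:P by rewrite [LHS]size1_polyC // coef_map.
have du : d`_0 \is a GRing.unit.
  by rewrite fps1_unitE; move: d0; rewrite rdE polyC_eq0.
have z0 : z != 0.
  apply: contraTneq du => z0; move: dz; rewrite z0 /ev horner_coef0 coef_map /=.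
  by move/j_inj => ->; rewrite unitr0.
split=> //; pose s := (size d).-1.
have d00 : d != 0 by apply: contraNneq d0 => ->; rewrite rmorph0.
have sE : size d = s.+1 by rewrite /s prednK // size_poly_gt0.
have s0 : (0 < s)%N.
  rewrite lt0n; apply/eqP => s0; move: dz; rewrite (ev_wide z (leqnn _)) sE s0 big_ord1.
  by rewrite mulr1 => /j_inj dz; move: du; rewrite dz unitr0.
(* The reversal of d, made monic by the unit constant term of d; modulo x only its leading term
   survives. *)
pose W : {poly A} := \poly_(i < s.+1) (d`_(s - i) / d`_0).
have sW : size W = s.+1.
  by apply: size_poly_eq; rewrite subnn divrr ?oner_neq0.
exists s, W; split=> //.
- by rewrite monicE /lead_coef sW coef_poly ltnSn subnn divrr.
- apply/polyP => i; rewrite coef_map coefXn coef_poly ltnS /=.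
  case: ltngtP => [lt|gt|->].
  + rewrite rmorphM /=; have /= := congr1 (fun p : {poly K} => p`_(s - i)) rdE.
    by rewrite coef_map coefC subn_eq0 leqNgt lt => ->; rewrite mul0r.
  + by rewrite rmorph0.
  by rewrite subnn divrr ?rmorph1.
apply: (mulIf (expf_neq0 s z0)); rewrite mul0r (@ev_wide s.+1) ?sW // mulr_suml.
have : j (d`_0)^-1 * ev d z = 0 by rewrite dz mulr0.
rewrite (@ev_wide s.+1) ?sE // mulr_sumr (reindex_inj rev_ord_inj) /= => E; rewrite -[RHS]E {E}.
apply: eq_bigr => i _; have is' : (i <= s)%N by rewrite -ltnS.
have zE m : (m <= s)%N -> z^-1 ^+ m * z ^+ s = z ^+ (s - m).
  by move=> ms; rewrite -{1}(subnK ms) exprD mulrC exprVn mulfK ?expf_neq0.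
rewrite coef_poly ltn_ord rmorphM subSS -!mulrA.
by rewrite zE // mulrCA.
Qed.

(** Multiplying a monic equation of degree s for 1/x by x^s and setting x = 0 would give 1 = 0. *)
Lemma X_inv_Nint : ~ int (j X)^-1.
Proof.
move=> [p pm /rootP]; rewrite -/(ev p _) => pX.
pose s := (size p).-1; have sE : size p = s.+1.
  by rewrite /s prednK // size_poly_gt0 monic_neq0.
have : j (\sum_(i < s.+1) p`_i * X ^+ (s - i)) = 0.
  have -> : 0 = ev p (j X)^-1 * j X ^+ s by rewrite pX mul0r.
  rewrite rmorph_sum (@ev_wide s.+1) ?sE // mulr_suml.
  apply: eq_bigr => i _; have is' : (i <= s)%N by rewrite -ltnS.
  have zE m : (m <= s)%N -> (j X)^-1 ^+ m * j X ^+ s = j X ^+ (s - m).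
    by move=> ms; rewrite -{1}(subnK ms) exprD mulrC exprVn mulfK ?expf_neq0.
  by rewrite -mulrA zE // rmorphM rmorphXn.
move/j_inj/(congr1 c0); rewrite big_ord_recr /= subnn mulr1 rmorphD rmorph0.
rewrite rmorph_sum big1 ?add0r => [|i _].
  have -> : p`_s = lead_coef p by rewrite lead_coefE.
  by rewrite (monicP pm) rmorph1; apply/eqP/oner_neq0.
rewrite rmorphM rmorphXn /= fps1_c0X expr0n subn_eq0 leqNgt ltn_ord /=.
by rewrite mulr0.
Qed.

(** The maximal ideal of the integral closure. Zero is listed apart because its formal inverse 0 is
    integral. *)
Definition maxid z := int z /\ (z = 0 \/ ~ int z^-1).

(** A Weierstrass equation reads z^k = - x q(z); if 1/z were integral, so would be 1/x = - q(z)
    z^(-k). *)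
Let topnil_maxid z : topnil z -> maxid z.
Proof.
move=> tz; have iz := topnil_int tz; split=> //.
have [->|z0] := eqVneq z 0; [by left|right] => iVz.
have [k [W [k0 Wm W0 Wz]]] := tz.
have WkE : W = 'X^k + (W - 'X^k) by rewrite addrC subrK.
have /red_eq0 [q qE] : red (W - 'X^k) = 0 by rewrite rmorphB /= map_polyXn W0 subrr.
have intq : int (ev q z).
  rewrite (ev_wide z (leqnn _)); apply: int_sum => i.
  by apply: intM; [apply: int_j|apply: intX].
have zk : z ^+ k = j X * - ev q z.
  apply/eqP; rewrite mulrN -addr_eq0; apply/eqP; rewrite -Wz WkE qE.
  by rewrite /ev rmorphD hornerD /= map_polyXn hornerXn rmorphM hornerM /= map_polyC hornerC.
apply: X_inv_Nint; have -> : (j X)^-1 = - ev q z * z^-1 ^+ k.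
  apply: (mulfI jX0); rewrite divff // mulrA -zk exprVn divff //.
  by rewrite expf_neq0.
by apply: intM; [apply: intN|apply: intX].
Qed.

Let int_or_inv z : z != 0 -> int z \/ int z^-1.
Proof.
have [[c tz]|[_ tz]] := trichotomy z => z0; last by right; apply: topnil_int.
left; rewrite -(subrK (j (const c)) z); apply: intD; last exact: int_j.
exact: topnil_int.
Qed.

Let int_residue z : int z -> exists c, maxid (z - j (const c)).
Proof.
move=> iz; have [[c tz]|[z0 tz]] := trichotomy z.
  by exists c; apply: topnil_maxid.
have [_ [zV0|]] := topnil_maxid tz; last by rewrite invrK.
by case/eqP: z0; rewrite -[z]invrK zV0 invr0.
Qed.

Let maxidM z w : maxid z -> int w -> maxid (z * w).
Proof.
move=> [iz z0] iw; split; first exact: intM.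
have [->|zw0] := eqVneq (z * w) 0; [by left|right] => izw.
case: z0 => [zE|]; first by move: zw0; rewrite zE mul0r eqxx.
apply; have -> : z^-1 = w * (z * w)^-1.
  by move: zw0; rewrite mulf_eq0 negb_or => /andP[z0 w0]; rewrite invfM mulrC mulfVK.
exact: intM.
Qed.

Let maxidD z w : maxid z -> maxid w -> maxid (z + w).
Proof.
wlog : z w / w != 0 /\ int (z / w) => [W mz mw|[w0 izw] mz mw].
  have [->|w0] := eqVneq w 0; first by rewrite addr0.
  have [->|z0] := eqVneq z 0; first by rewrite add0r.
  have zw0 : z / w != 0 by rewrite mulf_neq0 ?invr_eq0.
  have [?|iwz] := int_or_inv zw0; first exact: W.
  by rewrite addrC; apply: W => //; split=> //; rewrite -invf_div.
have -> : z + w = w * (z / w + 1) by rewrite mulrDr mulr1 mulrC divfK.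
by apply: maxidM => //; apply: intD.
Qed.

Let maxid_sum m (F : 'I_m -> L) : (forall i, maxid (F i)) -> maxid (\sum_i F i).
Proof.
move=> mF; apply: (big_ind maxid) => [|x y|i _]; [|exact: maxidD|exact: mF].
by split; [exact: int0|left].
Qed.

Let maxidN1 : ~ maxid 1.
Proof.
move=> [_ [/eqP|]]; first by rewrite oner_eq0.
by rewrite invr1; apply.
Qed.

Let maxid_X : maxid (j X).
Proof. by split; [apply: int_j|right; apply: X_inv_Nint]. Qed.

(* A family of elements whose successive valuations increase strictly, all
   less than that of x, is linearly independent. *)
Lemma chain_free m (w : nat -> L) :
  (forall i, int (w i)) ->
  (forall i, (i < m)%N -> exists2 v, maxid v & j X = w i * v) ->
  (forall i k, (i < k)%N -> (k < m)%N -> exists2 v, maxid v & w k = w i * v) ->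
  forall p, (size p <= m)%N -> \sum_(i < m) j p`_i * w i = 0 -> p = 0.
Proof.
move=> wint wX ww p pm ps; apply: contrapT => /eqP p0.
have [l [q [pE q0]]] := content p0.
have qs : \sum_(i < m) j q`_i * w i = 0.
  apply: (mulfI (expf_neq0 l jX0)); rewrite mulr0 -[RHS]ps mulr_sumr.
  by apply: eq_bigr => i _; rewrite pE coefCM rmorphM rmorphXn mulrA.
have ex : exists i, c0 q`_i != 0.
  exists (size (red q)).-1; rewrite -coef_map; apply: contraNneq q0 => h.
  by rewrite -lead_coef_eq0 lead_coefE h.
(* The first coefficient not divisible by x. Every other term is w_i times a non-unit: the earlier
   ones through their coefficient, since x lies in w_i times the maximal ideal, the later ones
   through w_k. *)
have [i qi imin] := ex_minnP ex.
have im : (i < m)%N.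
  rewrite ltnNge; apply/negP => mi; move: qi; rewrite nth_default ?rmorph0 ?eqxx //.
  apply: leq_trans mi; move: pm; rewrite pE.
  by rewrite mul_polyC size_scale // expf_neq0 ?fps1_X_neq0.
have w0 : w i != 0.
  have [v _ Xv] := wX i im; apply: contraNneq jX0 => w0.
  by rewrite Xv w0 mul0r.
have step (k : 'I_m) : exists v, k != Ordinal im -> maxid v /\ j q`_k * w k = w i * v.
  rewrite -val_eqE /=; case: (ltngtP k i) => [ki|ik|_]; last by exists 0.
    have [q' q'E] : exists b, q`_k = X * b.
      apply: fps1_c0_eq0; apply/eqP/negPn/negP => qk.
      by move: ki; rewrite ltnNge imin.
    have [v mv Xv] := wX i im; exists (v * (j q' * w k)) => _; split.
      by apply: maxidM => //; apply: intM => //; apply: int_j.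
    by rewrite q'E rmorphM Xv !mulrA.
  have [v mv kv] := ww i k ik (ltn_ord k); exists (v * j q`_k) => _; split.
    by apply: maxidM => //; apply: int_j.
  by rewrite kv mulrC mulrA.
have /choice[v vP] := step.
move: qs; rewrite (bigD1 (Ordinal im)) //=.
rewrite (eq_bigr (fun k => w i * v k)) => [|k ki]; last by have [] := vP k ki.
rewrite -mulr_sumr mulrC -mulrDr => /eqP; rewrite mulf_eq0 (negPf w0) /= addr_eq0 => /eqP qE.
have mq : maxid (- \sum_(k < m | k != Ordinal im) v k).
  rewrite -mulN1r mulrC; apply: maxidM; last by apply: intN.
  rewrite big_mkcond; apply: maxid_sum => k; case: ifP => [/vP[]//|_].
  by split; [exact: int0|left].
apply: maxidN1; rewrite -(rmorph1 j) -(@mulrV _ q`_i) ?fps1_unitE // rmorphM qE.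
by apply: maxidM => //; apply: int_j.
Qed.

(* A factorization of x of maximal length in the maximal ideal consists of
   uniformizers. *)
Let uniformizer_chain m := exists s : seq L,
  [/\ size s = m, forall z, z \in s -> maxid z & j X = \prod_(z <- s) z].

(** A chain longer than n has n + 1 proper initial products, of increasing valuation below that of
    x, hence independent by [chain_free]; this contradicts [dependent]. *)
Lemma uniformizer_chain_le m : uniformizer_chain m -> (m <= n)%N.
Proof.
move=> [s [sm smax sX]]; rewrite leqNgt; apply/negP => nm.
pose w i := \prod_(z <- take i s) z.
have iprod (r : seq L) : {subset r <= s} -> int (\prod_(z <- r) z).
  move=> rs; rewrite big_seq; apply: (big_ind int) => [|x y|z /rs /smax[]//]; first exact: int1.
  exact: intM.
have dropE i : (i < m)%N -> drop i s = nth 0 s i :: drop i.+1 s.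
  by move=> im; rewrite (drop_nth 0) ?sm.
have wX i : (i < m)%N -> j X = w i * (nth 0 s i * \prod_(z <- drop i.+1 s) z).
  by move=> im; rewrite sX -{1}(cat_take_drop i s) big_cat /= dropE // big_cons.
have wk i k : (i < k)%N -> (k < m)%N ->
    w k = w i * (nth 0 s i * \prod_(z <- take (k - i.+1) (drop i.+1 s)) z).
  move=> ik km; rewrite /w -{1}(cat_take_drop i (take k s)) big_cat /=.
  rewrite take_takel ?(ltnW ik) //; congr (_ * _).
  rewrite -{1}(subnK (ltnW ik)) -take_drop dropE ?(ltn_trans ik) //.
  have -> : (k - i = (k - i.+1).+1)%N by lia.
  by rewrite /= big_cons.
have smem i : (i < m)%N -> maxid (nth 0 s i).
  by move=> im; apply: smax; rewrite mem_nth ?sm.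
have [p [p0 sp pw]] := dependent w.
case/eqP: p0; apply: (@chain_free n.+1 w) => //.
- by move=> i; apply: iprod => z; apply: mem_take.
- move=> i im; have {}im : (i < m)%N by apply: leq_trans nm.
  exists (nth 0 s i * \prod_(z <- drop i.+1 s) z); last exact: wX.
  by apply: maxidM; [apply: smem|apply: iprod => z; apply: mem_drop].
- move=> i k ik km; have {}km : (k < m)%N by apply: leq_trans nm.
  exists (nth 0 s i * \prod_(z <- take (k - i.+1) (drop i.+1 s)) z); last exact: wk.
  apply: maxidM; first exact/smem/(ltn_trans ik).
  by apply: iprod => z /mem_take; apply: mem_drop.
Qed.

(** In a chain of maximal length no member is a product of two non-units. If z / t were not
    integral, t = z (t / z) would be such a product; so t generates the maximal ideal, and all
    members of the chain are associated to t. *)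
Lemma uniformizer_ex : exists t k u, [/\ maxid t /\ t != 0, (0 < k <= n)%N,
  int u /\ int u^-1, u != 0 & t ^+ k = j X * u] /\
  forall z, maxid z -> exists2 w, int w & z = t * w.
Proof.
have ex1 : exists m, `[< uniformizer_chain m >].
  exists 1%N; apply/asboolP; exists [:: j X]; split=> //; last by rewrite big_seq1.
  by move=> z; rewrite inE => /eqP ->.
have bnd m : `[< uniformizer_chain m >] -> (m <= n)%N.
  by move/asboolP/uniformizer_chain_le.
have [k /asboolP [s [sk smax sX]] kmax] := ex_maxnP ex1 bnd.
have sN0 z : z \in s -> z != 0.
  move=> zs; apply: contraNneq jX0 => z0; rewrite sX (big_rem z) //= z0.
  by rewrite mul0r.
have split_chain r a b : r \in s -> r = a * b -> maxid a -> maxid b -> False.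
  move=> rs rE ma mb; suff : (k.+1 <= k)%N by rewrite ltnn.
  apply: kmax; apply/asboolP; exists (a :: b :: rem r s); split.
  - rewrite /= size_rem // sk prednK //; case: (s) sk rs => // ? ? /= <- //.
  - by move=> z; rewrite !inE => /or3P[/eqP -> //|/eqP -> //|/mem_rem/smax].
  by rewrite !big_cons mulrA -rE sX (big_rem r).
have k0 : (0 < k)%N.
  by apply: kmax; apply/asboolP; case: ex1 => _ _; exists [:: j X]; split=> //;
    [move=> z; rewrite inE => /eqP ->|rewrite big_seq1].
have [t ts] : exists t, t \in s.
  by case: (s) sk k0 => [<- //|t s' _ _]; exists t; rewrite mem_head.
have t0 := sN0 t ts.
have gen z : maxid z -> exists2 w, int w & z = t * w.
  move=> mz; have [->|z0] := eqVneq z 0; first by exists 0; rewrite ?mulr0.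
  have tz0 : t / z != 0 by rewrite mulf_neq0 ?invr_eq0.
  have [izt|Nizt] := pselect (int (z / t)); first by exists (z / t); rewrite // mulrC divfK.
  case: (split_chain t z (t / z) ts _ mz); first by rewrite mulrC divfK.
  split; last by right; rewrite invf_div.
  by case: (int_or_inv tz0) => //; rewrite invf_div.
exists t, k; have sunit z : z \in s -> exists2 v, z = t * v & [/\ int v, int v^-1 & v != 0].
  move=> zs; have [v iv zE] := gen _ (smax _ zs); exists v => //.
  have v0 : v != 0 by apply: contraNneq (sN0 z zs) => v0; rewrite zE v0 mulr0.
  split=> //; apply: contrapT => iv'.
  by apply: (split_chain z t v zs zE (smax _ ts)); split=> //; right.
have [v [vE iv iv' v0]] : exists v, [/\ j X = t ^+ k * v, int v, int v^-1 & v != 0].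
  rewrite sX -sk; elim: (s) sunit => [|z r IH] sunit.
    exists 1; rewrite big_nil expr0 mulr1 invr1 oner_neq0; split=> //; exact: int1.
  have [|v [vE iv iv' v0]] := IH; first by move=> y yr; apply: sunit; rewrite inE yr orbT.
  have [w wE [iw iw' w0]] := sunit z (mem_head _ _).
  exists (v * w); rewrite big_cons vE wE exprS mulf_neq0 // invfM.
  by split; [ring|apply: intM|apply: intM|].
exists v^-1; split; last exact: gen.
split; rewrite ?invr_eq0 ?k0 ?invrK //; first by split=> //; exact: smax.
- by apply: bnd; apply/asboolP; exists s.
- by rewrite vE mulfK.
Qed.

(** Suppose y != 0. Removing powers of T from an equation of y leaves one with constant term q_0 !=
    0, and y divides q_0. If q_0 has order l, divisibility of y by x^(l+1) makes 1/x integral. *)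
Lemma separated y : (forall N, exists2 v, int v & y = j X ^+ N * v) -> y = 0.
Proof.
move=> yX; apply: contrapT => /eqP y0.
have iy : int y by have [v iv ->] := yX 0%N; rewrite expr0 mul1r.
have [p [p0 sp pw]] := dependent (fun i => y ^+ i).
have [m [q qr pE]] := multiplicity_XsubC p 0.
move: qr; rewrite p0 /= => q0.
have : ev p y = 0 by rewrite (ev_wide _ sp).
rewrite pE subr0 evM => /eqP; rewrite mulf_eq0.
have -> : ev ('X ^+ m) y = y ^+ m by rewrite /ev map_polyXn hornerXn.
rewrite expf_eq0 (negPf y0) andbF orbF => /eqP qy.
have [l [u uu lE]] : exists l, fps1_ord q`_0 l.
  by apply: fps1_ord_ex; rewrite -horner_coef0 -rootE.
have [v [iv vE]] : exists v, int v /\ j q`_0 = y * v.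
  have sq : (0 < size q)%N by rewrite size_poly_gt0; apply: contraNneq q0 => ->; rewrite root0.
  exists (- \sum_(i < (size q).-1) j q`_i.+1 * y ^+ i); split.
    by apply: intN; apply: int_sum => i; apply: intM; [apply: int_j|apply: intX].
  apply/eqP; rewrite mulrN -addr_eq0 mulr_sumr; apply/eqP.
  rewrite -[RHS]qy (ev_wide y (leqnn _)) -[in RHS](prednK sq) big_ord_recl mulr1.
  by congr (_ + _); apply: eq_bigr => i _; rewrite exprS mulrCA.
have [v' iv' yE] := yX l.+1.
have ju : j u != 0 by apply: contraTneq uu => /j_inj ->; rewrite unitr0.
apply: X_inv_Nint; have -> : (j X)^-1 = v' * v * j (u^-1).
  apply: (mulfI jX0); rewrite divff //; apply: (mulfI (expf_neq0 l jX0)).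
  have -> : j X ^+ l * (j X * (v' * v * j u^-1)) = y * v * j u^-1.
    by rewrite yE exprS; ring.
  by rewrite mulr1 -vE lE rmorphM rmorphXn -mulrA -rmorphM divrr // rmorph1 mulr1.
by apply: intM; [apply: intM|apply: int_j].
Qed.

(** Integral elements are expanded in powers of t with digits in K. As t^k is x up to a unit, k
    digits are taken for each power of x, and K[[x]] collects the digits of each residue class of
    exponents; [separated] shows that the resulting combination is the given element. *)
Lemma valuation_ring_structure : exists t k u,
  [/\ int t /\ (0 < k <= n)%N, [/\ int u, int u^-1 & u != 0], t ^+ k = j X * u,
   forall p : {poly A}, (size p <= k)%N -> ev p t = 0 -> p = 0 &
   forall z, int z -> exists2 p : {poly A}, (size p <= k)%N & z = ev p t] /\
  forall c z, c != 0 -> int z ->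
    j (const c) + t * z != 0 /\ int (j (const c) + t * z)^-1.
Proof.
have [t [k [u [[[mt t0] k0n [iu iu'] u0 tk]] tgen]]] := uniformizer_ex.
have [it tV] := mt.
have iuk m : (m < k)%N -> j X = t ^+ m * (t * (t ^+ (k - m.+1) * u^-1)).
  move=> mk; apply: (mulIf u0); rewrite -tk !mulrA mulfVK // -exprSr -exprD.
  by rewrite subnKC.
have step z : int z -> exists c : 'I_k -> K, exists2 z', int z' &
    z = \sum_(i < k) j (const (c i)) * t ^+ i + j X * z'.
  move=> iz.
  have [c [z' iz' zE]] : exists c : 'I_k -> K, exists2 z', int z' &
      z = \sum_(i < k) j (const (c i)) * t ^+ i + t ^+ k * z'.
    elim: (k) => [|m [c [z' iz' zE]]].
      by exists (fun=> 0); exists z; rewrite // big_ord0 add0r expr0 mul1r.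
    have [b /tgen[w iw wE]] := int_residue iz'.
    exists (fun i => oapp c b (unlift ord_max i)); exists w => //.
    rewrite big_ord_recr /= unlift_none /= exprSr -mulrA -wE zE.
    rewrite -[RHS]addrA; congr (_ + _); last by ring.
    apply: eq_bigr => i _; congr (j (const _) * _).
    by have -> : widen_ord (leqnSn m) i = lift ord_max i;
      [apply: val_inj; rewrite /= /bump leqNgt ltn_ord|rewrite liftK].
  exists c, (u * z'); first exact: intM.
  by rewrite mulrA -tk.
exists t, k, u; split; last first.
  move=> c z c0' iz; have iw : int (j (const c) + t * z).
    by apply: intD; [apply: int_j|apply: intM].
  apply: contrapT => Nw; have mw : maxid (j (const c) + t * z).
    split=> //; have [w0|w0] := eqVneq (j (const c) + t * z) 0; [by left|right].
    by move=> iw'; apply: Nw.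
  have mc : maxid (j (const c)).
    have -> : j (const c) = j (const c) + t * z + t * - z by rewrite mulrN addrK.
    by apply: maxidD => //; apply: maxidM => //; apply: intN.
  case: maxidN1; rewrite -(rmorph1 j) -(rmorph1 const) -(mulfV c0') !rmorphM.
  by apply: maxidM => //; apply: int_j.
split=> //.
- move=> p pk pt; apply: (@chain_free k (fun i => t ^+ i)) => //.
  + by move=> i; apply: intX.
  + move=> i ik; exists (t * (t ^+ (k - i.+1) * u^-1)); last exact: iuk.
    by apply: maxidM => //; apply: intM => //; apply: intX.
  + move=> i l il _; exists (t * t ^+ (l - i.+1)).
      by apply: maxidM => //; apply: intX.
    by rewrite mulrA -exprSr -exprD subnKC.
  by rewrite -(ev_wide _ pk).
move=> z0 iz0.
have /choice[F FP] : forall z : {z | int z}, exists p : ('I_k -> K) * {z | int z},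
    sval z = \sum_(i < k) j (const (p.1 i)) * t ^+ i + j X * sval p.2.
  move=> [z iz]; have [c [z' iz' zE]] := step z iz.
  by exists (c, exist _ z' iz').
(* Successive remainders, kept together with their integrality so that the step can be iterated. *)
pose s m := iter m (fun y : {z : L | int z} => (F y).2) (exist _ z0 iz0 : {z : L | int z}).
pose c m i := (F (s m)).1 i.
pose a i := fps1_of (fun m => c m i).
have sP N : z0 = \sum_(i < k) j (\sum_(m < N) X ^+ m * const (c m i)) * t ^+ i
    + j X ^+ N * sval (s N).
  elim: N => [|N IH].
    rewrite expr0 mul1r big1 ?add0r // => i _.
    by rewrite big_ord0 rmorph0 mul0r.
  have sE : sval (s N) = \sum_(i < k) j (const (c N i)) * t ^+ i + j X * sval (s N.+1).
    exact: FP.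
  rewrite [LHS]IH [in LHS]sE mulrDr addrA mulrA -exprSr; congr (_ + _).
  rewrite mulr_sumr -big_split; apply: eq_bigr => i _ /=.
  by rewrite big_ord_recr /= rmorphD mulrDl rmorphM rmorphXn mulrA.
pose p : {poly A} := \poly_(i < k) (if insub i is Some i' then a i' else 0).
have sp : (size p <= k)%N by apply: size_poly.
exists p => //; apply/eqP; rewrite -subr_eq0; apply/eqP/separated => N.
have /choice[b bE] : forall i, exists b, a i =
    \sum_(m < N) X ^+ m * const (c m i) + X ^+ N * b.
  by move=> i; apply: fps1_trunc.
exists (sval (s N) - \sum_(i < k) j (b i) * t ^+ i).
  apply: intD; first exact: (svalP (s N)).
  apply: intN; apply: int_sum => i.
  by apply: intM; [apply: int_j|apply: intX].
rewrite {1}(sP N) (ev_wide t sp) mulrBr mulr_sumr.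
rewrite [X in _ - X](_ : _ = \sum_(i < k) j (\sum_(m < N) X ^+ m * const (c m i)) * t ^+ i
  + \sum_(i < k) j X ^+ N * (j (b i) * t ^+ i)); first by ring.
rewrite -big_split; apply: eq_bigr => i _ /=.
have -> : p`_i = a i by rewrite coef_poly ltn_ord valK.
by rewrite bE [in LHS]rmorphD rmorphM rmorphXn mulrDl mulrA.
Qed.

End Valuation.

(** * Power bases, norms and the comparison of discriminants *)

Definition powers (L : fieldType) n (t : L) : 'I_n -> L := fun i => t ^+ i.
Arguments powers {L} n t.

Section PowerBasis.
Variables (K : fieldType) (L : fieldType) (j : {rmorphism fps1 K -> L}).
Notation A := (fps1 K).
Variables (n : nat) (t : L) (P : {poly A}).
Hypotheses (Pm : P \is monic) (sP : size P = n.+1) (Pt : (map_poly j P).[t] = 0).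
Hypothesis tfree : forall p : {poly A},
  (size p <= n)%N -> (map_poly j p).[t] = 0 -> p = 0.
Implicit Types (p q h : {poly A}) (a : 'rV[A]_n).

Let ev p := (map_poly j p).[t].
Notation pw := (powers n t).
Notation Mul h := (mulmod n P h).

Lemma comb_powers a : comb j a pw = ev (rVpoly a).
Proof.
rewrite /ev (horner_coef_wide _ (leq_trans (size_poly _ _) (size_poly _ _))).
by apply: eq_bigr => i _; rewrite coef_map coef_rVpoly_ord.
Qed.

Lemma comb_poly_rV p : (size p <= n)%N -> comb j (poly_rV p) pw = ev p.
Proof. by move=> pn; rewrite comb_powers poly_rV_K. Qed.

Lemma powers_free : free_family j pw.
Proof.
move=> a; have sa : (size (rVpoly a) <= n)%N by apply: size_poly.
by rewrite comb_powers => /(tfree sa) a0; rewrite -[a]rVpolyK a0 linear0.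
Qed.

Lemma ev_rem h : ev (Pdiv.CommonRing.rmodp h P) = ev h.
Proof.
rewrite [in RHS](Pdiv.RingMonic.rdivp_eq Pm h) /ev rmorphD rmorphM hornerD hornerM.
by rewrite Pt mulr0 add0r.
Qed.

Lemma row_mulmod h i : comb j (row i (Mul h)) pw = t ^+ i * ev h.
Proof.
have -> : row i (Mul h) = poly_rV (Pdiv.CommonRing.rmodp ('X^i * h) P).
  by apply/rowP => k; rewrite !mxE.
rewrite comb_poly_rV; last exact: (size_rmodp Pm sP).
rewrite ev_rem /ev rmorphM hornerM /= map_polyXn.
by rewrite hornerXn.
Qed.

Lemma comb_inj a b : comb j a pw = comb j b pw -> a = b.
Proof.
by move=> ab; apply/eqP; rewrite -subr_eq0; apply/eqP/powers_free; rewrite combB ab subrr.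
Qed.

Lemma change_basis_inj (C D : 'M[A]_n) :
  (forall i, change_basis j C pw i = change_basis j D pw i) -> C = D.
Proof. by move=> CD; apply/row_matrixP => i; apply/comb_inj/CD. Qed.

Lemma comb_mulmod a h : comb j a (change_basis j (Mul h) pw) = comb j a pw * ev h.
Proof.
rewrite /comb mulr_suml; apply: eq_bigr => i _.
by rewrite /change_basis row_mulmod mulrA.
Qed.

Lemma mulmod_ext g h : ev g = ev h -> Mul g = Mul h.
Proof.
by move=> gh; apply: change_basis_inj => i; rewrite /change_basis !row_mulmod gh.
Qed.

Lemma mulmodM g h : Mul (g * h) = Mul g *m Mul h.
Proof.
apply: change_basis_inj => i; rewrite [RHS]/change_basis row_mul -comb_change.
rewrite comb_mulmod row_mulmod /change_basis row_mulmod /ev rmorphM hornerM.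
by rewrite mulrA.
Qed.

(** The norm from L to K((x)) of the value of h at t. *)
Definition norm_poly h := \det (Mul h).

Lemma norm_polyM g h : norm_poly (g * h) = norm_poly g * norm_poly h.
Proof. by rewrite /norm_poly mulmodM det_mulmx. Qed.

Lemma norm_polyC c : norm_poly c%:P = c ^+ n.
Proof.
rewrite /norm_poly -det_scalar; congr (\det _); apply: change_basis_inj => i.
rewrite /change_basis row_mulmod /ev map_polyC hornerC /=.
have -> : row i c%:M = c *: delta_mx 0 i :> 'rV[A]_n.
  by apply/rowP => k; rewrite !mxE eqxx mulr_natr eq_sym.
by rewrite combZ comb_delta mulrC.
Qed.

Lemma norm_poly1 : norm_poly 1 = 1.
Proof. by rewrite -[1]/(1%:P) norm_polyC expr1n. Qed.

Lemma norm_polyXn h m : norm_poly (h ^+ m) = norm_poly h ^+ m.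
Proof.
by elim: m => [|m IH]; rewrite ?norm_poly1 // !exprS norm_polyM IH.
Qed.

Lemma norm_poly_ext g h : ev g = ev h -> norm_poly g = norm_poly h.
Proof. by move=> /mulmod_ext; rewrite /norm_poly => ->. Qed.

Lemma norm_poly_unit g h : ev g * ev h = 1 -> norm_poly g \is a GRing.unit.
Proof.
move=> gh; apply/unitrPr; exists (norm_poly h); rewrite -norm_polyM -norm_poly1.
by apply: norm_poly_ext; rewrite /ev rmorphM hornerM rmorph1 hornerC.
Qed.

Lemma norm_poly_eq0 h : norm_poly h = 0 -> ev h = 0.
Proof.
move=> /eqP/det0P[a a0 aM]; apply/eqP.
have : comb j a pw * ev h = 0 by rewrite -comb_mulmod comb_change aM comb0.
by move/eqP; rewrite mulf_eq0 => /orP[/eqP/powers_free a0'|//]; rewrite a0' eqxx in a0.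
Qed.

Lemma lattice_powersP z :
  lattice j pw z <-> exists2 p : {poly A}, (size p <= n)%N & z = ev p.
Proof.
split=> [[a ->]|[p pn ->]]; last by exists (poly_rV p); rewrite comb_poly_rV.
by exists (rVpoly a); rewrite ?comb_powers ?size_poly.
Qed.

Lemma lattice_mulmod h z : lattice j (change_basis j (Mul h) pw) z <->
  exists2 w, lattice j pw w & z = ev h * w.
Proof.
split=> [[a ->]|[_ [a ->] ->]]; last by exists a; rewrite comb_mulmod mulrC.
by exists (comb j a pw); [exists a|rewrite comb_mulmod mulrC].
Qed.

End PowerBasis.

Section TwoBases.
Variables (K : fieldType) (L : fieldType) (j : {rmorphism fps1 K -> L}).
Notation A := (fps1 K).
Variables (n : nat) (t y : L) (P W : {poly A}).
Hypotheses (Pm : P \is monic) (sP : size P = n.+1) (Pt : (map_poly j P).[t] = 0).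
Hypotheses (Wm : W \is monic) (sW : size W = n.+1) (Wy : (map_poly j W).[y] = 0).
Hypothesis tfree : forall p : {poly A},
  (size p <= n)%N -> (map_poly j p).[t] = 0 -> p = 0.
Hypothesis yfree : forall p : {poly A},
  (size p <= n)%N -> (map_poly j p).[y] = 0 -> p = 0.
Variable M : 'M[A]_n.
Hypothesis yM : forall i : 'I_n, y ^+ i = (map_poly j (rVpoly (row i M))).[t].

Let yE i : powers n y i = change_basis j M (powers n t) i.
Proof. by rewrite /change_basis comb_powers -yM. Qed.

Lemma det_transition : \det M != 0.
Proof.
apply/negP => /det0P[a a0 aM]; case/negP: a0; apply/eqP.
apply: (powers_free yfree); transitivity (comb j a (change_basis j M (powers n t))).
  by apply: eq_bigr => i _; rewrite yE.
by rewrite comb_change aM comb0.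
Qed.

Lemma mulmod_transition g h : (map_poly j g).[y] = (map_poly j h).[t] ->
  mulmod n W g *m M = M *m mulmod n P h.
Proof.
move=> gh; apply: (change_basis_inj tfree) => i.
rewrite /change_basis !row_mul -!comb_change (comb_mulmod Pm sP Pt).
transitivity (comb j (row i (mulmod n W g)) (powers n y)).
  by apply: eq_bigr => k _; rewrite yE.
by rewrite (row_mulmod Wm sW Wy) gh; congr (_ * _); exact: (yE i).
Qed.

Lemma tr_transition g h : (map_poly j g).[y] = (map_poly j h).[t] ->
  \tr (mulmod n W g) = \tr (mulmod n P h).
Proof.
(* M need not be invertible over K[[x]]; it is cancelled through its adjugate and its nonzero
   determinant. *)
move=> /mulmod_transition E; apply: (mulfI det_transition).
have -> : \det M * \tr (mulmod n W g) = \tr (mulmod n W g *m M *m \adj M).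
  by rewrite -mulmxA mul_mx_adj mul_mx_scalar mxtraceZ.
by rewrite E mxtrace_mulC mulmxA mul_adj_mx mul_scalar_mx mxtraceZ.
Qed.

(** Traces do not depend on the basis, so the two Gram matrices of the trace form differ by M on one
    side and its transpose on the other; the unit comes from the two applications of
    [det_trace_form]. *)
Lemma discriminant_transition : exists2 u : A, u \is a GRing.unit &
  norm_poly n W W^`() = \det M ^+ 2 * norm_poly n P P^`() * u.
Proof.
have [u [u' uu'] uE] := det_trace_form Wm sW.
have [v [v' vv'] vE] := det_trace_form Pm sP.
pose m i := rVpoly (row i M).
have mE i0 : m i0 = \sum_l M i0 l *: 'X^l.
  rewrite /m /rVpoly poly_def; apply: eq_bigr => l _.
  by rewrite insubT //= => ln; rewrite mxE; congr (M _ _ *: _); apply: val_inj.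
have traceE : \matrix_(i < n, k < n) \tr (mulmod n W ('X^i * 'X^k)) =
    M *m (\matrix_(i < n, k < n) \tr (mulmod n P ('X^i * 'X^k))) *m M^T.
  apply/matrixP => i k; rewrite mxE (@tr_transition _ (m i * m k)); last first.
    by rewrite !rmorphM !hornerM /= !map_polyXn !hornerXn !yM.
  rewrite (tr_mulmod Pm sP) (mE k) mulr_sumr mulr_suml topcoef_sum // mxE.
  apply: eq_bigr => b _; rewrite [M^T _ _]mxE -scalerAr -scalerAl topcoefZ // mulrC.
  congr (_ * _); rewrite (mE i) !mulr_suml topcoef_sum // mxE; apply: eq_bigr => a _.
  by rewrite -!scalerAl topcoefZ // mxE (tr_mulmod Pm sP).
have := congr1 determinant traceE; rewrite uE !det_mulmx det_tr vE => E.
exists (v * u'); first by apply/unitrPr; exists (v' * u); rewrite mulrACA vv' mul1r mulrC uu'.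
rewrite /norm_poly -[LHS]mulr1 -uu' mulrA E; ring.
Qed.

End TwoBases.

(** * Invariants of a branch *)

Section Derivation.
Variable K : fieldType.
Implicit Types f g : fps2 K.

Lemma fps2_dyM f g : fps2_dy (f * g) = fps2_dy f * g + f * fps2_dy g.
Proof.
apply: fps2P => m n; rewrite fps2ED [fps2_dy (f * g) _ _]FPS2E !fps2EM -sumrMnl.
rewrite -big_split; apply: eq_bigr => i _ /=.
pose F k := f i k * g (m - i)%N (n.+1 - k)%N.
have FE k : (k < n.+2)%N -> F k *+ n.+1 = F k *+ k + F k *+ (n.+1 - k).
  by move=> kn; rewrite -mulrnDr subnKC.
rewrite -sumrMnl (eq_bigr (fun k : 'I_n.+2 => F k *+ k + F k *+ (n.+1 - k))) => [|k _].
  rewrite big_split; congr (_ + _).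
    rewrite big_ord_recl /= mulr0n add0r; apply: eq_bigr => k _.
    by rewrite /F /= FPS2E mulrnAl.
  rewrite big_ord_recr /= subnn mulr0n addr0; apply: eq_bigr => k _.
  have kn : (k <= n)%N by rewrite -ltnS.
  by rewrite /F FPS2E /= subSn // mulrnAr.
exact: FE.
Qed.

Lemma fps2EMn f k i j : (f *+ k) i j = f i j *+ k.
Proof. by elim: k => [|k IH]; rewrite ?mulr0n ?fps2E0 // !mulrS fps2ED IH. Qed.

Lemma toO_deriv (p : {poly fps1 K}) : toO p^`() = fps2_dy (toO p).
Proof.
apply: fps2P => m n; rewrite [RHS]FPS2E !toOE coef_deriv raddfMn /=.
by rewrite fps2EMn.
Qed.

End Derivation.

(** The same shape as [normalization], but relative to a map, so that it can be moved between models
    of the ring of fractions. *)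
Definition integral_closure (R T : comPzRingType) (phi : R -> T) : set T :=
  fun z => exists m (c : 'I_m -> R), z ^+ m + \sum_(i < m) phi (c i) * z ^+ i = 0.

Definition ideal2 (K : closedFieldType) (f g : fps2 K) : set (fps2 K) :=
  fun h => exists a b, h = a * f + b * g.

Section Branch.
Variables (K : closedFieldType) (L : fieldType) (phi : {rmorphism fps2 K -> L}).
Variables (f : fps2 K) (n : nat).
Notation A := (fps1 K).
Notation X := (@fps1_X K).
Hypothesis freg : yregular n f.
Hypothesis phi_ker : forall g, phi g = 0 <-> divides f g.
Hypothesis phi_frac : forall z, exists g s, phi s != 0 /\ phi s * z = phi g.

Let j : {rmorphism fps1 K -> L} := phi \o val.
Let y := phi fps2_y.
Let ev z (p : {poly A}) := (map_poly j p).[z].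

Let evyE p : ev y p = phi (toO p).
Proof. by rewrite /toO -horner_map -map_poly_comp. Qed.

Let evB z p q : ev z (p - q) = ev z p - ev z q.
Proof. by rewrite /ev rmorphB hornerD hornerN. Qed.
Let evM z p q : ev z (p * q) = ev z p * ev z q.
Proof. by rewrite /ev rmorphM hornerM. Qed.
Let evC z a : ev z a%:P = j a.
Proof. by rewrite /ev map_polyC hornerC. Qed.
Let evXn z m : ev z 'X^m = z ^+ m.
Proof. by rewrite /ev map_polyXn hornerXn. Qed.

Let n0 : (0 < n)%N.
Proof.
rewrite lt0n; apply/eqP => n0; have fu : f \is a GRing.unit.
  by apply/fps2_unitP; case: freg; rewrite n0.
have : phi 1 = 0 by apply/phi_ker; exists f^-1; rewrite mulVr.
by rewrite rmorph1; apply/eqP/oner_neq0.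
Qed.

Let yfree' : forall p : {poly A}, (size p <= n)%N -> ev y p = 0 -> p = 0.
Proof.
move=> p pn; rewrite evyE => /phi_ker[b bE].
exact: weierstrass_poly_uniq freg pn bE.
Qed.

Let j_inj a : j a = 0 -> a = 0.
Proof.
move=> ja; apply/eqP; rewrite -polyC_eq0; apply/eqP/yfree'.
  by apply: leq_trans n0; apply: size_polyC_leq1.
by rewrite /ev map_polyC hornerC.
Qed.

Let yspan g : exists2 p : {poly A}, (size p <= n)%N & phi g = ev y p.
Proof.
have [q [p [gE sp]]] := weierstrass_poly_div g freg; exists p => //.
rewrite evyE gE rmorphD rmorphM.
by have -> : phi f = 0 by [apply/phi_ker; exact: divides_refl]; rewrite mulr0 add0r.
Qed.

(** After clearing denominators, the n + 1 elements lie in the K[[x]]-module spanned by 1, y, ...,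
    y^(n-1). *)
Lemma branch_dependent (w : nat -> L) : exists p : {poly A},
  [/\ p != 0, (size p <= n.+1)%N & \sum_(i < n.+1) j p`_i * w i = 0].
Proof.
have /choice[G GP] : forall i, exists gs : fps2 K * fps2 K,
    phi gs.2 != 0 /\ phi gs.2 * w i = phi gs.1.
  by move=> i; have [g [s h]] := phi_frac (w i); exists (g, s).
pose S := \prod_(i < n.+1) (G i).2.
have S0 : phi S != 0.
  by rewrite rmorph_prod; apply/prodf_neq0 => i _; case: (GP i).
have /choice[C CP] (i : 'I_n.+1) : exists p : {poly A},
    (size p <= n)%N /\ phi S * w i = ev y p.
  have [p pn pE] := yspan ((\prod_(k < n.+1 | k != i) (G k).2) * (G i).1).
  exists p; split=> //; rewrite -pE rmorphM -(GP i).2 /S (bigD1 i) //= rmorphM.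
  by rewrite -mulrA mulrCA.
have [v v0 vC] := wide_dependent (\matrix_(i, k) poly_rV (C i) 0 k : 'M[A]_(n.+1, n)) (ltnSn n).
exists (rVpoly v); split.
- by apply: contraNneq v0 => h; rewrite -[v]rVpolyK h linear0.
- exact: size_poly.
apply: (mulfI S0); rewrite mulr0 mulr_sumr.
rewrite (eq_bigr (fun i : 'I_n.+1 => j (v 0 i) * comb j (poly_rV (C i)) (powers n y))).
  transitivity (\sum_i comb j (v 0 i *: poly_rV (C i)) (powers n y)).
    by apply: eq_bigr => i _; rewrite combZ.
  rewrite -[LHS](_ : comb j (\sum_i v 0 i *: poly_rV (C i)) (powers n y) = _).
    rewrite [X in comb _ X _](_ : _ = 0) ?comb0 //.
    apply/rowP => k; rewrite summxE -vC !mxE; apply: eq_bigr => i _.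
    by rewrite !mxE.
  by elim/big_rec2: _ => [|i a b _ <-]; rewrite ?comb0 ?combD.
move=> i _; rewrite coef_rVpoly_ord mulrCA (CP i).2.
by rewrite comb_poly_rV //; case: (CP i).
Qed.

(** Here d is delta(f) and [nu g] is i(f, g), computed as the order of the norm of g. The last two
    clauses are i(f, f_y) = 2 d + n - 1 when n is nonzero in K, and a strictly larger value
    otherwise. *)
Theorem branch_invariants : exists d (nu : fps2 K -> nat),
  [/\ has_dim (phi \o @fps2_const K) (integral_closure phi) (range phi) d,
   forall g, ~ divides f g -> has_dim (@fps2_const K) setT (ideal2 f g) (nu g),
   forall g h, ~ divides f g -> ~ divides f h -> nu (g * h) = (nu g + nu h)%N,
   ~ divides f fps2_x /\ nu fps2_x = n &
   (n%:R != 0 :> K -> ~ divides f (fps2_dy f) /\ (nu (fps2_dy f)).+1 = (d.*2 + n)%N) /\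
   (n%:R = 0 :> K -> ~ divides f (fps2_dy f) -> (d.*2 + n <= nu (fps2_dy f))%N)].
Proof.
have [W [q [Wm sW _ qu WE]]] := weierstrass_poly freg.
have Wy : (map_poly j W).[y] = 0.
  by rewrite -/(ev y W) evyE WE; apply/phi_ker; exists q.
have [t [k [u [[[it kn] [iu iu' u0] tk tfree tspan]] tunit]]] :=
  valuation_ring_structure j_inj branch_dependent.
have iy : integralOver j y by exists W => //; apply/rootP.
have iphi g : integralOver j (phi g).
  have [p _ ->] := yspan g; apply: integral_horner iy.
  by apply/integral_poly => i; rewrite coef_map; apply: integral_id.
have cm (p : {poly A}) i : (map_poly j p)`_i = j p`_i by exact: coef_map.
(* Integrality over K[[x,y]] and over K[[x]] agree because y is a root of the monic polynomial W. *)
have clE z : integral_closure phi z <-> integralOver j z.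
  split=> [[m [c cE]]|[p pm /rootP pz]].
    pose p : {poly L} := 'X^m + \poly_(i < m) oapp (fun i => phi (c i)) 0 (insub i).
    have sp : size p = m.+1.
      by rewrite size_polyDl size_polyXn // ltnS size_poly.
    apply: (@integral_root_monic _ _ _ _ p).
    - rewrite monicE /lead_coef sp /= coefD coefXn eqxx nth_default ?addr0 //.
      exact: size_poly.
    - apply/rootP; rewrite hornerD hornerXn -[RHS]cE; congr (_ + _).
      rewrite poly_def horner_sum; apply: eq_bigr => i _.
      by rewrite hornerZ hornerXn valK.
    apply/integral_poly => i; rewrite coefD; apply: integral_add.
      by rewrite coefXn; apply: integral_nat.
    rewrite coef_poly; case: ifP => [im|_]; last exact: integral0.
    by rewrite insubT /=.
  exists (size p).-1, (fun i => val p`_i).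
  have sE : size p = (size p).-1.+1 by rewrite prednK // size_poly_gt0 monic_neq0.
  rewrite -[RHS]pz (@horner_coef_wide _ (size p)) ?size_poly // [in RHS]sE.
  rewrite big_ord_recr addrC; congr (_ + _).
    by apply: eq_bigr => i _; rewrite cm.
  have pl : p`_(size p).-1 = 1 by rewrite -lead_coefE; apply/monicP.
  by rewrite cm -[nat_of_ord ord_max]/((size p).-1) pl rmorph1 mul1r.
(* The n independent powers of y lie in a module generated by k elements, so there is no residual
   inequality k < n. *)
have kE : k = n.
  apply/eqP; rewrite eqn_leq; case/andP: kn => _ ->; rewrite leqNgt.
  apply/negP => kn.
  have /choice[C CP] (i : 'I_n) : exists p : {poly A},
      (size p <= k)%N /\ y ^+ i = (map_poly j p).[t].
    have [|p pk pE] := tspan (y ^+ i); last by exists p.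
    by rewrite -rmorphXn; apply: iphi.
  have [v v0 vC] := wide_dependent (\matrix_(i, l) poly_rV (C i) 0 l : 'M[A]_(n, k)) kn.
  case/eqP: v0; apply: (powers_free yfree'); rewrite /comb.
  rewrite (eq_bigr (fun i => comb j (v 0 i *: poly_rV (C i)) (powers k t))) => [|i _].
    rewrite -[LHS](_ : comb j (\sum_i v 0 i *: poly_rV (C i)) (powers k t) = _).
      rewrite [X in comb _ X _](_ : _ = 0) ?comb0 //.
      apply/rowP => l; rewrite summxE -vC !mxE; apply: eq_bigr => i _.
      by rewrite !mxE.
    by elim/big_rec2: _ => [|i a b _ <-]; rewrite ?comb0 ?combD.
  rewrite combZ /powers (CP i).2 comb_poly_rV //; by case: (CP i).
subst k.
have [r rn uE] := tspan u iu.
(* From t^n = x u with u = r(t), an equation of t is obtained without constructing a minimal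
   polynomial. *)
pose P : {poly A} := 'X^n - X%:P * r.
have sXr : (size (X%:P * r)%R <= n)%N.
  by rewrite mul_polyC (leq_trans (size_scale_leq _ _)).
have sP : size P = n.+1 by rewrite size_polyDl size_polyXn // size_polyN.
have Pm : P \is monic.
  by rewrite monicE /lead_coef sP /= coefB coefXn eqxx nth_default ?subr0.
have Pt : (map_poly j P).[t] = 0.
  by rewrite -/(ev t P) evB evXn evM evC /ev -uE tk subrr.
have /choice[C CP] (i : 'I_n) : exists p : {poly A},
    (size p <= n)%N /\ y ^+ i = (map_poly j p).[t].
  have [|p pk pE] := tspan (y ^+ i); last by exists p.
  by rewrite -rmorphXn; apply: iphi.
pose M : 'M[A]_n := \matrix_i poly_rV (C i).
have yM (i : 'I_n) : y ^+ i = (map_poly j (rVpoly (row i M))).[t].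
  by rewrite rowK poly_rV_K; case: (CP i).
have M0 := det_transition yfree' yM.
have [d dM] := fps1_ord_ex M0.
have yEt (i : 'I_n) : powers n y i = change_basis j M (powers n t) i.
  by rewrite /change_basis comb_powers -yM.
have toMt (p : {poly A}) : exists h : {poly A}, ev y p = ev t h.
  have ip : integralOver j (ev y p) by rewrite evyE; apply: iphi.
  by have [h _ ->] := tspan _ ip; exists h.
have latR z : lattice j (powers n y) z <-> range phi z.
  rewrite lattice_powersP; split=> [[p _ ->]|[g _ <-]].
    by exists (toO p); rewrite ?evyE // -evyE.
  exact: yspan.
have latV z : lattice j (powers n t) z <-> integral_closure phi z.
  rewrite lattice_powersP clE; split=> [[p _ ->]|/tspan//].
  by apply: integral_horner it; apply/integral_poly => i; rewrite cm; apply: integral_id.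
have dimV : has_dim (phi \o @fps2_const K) (integral_closure phi) (range phi) d.
  have -> : integral_closure phi = lattice j (powers n t).
    by apply/seteqP; split=> z /latV.
  have -> : range phi = lattice j (change_basis j M (powers n t)).
    apply/seteqP; split=> z; first move=> /latR[a ->]; last move=> [a ->].
      by exists a; apply: eq_bigr => i _; rewrite yEt.
    by apply/latR; exists a; apply: eq_bigr => i _; rewrite yEt.
  exact: (lattice_index (powers_free tfree) dM).
pose isnorm g a := exists2 p : {poly A}, ev y p = phi g & norm_poly n W p = a.
have normM g h a b : isnorm g a -> isnorm h b -> isnorm (g * h) (a * b).
  move=> [p pg <-] [p' ph <-]; exists (p * p'); last exact: (norm_polyM Wm sW Wy yfree').
  by rewrite evM pg ph rmorphM.
have norm_uniq g a b : isnorm g a -> isnorm g b -> a = b.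
  move=> [p pg <-] [p' ph <-].
  exact: (norm_poly_ext Wm sW Wy yfree' (etrans pg (esym ph))).
have norm_neq0 g a : ~ divides f g -> isnorm g a -> a != 0.
  move=> fg [p pg <-]; apply/eqP => /(norm_poly_eq0 Wm sW Wy yfree') p0; apply: fg.
  by apply/phi_ker; rewrite -pg.
have norm_ex g : exists a, isnorm g a.
  by have [p _ pE] := yspan g; exists (norm_poly n W p); exists p.
(* On multiples of f, where i(f, g) is infinite, [nu] has the default value 0. *)
have /choice[nu nuP] : forall g, exists m, ~ divides f g ->
    forall a, isnorm g a -> fps1_ord a m.
  move=> g; have [fg|fg] := pselect (divides f g); first by exists 0%N.
  have [a ag] := norm_ex g; have [m am] := fps1_ord_ex (norm_neq0 _ _ fg ag).
  by exists m => _ b bg; rewrite (norm_uniq _ _ _ bg ag).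
have nuE g a m : ~ divides f g -> isnorm g a -> fps1_ord a m -> nu g = m.
  by move=> fg ag am; apply: fps1_ord_uniq am; apply: nuP.
have NXf : ~ divides f fps2_x.
  move=> /phi_ker; rewrite -[fps2_x]/(val X) -[phi _]/(j X) => /j_inj/eqP.
  by rewrite (negPf (fps1_X_neq0 K)).
have phi_f : phi f = 0 by apply/phi_ker; exact: divides_refl.
have dimR g : ~ divides f g -> has_dim (@fps2_const K) setT (ideal2 f g) (nu g).
  move=> fg; have [p pn pE] := yspan g.
  (* Multiplication by g carries the lattice R onto gR, so the dimension of R/gR is the order of the
     determinant of this multiplication. *)
  have gord : fps1_ord (\det (mulmod n W p)) (nu g) by apply: nuP => //; exists p.
  have := lattice_index (powers_free yfree') gord.
  apply: (has_dim_lift (phi := phi)) => //.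
  - by move=> c v; exact: (rmorphM phi).
  - exact: lattice_subspace.
  - by move=> v _; apply/latR; exists v.
  - move=> v _; rewrite -[Algebra.Additive.sort _ v]/(phi v).
    rewrite (lattice_mulmod Wm sW Wy) -/(ev y p) -pE.
    split=> [[_ /latR[b _ <-]]|[a [b ->]]].
      move/eqP; rewrite -subr_eq0 -rmorphM -rmorphB => /eqP/phi_ker[a aE].
      by exists a, b; rewrite -aE [b * g]mulrC subrK.
    exists (phi b); first by apply/latR; exists b.
    by rewrite rmorphD !rmorphM phi_f mulr0 add0r mulrC.
  - move=> w /latR[v _ <-]; exists v => //; rewrite subrr.
    by case: (lattice_subspace j (change_basis j (mulmod n W p) (powers n y))).
exists d, nu; split=> //.
- move=> g h fg fh; have [a ag] := norm_ex g; have [b bh] := norm_ex h.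
  apply: (nuE _ (a * b)); [|exact: normM|by apply: fps1_ordM; apply: nuP].
  move=> /phi_ker/eqP; rewrite rmorphM mulf_eq0.
  by move=> /orP[] /eqP/phi_ker.
- split=> //; apply: (nuE _ (X ^+ n)) => //; last exact: fps1_ordX.
  by exists X%:P; [rewrite evC|rewrite (norm_polyC Wm sW Wy yfree')].
have [un unu NW] := discriminant_transition Pm sP Pt Wm sW Wy tfree yfree' yM.
(* On the branch f = 0, differentiating W = q f gives W'(y) = q f_y with q a unit, so f_y and W'
   have the same norm up to a unit. *)
have norm_fy b : isnorm (fps2_dy f) b -> exists2 c, c \is a GRing.unit &
    b = \det M ^+ 2 * norm_poly n P P^`() * c.
  have [a aq] := norm_ex q; have [a' aq'] := norm_ex q^-1.
  have au : a \is a GRing.unit.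
    apply/unitrPr; exists a'; apply: (norm_uniq (q * q^-1)); first exact: normM.
    by exists 1; [rewrite mulrV // rmorph1 /ev rmorph1 hornerC|exact: (norm_poly1 Wm sW Wy yfree')].
  move=> bf; exists (un / a); first by rewrite unitrM unu unitrV.
  apply: (mulrI au); have -> : a * b = norm_poly n W W^`().
    apply: (norm_uniq (q * fps2_dy f)); first exact: normM.
    exists W^`() => //; rewrite evyE toO_deriv WE fps2_dyM rmorphD !rmorphM phi_f.
    by rewrite mulr0 add0r.
  by rewrite NW [RHS]mulrC -!mulrA mulVr // mulr1.
pose NP := norm_poly n P.
have NPM := norm_polyM Pm sP Pt tfree.
have NPXn := norm_polyXn Pm sP Pt tfree.
have NPext := norm_poly_ext Pm sP Pt tfree.
have ru : NP r \is a GRing.unit.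
  have [r' _ r'E] := tspan _ iu'.
  apply: (norm_poly_unit Pm sP Pt tfree (h := r')); rewrite -uE -r'E mulfV //.
(* The relation t^n = x u says that P is an Eisenstein polynomial, so that
   P'(t) has valuation at least n - 1, with equality iff n != 0 in K. *)
have NX1 : fps1_ord (NP 'X) 1.
  (* Taking norms in t^n = x u gives N(t)^n = x^n N(u), so N(t) has order exactly 1. *)
  have NXn : NP 'X ^+ n = X ^+ n * NP r.
    rewrite -NPXn -(norm_polyC Pm sP Pt tfree) -NPM; apply: NPext.
    by rewrite -!/(ev t _) evXn evM evC /ev -uE.
  have NX0 : NP 'X != 0.
    apply/eqP => N0; move/eqP: NXn; rewrite N0 expr0n (gtn_eqF n0).
    rewrite eq_sym mulf_eq0 expf_eq0 (negPf (fps1_X_neq0 K)) andbF /= => /eqP r0.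
    by move: ru; rewrite r0 unitr0.
  have [l lP] := fps1_ord_ex NX0.
  have lnP : fps1_ord (NP 'X ^+ n) (l * n).
    elim: (n) => [|m IH]; first by rewrite muln0; apply/fps1_ord0; rewrite expr0 unitr1.
    by rewrite exprS mulnS; apply: fps1_ordM.
  have : (l * n)%N = n by apply: fps1_ord_uniq lnP _; exists (NP r).
  move/eqP; rewrite -[X in _ == X]mul1n eqn_pmul2r // => /eqP l1.
  by rewrite -l1.
have NXm m : fps1_ord (NP 'X ^+ m) m.
  elim: m => [|m IH]; first by apply/fps1_ord0; rewrite expr0 unitr1.
  by rewrite exprS -add1n; apply: fps1_ordM.
have ordb b m : fps1_ord (NP P^`()) m -> isnorm (fps2_dy f) b ->
    fps1_ord b (d.*2 + m).
  move=> Pord /norm_fy[c cu ->]; rewrite -[(_ + m)%N]addn0.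
  apply: fps1_ordM; last by apply/fps1_ord0.
  by apply: fps1_ordM => //; rewrite -addnn expr2; apply: fps1_ordM.
have Nfy m : fps1_ord (NP P^`()) m -> ~ divides f (fps2_dy f).
  move=> Pord /phi_ker fy0; have [b bf] := norm_ex (fps2_dy f).
  have := fps1_ord_neq0 (ordb _ _ Pord bf); rewrite (norm_uniq _ _ 0 bf) ?eqxx //.
  exists 0%:P; first by rewrite evC rmorph0 fy0.
  by rewrite (norm_polyC Wm sW Wy yfree') expr0n (gtn_eqF n0).
have P'E : ev t P^`() = j (fps1_const n%:R) * t ^+ n.-1 - j X * ev t r^`().
  rewrite derivB derivM derivC mul0r add0r derivXn -mulr_natl evB !evM evC evXn.
  by rewrite -polyC_natr evC !rmorph_nat.
have jXE : j X = t ^+ n * u^-1 by rewrite tk mulfK.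
have ir' : integralOver j (ev t r^`()).
  by apply: integral_horner it; apply/integral_poly => i; rewrite cm; apply: integral_id.
split=> [nK|nK fy].
  (* Substituting x = t^n / u in P'(t) gives t^(n-1) (n + t z); the second factor is a unit since n
     is nonzero in K. *)
  pose z := - (u^-1 * ev t r^`()).
  have iz : integralOver j z by apply: integral_opp; apply: integral_mul.
  have [w0 iw'] := tunit _ _ nK iz; set w := _ + _ in w0 iw'.
  have iw : integralOver j w.
    by apply: integral_add; [exact: integral_id|exact: integral_mul].
  have [h _ hE] := tspan _ iw; have [h' _ h'E] := tspan _ iw'.
  have P'w : NP P^`() = NP 'X ^+ n.-1 * NP h.
    rewrite -NPXn -NPM; apply: NPext; rewrite -!/(ev t _) evM evXn P'E.
    have tn : t ^+ n = t ^+ n.-1 * t by rewrite -exprSr prednK.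
    rewrite -[ev t h]hE jXE tn /w /z; ring.
  have hu : NP h \is a GRing.unit.
    by apply: (norm_poly_unit Pm sP Pt tfree (h := h')); rewrite -hE -h'E mulfV.
  have Pord : fps1_ord (NP P^`()) n.-1.
    by have := fps1_ordM (NXm n.-1) ((fps1_ord0 _).2 hu); rewrite addn0 P'w.
  split; first exact: Nfy Pord.
  have [b bf] := norm_ex (fps2_dy f).
  rewrite (nuE _ _ _ (Nfy _ Pord) bf (ordb _ _ Pord bf)) -addnS prednK //.
have [b bf] := norm_ex (fps2_dy f).
have iz : integralOver j (- (u^-1 * ev t r^`())).
  by apply: integral_opp; apply: integral_mul.
have [h _ hE] := tspan _ iz.
(* With n = 0 in K only the term divisible by x = t^n / u remains, whence one more power of t. *)
have P'w : NP P^`() = NP 'X ^+ n * NP h.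
  rewrite -NPXn -NPM; apply: NPext; rewrite -!/(ev t _) evM evXn P'E.
  by rewrite -[ev t h]hE jXE nK !rmorph0; ring.
have [l hl] : exists l, fps1_ord (NP h) l.
  apply: fps1_ord_ex; apply: contra_neq (norm_neq0 _ _ fy bf) => h0.
  by have [c _ ->] := norm_fy _ bf; rewrite -/(NP _) P'w h0 !mulr0 mul0r.
have Pord : fps1_ord (NP P^`()) (n + l) by rewrite P'w; apply: fps1_ordM.
by rewrite (nuE _ _ _ fy bf (ordb _ _ Pord bf)) addnA leq_addr.
Qed.

End Branch.

(** * The delta invariant of a product *)

Definition tfrac_map (K : closedFieldType) (f : fps2 K) :
  {rmorphism fps2 K -> tfrac (pquot f)} := @Defs.tofrac (pquot f) \o @to_pquot _ f.

(** Being a nonzerodivisor modulo f, expressed on representatives in K[[x,y]]. *)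
Definition regular_mod (K : closedFieldType) (f s : fps2 K) :=
  forall h, divides f (s * h) -> divides f h.

Section TotalFractions.
Variables (K : closedFieldType) (f : fps2 K).
Notation R := (pquot f).
Notation phi := (tfrac_map f).

Lemma pquotK (a : R) : exists g, a = to_pquot f g.
Proof. by exists (repr a); rewrite /to_pquot reprK. Qed.

Lemma to_pquot_eq g h : to_pquot f g = to_pquot f h <-> divides f (g - h).
Proof. by rewrite to_pquotP; split=> [/asboolP|] // ?; apply/asboolP. Qed.

Lemma tofrac_inj (a b : R) : Defs.tofrac a = Defs.tofrac b -> a = b.
Proof. by move=> /mk_tfracP /=; rewrite !mulr1. Qed.

Lemma tfrac_map_eq g h : phi g = phi h <-> divides f (g - h).
Proof.
split=> [/tofrac_inj/to_pquot_eq //|/to_pquot_eq gh].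
by rewrite /tfrac_map /= gh.
Qed.

Lemma tfrac_map_ker g : phi g = 0 <-> divides f g.
Proof. by rewrite -(rmorph0 phi) tfrac_map_eq subr0. Qed.

Lemma regular_modP s : regular_mod f s <-> nonzerodiv (to_pquot f s).
Proof.
split=> [sreg|/asboolP sreg h].
  apply/asboolP => a b; have [g ->] := pquotK a; have [h ->] := pquotK b.
  rewrite -!(rmorphM (to_pquot f)) => /to_pquot_eq; rewrite -mulrBr => /sreg.
  by move/to_pquot_eq.
rewrite -[s * h]subr0 => /to_pquot_eq sh; rewrite -[h]subr0; apply/to_pquot_eq.
by apply: sreg; rewrite -(rmorphM (to_pquot f)) [LHS]sh rmorph0 mulr0.
Qed.

Lemma tfrac_mapK z : exists g s, regular_mod f s /\ phi s * z = phi g.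
Proof.
pose a := (repr z).1; pose s := (repr z).2.
have zE : z = mk_tfrac a s by rewrite /mk_tfrac -surjective_pairing reprK.
have [g gE] := pquotK a; have [r rE] := pquotK (val s).
exists g, r; split; first by apply/regular_modP; rewrite -rE; apply: (valP s).
rewrite zE /tfrac_map /= -rE -gE [LHS]tfrac_mulE.
by apply/mk_tfracP => /=; rewrite mulr1 mul1r mulrC.
Qed.

Lemma tfrac_map_unit s : regular_mod f s -> exists w, w * phi s = 1.
Proof.
move=> /regular_modP sreg; exists (mk_tfrac 1 (exist (fun a : R => nonzerodiv a) _ sreg)).
by rewrite [LHS]tfrac_mulE; apply/mk_tfracP => /=; rewrite !mulr1 !mul1r.
Qed.

Lemma tfrac_map_cancel s z w : regular_mod f s -> phi s * z = phi s * w -> z = w.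
Proof.
move=> /tfrac_map_unit[v vs] E; rewrite -[z]mul1r -[w]mul1r -vs -!mulrA.
by rewrite E.
Qed.

Lemma normalizationE : @normalization R = integral_closure phi.
Proof.
apply/seteqP; split=> z [n [c cE]].
  exists n, (fun i => repr (c i)); rewrite -[RHS]cE; congr (_ + _).
  apply: eq_bigr => i _; rewrite /tfrac_map /=.
  by have -> : to_pquot f (repr (c i)) = c i by rewrite /to_pquot reprK.
by exists n, (fun i => to_pquot f (c i)).
Qed.

Lemma range_tofrac : range (@Defs.tofrac R) = range phi.
Proof.
apply/seteqP; split=> _ [a _ <-]; last by exists (to_pquot f a).
by have [g ->] := pquotK a; exists g.
Qed.

End TotalFractions.

Lemma range_subspace (K : fieldType) (S T : comPzRingType)
    (iota : {rmorphism K -> S}) (phi : {rmorphism S -> T}) :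
  subspace (phi \o iota) (range phi).
Proof.
split=> [|_ _ [g _ <-] [h _ <-]|c _ [g _ <-]]; first by exists 0; rewrite ?rmorph0.
  by exists (g + h); rewrite ?rmorphD.
by exists (iota c * g); rewrite ?rmorphM.
Qed.

(** Stability of the closure under addition is recorded along with the dimension: it is known in a
    field and passes to products and to other models. *)
Definition delta_dim (K : closedFieldType) (f : fps2 K) d :=
  subspace (tfrac_map f \o @fps2_const K) (integral_closure (tfrac_map f)) /\
  has_dim (tfrac_map f \o @fps2_const K) (integral_closure (tfrac_map f))
    (range (tfrac_map f)) d.

Lemma delta_dimE (K : closedFieldType) (f : fps2 K) d :
  delta_dim f d -> delta f = (Posz d)%:E.
Proof.
move=> [_ dd]; rewrite /delta normalizationE range_tofrac.
exact: (quot_dimE (range_subspace (@fps2_const K) (tfrac_map f)) dd).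
Qed.

(** * Delta computed in any model of the total ring of fractions *)

Section Model.
Variables (K : closedFieldType) (f : fps2 K) (T : comPzRingType).
Variable psi : {rmorphism fps2 K -> T}.
Notation phi := (tfrac_map f).
Hypothesis psi_ker : forall g, psi g = 0 <-> divides f g.
Hypothesis psi_unit : forall s, regular_mod f s -> exists w, w * psi s = 1.
Hypothesis psi_frac : forall z, exists g s, regular_mod f s /\ psi s * z = psi g.

Let psi_eq g h : psi g = psi h <-> divides f (g - h).
Proof.
rewrite -psi_ker rmorphB; split=> [->|/eqP]; first by rewrite subrr.
by rewrite subr_eq0 => /eqP.
Qed.

Let psi_cancel s z w : regular_mod f s -> psi s * z = psi s * w -> z = w.
Proof.
move=> /psi_unit[v vs] E; rewrite -[z]mul1r -[w]mul1r -vs -!mulrA.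
by rewrite E.
Qed.

Let regularM s r : regular_mod f s -> regular_mod f r -> regular_mod f (s * r).
Proof. by move=> sr rr h; rewrite -mulrA => /sr/rr. Qed.

Let theta_ex (u : tfrac (pquot f)) : exists z, forall g s, regular_mod f s ->
  phi s * u = phi g -> psi s * z = psi g.
Proof.
have [g0 [s0 [s0r uE]]] := tfrac_mapK u; have [w wE] := psi_unit s0r.
exists (w * psi g0) => g s sr sE.
have gE : psi (s * g0) = psi (s0 * g).
  apply/psi_eq; apply/tfrac_map_eq; rewrite !rmorphM -uE -sE mulrCA.
  by rewrite mulrC.
by rewrite mulrCA -rmorphM gE rmorphM mulrA wE mul1r.
Qed.

(** The map given by the universal property of fractions: phi(g) / phi(s) goes to psi(g) / psi(s),
    whatever the representation. It is injective and onto, and preserves integral elements. *)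
Definition theta u := sval (cid (theta_ex u)).

Let thetaE u g s : regular_mod f s -> phi s * u = phi g -> psi s * theta u = psi g.
Proof. by move=> sr uE; apply: (svalP (cid (theta_ex u))). Qed.

Let theta_uniq u z g s : regular_mod f s -> phi s * u = phi g -> psi s * z = psi g ->
  theta u = z.
Proof. by move=> sr uE zE; apply: (psi_cancel sr); rewrite zE; apply: thetaE. Qed.

Fact theta_zmod : zmod_morphism theta.
Proof.
move=> u v; have [g [s [sr uE]]] := tfrac_mapK u; have [h [r [rr vE]]] := tfrac_mapK v.
apply: (@theta_uniq _ _ (r * g - s * h) (s * r)); first exact: regularM.
  by rewrite rmorphB !rmorphM -uE -vE; ring.
by rewrite rmorphB !rmorphM -(thetaE sr uE) -(thetaE rr vE); ring.
Qed.

Let theta_phi g : theta (phi g) = psi g.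
Proof.
apply: (@theta_uniq _ _ g 1); rewrite ?rmorph1 ?mul1r // => h.
by rewrite mul1r.
Qed.

Fact theta_monoid : monoid_morphism theta.
Proof.
split=> [|u v]; first by rewrite -(rmorph1 phi) theta_phi rmorph1.
have [g [s [sr uE]]] := tfrac_mapK u; have [h [r [rr vE]]] := tfrac_mapK v.
apply: (@theta_uniq _ _ (g * h) (s * r)); first exact: regularM.
  by rewrite !rmorphM -uE -vE; ring.
by rewrite !rmorphM -(thetaE sr uE) -(thetaE rr vE); ring.
Qed.
HB.instance Definition _ :=
  GRing.isZmodMorphism.Build (tfrac (pquot f)) T theta theta_zmod.
HB.instance Definition _ :=
  GRing.isMonoidMorphism.Build (tfrac (pquot f)) T theta theta_monoid.

Let thetaM u v : theta (u * v) = theta u * theta v.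
Proof. exact: (rmorphM theta). Qed.
Let thetaB u v : theta (u - v) = theta u - theta v.
Proof. exact: (rmorphB theta). Qed.
Let thetaD u v : theta (u + v) = theta u + theta v.
Proof. exact: (rmorphD theta). Qed.
Let theta0 : theta 0 = 0.
Proof. exact: (rmorph0 theta). Qed.

Let theta_eq0 u : theta u = 0 -> u = 0.
Proof.
have [g [s [sr uE]]] := tfrac_mapK u => u0; apply: (tfrac_map_cancel sr).
have := thetaE sr uE; rewrite u0 !mulr0 => /esym/psi_ker/tfrac_map_ker g0.
by rewrite uE g0.
Qed.

Let theta_closure u : integral_closure phi u <-> integral_closure psi (theta u).
Proof.
have E n (c : 'I_n -> fps2 K) : theta (u ^+ n + \sum_(i < n) phi (c i) * u ^+ i) =
    theta u ^+ n + \sum_(i < n) psi (c i) * theta u ^+ i.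
  rewrite rmorphD rmorphXn rmorph_sum; congr (_ + _).
  by apply: eq_bigr => i _; rewrite rmorphM rmorphXn; congr (_ * _); exact: theta_phi.
split=> -[n [c cE]]; exists n, c; first by rewrite -E cE rmorph0.
by apply: theta_eq0; rewrite E.
Qed.

Lemma delta_dim_model d :
  subspace (psi \o @fps2_const K) (integral_closure psi) ->
  has_dim (psi \o @fps2_const K) (integral_closure psi) (range psi) d ->
  delta_dim f d.
Proof.
move=> [c0 cD cZ] dd.
have thetaZ c v : theta (phi (fps2_const c) * v) = psi (fps2_const c) * theta v.
  by rewrite thetaM theta_phi.
have sub : subspace (phi \o @fps2_const K) (integral_closure phi).
  split=> [|u v /theta_closure iu /theta_closure iv|c v /theta_closure iv].
  - by apply/theta_closure; rewrite theta0.
  - by apply/theta_closure; rewrite thetaD; apply: cD.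
  by apply/theta_closure; rewrite thetaZ; apply: cZ.
split=> //; apply: (has_dim_lift (phi := theta)) dd => //.
- exact: range_subspace.
- by move=> v /theta_closure.
- move=> v _; split=> [[g _ gE]|[g _ <-]]; last by exists g; rewrite // -theta_phi.
  exists g => //; apply/eqP; rewrite -subr_eq0; apply/eqP/theta_eq0.
  by rewrite thetaB theta_phi gE subrr.
move=> w iw; have [g [s [sr wE]]] := psi_frac w.
have [v vs] := tfrac_map_unit sr.
have tE : theta (v * phi g) = w.
  apply: (@theta_uniq _ _ g s) => //.
  by rewrite mulrA [phi s * v]mulrC vs mul1r.
exists (v * phi g); first by apply/theta_closure; rewrite tE.
by rewrite [X in range _ (_ - X)]tE subrr; exists 0; rewrite ?rmorph0.
Qed.

End Model.

Section IntegralClosure.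
Variables (R : comNzRingType) (T : comPzRingType) (phi : {rmorphism R -> T}).
Implicit Types (p q : {poly R}) (z : T).

(** Evaluation as a plain sum over coefficients in R, where T may be the zero ring. *)
Definition poly_eval p z := \sum_(i < size p) phi p`_i * z ^+ i.

Lemma poly_eval_wide n p z : (size p <= n)%N ->
  poly_eval p z = \sum_(i < n) phi p`_i * z ^+ i.
Proof.
move=> pn; rewrite /poly_eval (big_ord_widen n (fun i => phi p`_i * z ^+ i)) //.
rewrite big_mkcond; apply: eq_bigr => i _; case: ltnP => // le.
by rewrite nth_default // rmorph0 mul0r.
Qed.

Lemma poly_evalD p q z : poly_eval (p + q) z = poly_eval p z + poly_eval q z.
Proof.
rewrite !(@poly_eval_wide (maxn (size p) (size q))) ?leq_maxl ?leq_maxr //.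
  by rewrite -big_split; apply: eq_bigr => i _; rewrite coefD rmorphD mulrDl.
exact: size_polyD.
Qed.

Lemma poly_evalCM c p z : poly_eval (c%:P * p) z = phi c * poly_eval p z.
Proof.
rewrite !(@poly_eval_wide (size p)) ?mul_polyC ?size_scale_leq // mulr_sumr.
by apply: eq_bigr => i _; rewrite coefZ rmorphM mulrA.
Qed.

Lemma poly_evalMX p z : poly_eval (p * 'X) z = z * poly_eval p z.
Proof.
rewrite (@poly_eval_wide (size p).+1) ?(leq_trans (size_polyMleq _ _)) ?size_polyX ?addn2 //.
rewrite big_ord_recl coefMX rmorph0 mul0r add0r mulr_sumr.
by apply: eq_bigr => i _; rewrite coefMX exprS mulrCA.
Qed.

Lemma poly_evalM p q z : poly_eval (p * q) z = poly_eval p z * poly_eval q z.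
Proof.
elim/poly_ind: p => [|p c IH].
  by rewrite mul0r /poly_eval size_poly0 big_ord0 mul0r.
have -> : (p * 'X + c%:P) * q = p * q * 'X + c%:P * q by ring.
rewrite !poly_evalD !poly_evalMX IH poly_evalCM mulrDl mulrA.
congr (_ + _ * _); rewrite -[c%:P]mulr1 poly_evalCM.
by rewrite /poly_eval size_poly1 big_ord1 coef1 rmorph1 !mulr1.
Qed.

Lemma poly_eval_mulr q p z : poly_eval p z = 0 -> poly_eval (p * q) z = 0.
Proof. by rewrite poly_evalM => ->; rewrite mul0r. Qed.

Lemma poly_eval_mull p q z : poly_eval q z = 0 -> poly_eval (p * q) z = 0.
Proof. by rewrite poly_evalM => ->; rewrite mulr0. Qed.

Lemma integral_closureP z :
  integral_closure phi z <-> exists2 p, p \is monic & poly_eval p z = 0.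
Proof.
split=> [[n [c cE]]|[p pm pz]].
  pose p : {poly R} := 'X^n + \poly_(i < n) oapp c 0 (insub i).
  have sp : size p = n.+1 by rewrite size_polyDl size_polyXn // ltnS size_poly.
  exists p.
    rewrite monicE /lead_coef sp /= coefD coefXn eqxx nth_default ?addr0 //.
    exact: size_poly.
  rewrite /poly_eval sp big_ord_recr /= addrC -[RHS]cE; congr (_ + _).
    rewrite coefD coefXn eqxx nth_default ?size_poly //.
    by rewrite addr0 rmorph1 mul1r.
  apply: eq_bigr => i _; rewrite coefD coefXn ltn_eqF // add0r coef_poly ltn_ord.
  by rewrite valK.
exists (size p).-1, (fun i => p`_i).
rewrite -[RHS]pz /poly_eval; have sE : size p = (size p).-1.+1.
  by rewrite prednK // size_poly_gt0 monic_neq0.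
rewrite [in RHS]sE big_ord_recr addrC /=; congr (_ + _).
by rewrite -lead_coefE (monicP pm) rmorph1 mul1r.
Qed.

Lemma range_integral z : range phi z -> integral_closure phi z.
Proof.
move=> [a _ <-]; apply/integral_closureP; exists ('X - a%:P); first exact: monicXsubC.
rewrite /poly_eval size_XsubC !big_ord_recl big_ord0 addr0 !coefB !coefX !coefC /=.
by rewrite sub0r subr0 rmorphN rmorph1 mul1r mulr1 addNr.
Qed.

End IntegralClosure.

Lemma sum_pair (V W : nmodType) (I : Type) (r : seq I) (a : I -> V) (b : I -> W) :
  \sum_(i <- r) ((a i, b i) : V * W) = (\sum_(i <- r) a i, \sum_(i <- r) b i).
Proof. by elim: r => [|i r IH]; rewrite ?big_nil // !big_cons IH. Qed.

(** * Codimensions in a product of two rings *)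

Section Pairing.
Variables (S T1 T2 : comPzRingType).
Variables (phi1 : {rmorphism S -> T1}) (phi2 : {rmorphism S -> T2}).

Definition pair_rmorphism (h : S) : T1 * T2 := (phi1 h, phi2 h).
Fact pair_rmorphism_zmod : zmod_morphism pair_rmorphism.
Proof. by move=> a b; rewrite /pair_rmorphism (rmorphB phi1) (rmorphB phi2). Qed.
Fact pair_rmorphism_monoid : monoid_morphism pair_rmorphism.
Proof.
split=> [|a b]; rewrite /pair_rmorphism; first by rewrite (rmorph1 phi1) (rmorph1 phi2).
by rewrite (rmorphM phi1) (rmorphM phi2).
Qed.
HB.instance Definition _ :=
  GRing.isZmodMorphism.Build S (T1 * T2)%type pair_rmorphism pair_rmorphism_zmod.
HB.instance Definition _ :=
  GRing.isMonoidMorphism.Build S (T1 * T2)%type pair_rmorphism pair_rmorphism_monoid.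

(** Every pair is congruent modulo the diagonal image of S to one with second component 0; this map
    thus identifies a quotient of S with the product of the two images modulo the diagonal. *)
Definition left_additive (h : S) : T1 * T2 := (phi1 h, 0).
Fact left_additive_zmod : zmod_morphism left_additive.
Proof.
by move=> a b; rewrite /left_additive (rmorphB phi1); congr pair; rewrite /= subr0.
Qed.
HB.instance Definition _ :=
  GRing.isZmodMorphism.Build S (T1 * T2)%type left_additive left_additive_zmod.

Section PairDim.
Variables (K : fieldType) (iota : {rmorphism K -> S}).
Notation iota1 := (phi1 \o iota).
Notation iota2 := (phi2 \o iota).
Notation iota12 := (pair_rmorphism \o iota).

Definition pair_set (V : set T1) (W : set T2) : set (T1 * T2) :=
  fun z => V z.1 /\ W z.2.

Lemma subspace_pair V W : subspace iota1 V -> subspace iota2 W ->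
  subspace iota12 (pair_set V W).
Proof.
move=> [V0 VD VZ] [W0 WD WZ]; split=> [|[u1 u2] [v1 v2] [u1P u2P] [v1P v2P]|c [v1 v2] [v1P v2P]].
- by split.
- by split; [apply: VD|apply: WD].
by split; [apply: VZ|apply: WZ].
Qed.

Lemma has_dim_pair_l V V' W n : subspace iota1 V -> subspace iota1 V' ->
  subspace iota2 W -> has_dim iota1 V V' n ->
  has_dim iota12 (pair_set V W) (pair_set V' W) n.
Proof.
move=> sV sV' sW; apply: (has_dim_lift (phi := fst)) => //.
- exact: subspace_pair.
- by move=> v [].
- by move=> v [_ v2]; split=> [|[]].
move=> w iw; exists (w, 0) => /=; last by rewrite subrr; case: sV'.
by split=> //; case: sW.
Qed.

Lemma has_dim_pair_r V W W' n : subspace iota1 V -> subspace iota2 W ->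
  subspace iota2 W' -> has_dim iota2 W W' n ->
  has_dim iota12 (pair_set V W) (pair_set V W') n.
Proof.
move=> sV sW sW'; apply: (has_dim_lift (phi := snd)) => //.
- exact: subspace_pair.
- by move=> v [].
- by move=> v [v1 _]; split=> [|[]].
move=> w iw; exists (0, w) => /=; last by rewrite subrr; case: sW'.
by split=> //; case: sV.
Qed.

Lemma has_dim_diagonal (J : set S) n :
  (forall h, J h <-> exists2 k, phi1 k = phi1 h & phi2 k = 0) ->
  has_dim iota setT J n ->
  has_dim iota12 (pair_set (range phi1) (range phi2)) (range pair_rmorphism) n.
Proof.
move=> JE; apply: (has_dim_transport (phi := left_additive)) => //.
- move=> c v; rewrite /= /left_additive (rmorphM phi1); congr pair.
  by rewrite /= mulr0.
- exact: range_subspace.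
- by move=> v _; split; [exists v|exists 0; rewrite ?rmorph0].
- move=> v _; rewrite JE; split=> [[k _ kE]|[k k1 k2]]; exists k => //.
  + by have := congr1 (@fst T1 T2) kE.
  + by have := congr1 (@snd T1 T2) kE.
  by rewrite /pair_rmorphism k1 k2.
move=> [w1 w2] [[a _ /= <-] [b _ /= <-]]; exists (a - b) => //.
exists b => //; rewrite /pair_rmorphism; congr pair => /=; last by rewrite subr0.
by rewrite (rmorphB phi1) opprB addrC subrK.
Qed.

(** The codimensions d1, d2, m are those of the successive steps of C1 x C2, R1 x C2, R1 x R2,
    diagonal, where Ri is the range of [phi]i. *)
Lemma has_dim_pair (C1 : set T1) (C2 : set T2) (J : set S) d1 d2 m :
  subspace iota1 C1 -> subspace iota2 C2 ->
  (forall z, range phi1 z -> C1 z) -> (forall z, range phi2 z -> C2 z) ->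
  (forall h, J h <-> exists2 k, phi1 k = phi1 h & phi2 k = 0) ->
  has_dim iota1 C1 (range phi1) d1 -> has_dim iota2 C2 (range phi2) d2 ->
  has_dim iota setT J m ->
  has_dim iota12 (pair_set C1 C2) (range pair_rmorphism) (d1 + d2 + m).
Proof.
move=> s1 s2 r1 r2 JE dim1 dim2 dimJ.
have sr1 := range_subspace iota phi1; have sr2 := range_subspace iota phi2.
have sY := subspace_pair sr1 s2; have sZ := subspace_pair sr1 sr2.
apply: (has_dimD (W := pair_set (range phi1) (range phi2))) (has_dim_diagonal JE dimJ) => //.
- exact: range_subspace.
- by move=> _ [a _ <-]; split; exists a.
- by move=> v [v1 v2]; split; [exact: r1|exact: r2].
apply: (has_dimD (W := pair_set (range phi1) C2)) => //.
- by move=> v [v1 v2]; split=> //; exact: r2.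
- by move=> v [v1 v2]; split=> //; exact: r1.
- exact: has_dim_pair_l.
exact: has_dim_pair_r.
Qed.

End PairDim.
End Pairing.
Arguments left_additive {S T1} T2 phi1 h.

Section Product.
Variables (K : closedFieldType) (f g : fps2 K).
Hypotheses (f0 : f != 0) (g0 : g != 0).
Hypothesis fg : forall h, divides f (g * h) -> divides f h.
Hypothesis gf : forall h, divides g (f * h) -> divides g h.
Notation T1 := (tfrac (pquot f)).
Notation T2 := (tfrac (pquot g)).
Notation phi1 := (tfrac_map f).
Notation phi2 := (tfrac_map g).

Notation pair_map := (pair_rmorphism phi1 phi2).
Notation left_map := (left_additive T2 phi1).

Lemma divides_coprimeM h : divides (f * g) h <-> divides f h /\ divides g h.
Proof.
split=> [[a ->]|[[a ->]]].
  by split; [exists (a * g)|exists (a * f)]; ring.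
by rewrite mulrC => /gf[b ->]; exists b; ring.
Qed.

Lemma pair_map_ker h : pair_map h = 0 <-> divides (f * g) h.
Proof.
split=> [h0|/divides_coprimeM[/tfrac_map_ker h1 /tfrac_map_ker h2]]; last first.
  by rewrite /pair_rmorphism h1 h2.
apply/divides_coprimeM; split; apply/tfrac_map_ker.
  by have := congr1 (@fst T1 T2) h0.
by have := congr1 (@snd T1 T2) h0.
Qed.

Lemma regular_modM s : regular_mod (f * g) s -> regular_mod f s /\ regular_mod g s.
Proof.
move=> sr; split=> h sh.
  apply: fg; suff /divides_coprimeM[] : divides (f * g) (g * h) by [].
  apply: sr; have [a aE] := sh; exists a; rewrite mulrCA aE; ring.
apply: gf; suff /divides_coprimeM[] : divides (f * g) (f * h) by [].
by apply: sr; have [a aE] := sh; exists a; rewrite mulrCA aE; ring.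
Qed.

Lemma pair_map_unit s : regular_mod (f * g) s -> exists w, w * pair_map s = 1.
Proof.
move=> /regular_modM[/tfrac_map_unit[v vs] /tfrac_map_unit[w ws]].
by exists (v, w); congr pair.
Qed.

Lemma pair_map_frac z : exists h s, regular_mod (f * g) s /\ pair_map s * z = pair_map h.
Proof.
case: z => z1 z2.
have [h1 [s1 [s1r z1E]]] := tfrac_mapK z1; have [h2 [s2 [s2r z2E]]] := tfrac_mapK z2.
have phif : phi1 f = 0 by apply/tfrac_map_ker; exact: divides_refl.
have phig : phi2 g = 0 by apply/tfrac_map_ker; exact: divides_refl.
(* A common denominator: modulo f it is s1 g, modulo g it is s2 f, and both are regular; the
   numerator is built alike. *)
exists (h1 * g + h2 * f), (s1 * g + s2 * f); split.
  move=> h /divides_coprimeM[hf hg]; apply/divides_coprimeM; split.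
    apply: fg; apply: s1r; have [a aE] := hf; exists (a - s2 * h).
    by rewrite mulrBl -aE; ring.
  apply: gf; apply: s2r; have [a aE] := hg; exists (a - s1 * h).
  by rewrite mulrBl -aE; ring.
rewrite [LHS]surjective_pairing; congr pair.
  have -> : (pair_map (s1 * g + s2 * f) * (z1, z2)).1 = phi1 (s1 * g + s2 * f) * z1 by [].
  by rewrite !(rmorphD phi1) !(rmorphM phi1) phif !mulr0 !addr0 -z1E mulrAC.
have -> : (pair_map (s1 * g + s2 * f) * (z1, z2)).2 = phi2 (s1 * g + s2 * f) * z2 by [].
by rewrite !(rmorphD phi2) !(rmorphM phi2) phig !mulr0 !add0r -z2E mulrAC.
Qed.

Lemma pair_closure z : integral_closure pair_map z <->
  integral_closure phi1 z.1 /\ integral_closure phi2 z.2.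
Proof.
have powE (w : T1 * T2) i : w ^+ i = (w.1 ^+ i, w.2 ^+ i).
  by elim: i => [//|i IH]; rewrite !exprS IH.
have E p (w : T1 * T2) : poly_eval pair_map p w = (poly_eval phi1 p w.1, poly_eval phi2 p w.2).
  by rewrite /poly_eval -sum_pair; apply: eq_bigr => i _; rewrite powE.
split=> [/integral_closureP[p pm]|[/integral_closureP[p pm p0] /integral_closureP[q qm q0]]].
  rewrite E => E0; split; apply/integral_closureP; exists p => //.
    by have := congr1 (@fst T1 T2) E0.
  by have := congr1 (@snd T1 T2) E0.
apply/integral_closureP; exists (p * q); first by rewrite monicMr.
exact: etrans (E _ z) (congr2 pair (poly_eval_mulr q p0) (poly_eval_mull p q0)).
Qed.

(** The fractions of K[[x,y]]/(f g) form the product of the two rings of fractions and the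
    normalization is the product of the normalizations. The extra term m measures K[[x,y]]/(f g)
    inside the product of K[[x,y]]/(f) and K[[x,y]]/(g). *)
Lemma delta_dimM d1 d2 m : delta_dim f d1 -> delta_dim g d2 ->
  has_dim (@fps2_const K) setT (ideal2 f g) m -> delta_dim (f * g) (d1 + d2 + m).
Proof.
move=> [s1 dim1] [s2 dim2] dimfg.
have cE : integral_closure pair_map =
    pair_set (integral_closure phi1) (integral_closure phi2).
  by apply/seteqP; split=> z /pair_closure.
apply: (delta_dim_model (psi := pair_map)).
- exact: pair_map_ker.
- exact: pair_map_unit.
- exact: pair_map_frac.
- rewrite cE; exact: (subspace_pair (iota := @fps2_const K) s1 s2).
rewrite cE.
apply: (has_dim_pair (iota := @fps2_const K) s1 s2 _ _ _ dim1 dim2 dimfg).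
- exact: range_integral.
- exact: range_integral.
move=> h; split=> [[a [b ->]]|[k /tfrac_map_eq[a aE] /tfrac_map_ker[b bE]]].
  exists (b * g); last by apply/tfrac_map_ker; exists b.
  by apply/tfrac_map_eq; exists (- a); ring.
by exists (- a), b; rewrite -bE mulNr -aE; ring.
Qed.

End Product.

(** * The fraction field of a branch *)

Section BranchField.
Variables (K : closedFieldType) (f : fps2 K).
Hypothesis fprime : prime_fps2 f.

Let regular s : ~ divides f s -> regular_mod f s.
Proof. by case: fprime => _ [_ fp] fs h /fp[]. Qed.

(* The hypothesis is a parameter of the type, on which its field structure
   depends. *)
Definition branch_field of prime_fps2 f : Type := tfrac (pquot f).
Notation L := (branch_field fprime).
HB.instance Definition _ := GRing.ComPzRing.on L.

Fact branch_field_neq0 : (1 : L) != 0.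
Proof.
apply/eqP => h; have : tfrac_map f 1 = 0 by rewrite rmorph1.
move/tfrac_map_ker => [b bE]; case: fprime => fnu _; apply: fnu.
by apply/unitrPr; exists b; rewrite mulrC -bE.
Qed.
HB.instance Definition _ := GRing.PzSemiRing_isNonZero.Build L branch_field_neq0.

Fact branch_field_inv_ex (z : L) :
  exists w : L, (z = 0 -> w = 0) /\ (z != 0 -> w * z = 1).
Proof.
have [z0|z0] := eqVneq z 0; first by exists 0.
have [g [s [sr zE]]] := @tfrac_mapK K f z.
have [g0|g0] := pselect (divides f g).
  case/eqP: z0; apply: (tfrac_map_cancel sr); rewrite zE mulr0.
  exact/tfrac_map_ker.
have [w wE] := tfrac_map_unit (regular g0).
exists (w * tfrac_map f s); split=> [zz|_]; first by rewrite zz eqxx in z0.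
by rewrite -mulrA [X in w * X]zE.
Qed.

Definition branch_field_inv (z : L) : L := sval (cid (branch_field_inv_ex z)).

Fact branch_field_mulVf (z : L) : z != 0 -> branch_field_inv z * z = 1.
Proof. exact: (svalP (cid (branch_field_inv_ex z))).2. Qed.
Fact branch_field_inv0 : branch_field_inv 0 = 0.
Proof. exact: (svalP (cid (branch_field_inv_ex 0))).1. Qed.
HB.instance Definition _ :=
  GRing.ComNzRing_isField.Build L branch_field_mulVf branch_field_inv0.

Lemma branch_field_ex : exists (F : fieldType) (phi : {rmorphism fps2 K -> F}),
  (forall g, phi g = 0 <-> divides f g) /\
  (forall z, exists g s, phi s != 0 /\ phi s * z = phi g).
Proof.
exists L, (tfrac_map f); split; first exact: tfrac_map_ker.
move=> z; have [g [s [sr zE]]] := @tfrac_mapK K f z; exists g, s; split=> //.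
apply/eqP => /tfrac_map_ker s0; case: fprime => fnu _; apply: fnu.
have [b bE] : divides f 1 by apply: sr; rewrite mulr1.
by apply/unitrPr; exists b; rewrite mulrC -bE.
Qed.

End BranchField.

(** * Invariants of a branch with respect to both coordinates *)

Section Irreducible.
Variable K : closedFieldType.
Implicit Types (f g h q u : fps2 K).

Definition int_dim f g m := has_dim (@fps2_const K) setT (ideal2 f g) m.

Lemma ideal2_subspace f g : subspace (@fps2_const K) (ideal2 f g).
Proof.
split=> [|_ _ [a [b ->]] [c [d ->]]|c _ [a [b ->]]].
- by exists 0, 0; rewrite !mul0r addr0.
- by exists (a + c), (b + d); ring.
by exists (fps2_const c * a), (fps2_const c * b); ring.
Qed.

Lemma int_dimE f g m : int_dim f g m -> int_mult f g = (Posz m)%:E.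
Proof. exact: (quot_dimE (ideal2_subspace f g)). Qed.

Lemma int_dim_uniq f g m k : int_dim f g m -> int_dim f g k -> m = k.
Proof. exact: (has_dim_uniq (ideal2_subspace f g)). Qed.

Lemma ideal2C f g : ideal2 f g = ideal2 g f.
Proof. by apply/seteqP; split=> h [a [b ->]]; exists b, a; rewrite addrC. Qed.

Lemma int_dimC f g m : int_dim f g m -> int_dim g f m.
Proof. by rewrite /int_dim ideal2C. Qed.

Lemma int_dim_swap f g m : int_dim (fps2_swap f) (fps2_swap g) m -> int_dim f g m.
Proof.
apply: (has_dim_lift (phi := @fps2_swap K)) => //.
- by move=> c v; rewrite /= rmorphM /= fps2_swap_const.
- exact: ideal2_subspace.
- move=> v _; split=> -[a [b]] => [/(congr1 (@fps2_swap K))|->].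
    rewrite rmorphD !rmorphM /= !fps2_swapK => ->.
    by exists (fps2_swap a), (fps2_swap b).
  by exists (fps2_swap a), (fps2_swap b); rewrite /= rmorphD !rmorphM.
move=> w _; exists (fps2_swap w) => //.
by rewrite /= fps2_swapK subrr; case: (ideal2_subspace (fps2_swap f) (fps2_swap g)).
Qed.

Lemma int_dim_unit f g m : g \is a GRing.unit -> int_dim f g m -> m = 0%N.
Proof.
move=> gu /int_dim_uniq; apply; rewrite /int_dim.
have -> : ideal2 f g = setT.
  apply/seteqP; split=> // h _; exists 0, (h * g^-1).
  by rewrite mul0r add0r mulrVK.
by apply: has_dim0; split.
Qed.

(* [z] is a coordinate of order [n] on the branch [f], [df] the derivative of
   [f] along the other coordinate and [d] the delta invariant of [f]: the
   characteristic divides [n] exactly when i(f, df) exceeds 2 d + n - 1. *)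
Definition polar_index f d n z df :=
  [/\ ~ divides f z, int_dim f z n,
    n%:R != 0 :> K -> exists2 m, int_dim f df m & m.+1 = (d.*2 + n)%N &
    n%:R = 0 :> K -> ~ divides f df -> exists2 m, int_dim f df m & (d.*2 + n <= m)%N].

Lemma integral_closure_subspace (F : fieldType) (phi : {rmorphism fps2 K -> F}) :
  subspace (phi \o @fps2_const K) (integral_closure phi).
Proof.
have E z : integral_closure phi z <-> integralOver phi z.
  have pE p : poly_eval phi p z = (map_poly phi p).[z].
    rewrite /poly_eval (horner_coef_wide _ (size_poly _ _)).
    by apply: eq_bigr => i _; rewrite coef_map.
  split=> [/integral_closureP[p pm]|[p pm /rootP pz]].
    by rewrite pE => pz; exists p => //; apply/rootP.
  by apply/integral_closureP; exists p; rewrite ?pE.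
split=> [|u v /E iu /E iv|c v /E iv]; apply/E.
- exact: integral0.
- exact: integral_add.
by apply: integral_mul => //; apply: integral_id.
Qed.

(** The codimension [D] does not involve the coordinates, so the values of d obtained from f and
    from its exchange coincide, and a single d serves both polar indices. *)
Lemma irreducible_invariants f : irreducible f -> exists d,
  [/\ delta_dim f d,
   forall g, ~ divides f g -> exists m, int_dim f g m,
   forall g h m k, ~ divides f g -> ~ divides f h -> int_dim f g m ->
     int_dim f h k -> int_dim f (g * h) (m + k),
   forall n, yregular n f -> polar_index f d n fps2_x (fps2_dy f) &
   forall n, yregular n (fps2_swap f) -> polar_index f d n fps2_y (fps2_dx f)].
Proof.
move=> firr; have fprime := irreducible_prime firr.
have [F [phi [ker frac]]] := branch_field_ex fprime.
pose phi' : {rmorphism fps2 K -> F} := phi \o @fps2_swap K.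
have ker' g : phi' g = 0 <-> divides (fps2_swap f) g.
  by rewrite -divides_swap fps2_swapK; apply: ker.
have frac' z : exists g s, phi' s != 0 /\ phi' s * z = phi' g.
  have [g [s gs]] := frac z; exists (fps2_swap g), (fps2_swap s).
  by rewrite /phi' /= !fps2_swapK.
have fN1 : ~ divides f 1.
  by move=> [b bE]; case: fprime => fnu _; apply: fnu; apply/unitrPr; exists b; rewrite mulrC.
have fM g h : ~ divides f g -> ~ divides f h -> ~ divides f (g * h).
  by move=> fg fh; case: fprime => _ [_ fp] /fp[].
pose D d := has_dim (phi \o @fps2_const K) (integral_closure phi) (range phi) d.
have D_uniq d e : D d -> D e -> d = e by apply: has_dim_uniq; apply: range_subspace.
have D_delta d : D d -> delta_dim f d.
  apply: delta_dim_model => // [s sr|z|].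
  - exists (phi s)^-1; rewrite mulVf //; apply/eqP => /ker fs; apply: fN1.
    by apply: sr; rewrite mulr1.
  - have [g [s [s0 zE]]] := frac z; exists g, s; split=> // h.
    case: fprime => _ [_ fp] /fp[/ker s0'|//].
    by rewrite s0' eqxx in s0.
  exact: integral_closure_subspace.
pose Fin := (forall g, ~ divides f g -> exists m, int_dim f g m) /\
  (forall g h m k, ~ divides f g -> ~ divides f h -> int_dim f g m ->
     int_dim f h k -> int_dim f (g * h) (m + k)).
have FinP (nu : fps2 K -> nat) : (forall g, ~ divides f g -> int_dim f g (nu g)) ->
    (forall g h, ~ divides f g -> ~ divides f h -> nu (g * h) = (nu g + nu h)%N) -> Fin.
  move=> nuP nuM; split=> [g fg|g h m k fg fh gm hk]; first by exists (nu g); apply: nuP.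
  rewrite (int_dim_uniq gm (nuP _ fg)) (int_dim_uniq hk (nuP _ fh)) -nuM //.
  exact/nuP/fM.
have sideA n : yregular n f ->
    exists2 d, D d & Fin /\ polar_index f d n fps2_x (fps2_dy f).
  move=> freg; have [d [nu [dimV dimR nuM [Nx nux] [P1 P2]]]] :=
    branch_invariants freg ker frac.
  exists d => //; split; first exact: FinP dimR nuM.
  split=> // [|nK|nK fy].
  - by rewrite -nux; apply: dimR.
  - by have [fy nuE] := P1 nK; exists (nu (fps2_dy f)) => //; apply: dimR.
  by exists (nu (fps2_dy f)); [apply: dimR|apply: P2].
(* The exchange is absorbed into the map to F: composing [phi] with it changes neither the range nor
   the integral closure. *)
have sideB n : yregular n (fps2_swap f) ->
    exists2 d, D d & Fin /\ polar_index f d n fps2_y (fps2_dx f).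
  move=> freg; have [d [nu [dimV dimR nuM [Nx nux] [P1 P2]]]] :=
    branch_invariants freg ker' frac'.
  have dimR' g : ~ divides f g -> int_dim f g (nu (fps2_swap g)).
    by move=> fg; apply: int_dim_swap; apply: dimR => /divides_swap.
  exists d; first rewrite /D.
    have -> : integral_closure phi = integral_closure phi'.
      apply/seteqP; split=> z [m [c cE]]; exists m, (fun i => fps2_swap (c i));
        rewrite -[RHS]cE; congr (_ + _); apply: eq_bigr => i _; congr (_ * _).
      by rewrite /phi' /= fps2_swapK.
    have -> : range phi = range phi'.
      apply/seteqP; split=> _ [g _ <-]; last by exists (fps2_swap g).
      by exists (fps2_swap g); rewrite // /phi' /= fps2_swapK.
    move: dimV => [e [Ve ei es]]; exists e; split=> // [c|v Vv].
      move=> h; apply: ei; move: h; rewrite -/phi'.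
      by under eq_bigr do rewrite /= -fps2_swap_const.
    have [c cE] := es v Vv; exists c.
    by under eq_bigr do rewrite /= -fps2_swap_const.
  split.
    apply: (FinP (fun g => nu (fps2_swap g))) => // g h fg fh.
    by rewrite rmorphM nuM // => /divides_swap.
  have NE g : divides (fps2_swap f) (fps2_swap g) <-> divides f g by apply: divides_swap.
  have yE : fps2_swap fps2_y = fps2_x :> fps2 K by apply: fps2_swap_y.
  split=> [|| nK|nK fx].
  - by move/NE; rewrite yE.
  - by apply: int_dim_swap; rewrite yE -nux; apply: dimR.
  - have [fy nuE] := P1 nK; exists (nu (fps2_dy (fps2_swap f))) => //.
    by apply: int_dim_swap; rewrite fps2_swap_dx; apply: dimR.
  have fy : ~ divides (fps2_swap f) (fps2_dy (fps2_swap f)).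
    by rewrite -fps2_swap_dx => /NE.
  exists (nu (fps2_dy (fps2_swap f))); last exact: P2.
  by apply: int_dim_swap; rewrite fps2_swap_dx; apply: dimR.
(* At least one coordinate order applies: a branch of infinite order in y is associated to x and has
   order 1 after the exchange. *)
have [d Dd [F1 F2]] : exists2 d, D d & Fin.
  have [[n freg]|[u uu fE]] := irreducible_yregular firr.
    by have [d Dd [? _]] := sideA n freg; exists d.
  have freg : yregular 1 (fps2_swap f).
    rewrite fE rmorphM /= fps2_swap_x; apply: yregular_unitM (yregular_y _).
    by rewrite fps2_swap_unit.
  by have [d Dd [? _]] := sideB _ freg; exists d.
exists d; split=> //; first exact: D_delta.
  by move=> n /sideA[e De [_ pe]]; rewrite (D_uniq _ _ Dd De).
by move=> n /sideB[e De [_ pe]]; rewrite (D_uniq _ _ Dd De).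
Qed.

End Irreducible.

(** * Comparison of the two sides *)

Section ExtendedSums.
Local Open Scope ereal_scope.

(** The lower bounds are finite, so an infinite summand makes the sum infinite and excludes
    equality. *)
Lemma adde_ge_eq (x y : \bar int) (a b : int) : a%:E <= x -> b%:E <= y ->
  (a + b)%:E <= x + y /\ (x + y = (a + b)%:E <-> x = a%:E /\ y = b%:E).
Proof.
case: x y => [x||] [y||] //=; rewrite ?lee_fin => ax b_y.
- split; first exact: lerD.
  rewrite -EFinD; split=> [[xy]|[[->] [->]]//]; split; congr EFin; lia.
- by rewrite leey; split=> //; split=> // -[].
- by rewrite leey; split=> //; split=> // -[].
by rewrite leey; split=> //; split=> // -[].
Qed.

Lemma sume_ge_eq n (F : 'I_n -> \bar int) (a : 'I_n -> int) :
  (forall i, (a i)%:E <= F i) ->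
  (\sum_(i < n) a i)%R%:E <= \sum_(i < n) F i /\
  (\sum_(i < n) F i = (\sum_(i < n) a i)%R%:E <-> forall i, F i = (a i)%:E).
Proof.
elim: n F a => [|n IH] F a aF; first by rewrite !big_ord0; split=> //; split=> // _ [].
rewrite !big_ord_recl.
have [le eq] := IH (fun i => F (lift ord0 i)) (fun i => a (lift ord0 i)) (fun i => aF _).
have [le2 eq2] := adde_ge_eq (aF ord0) le; split=> //.
rewrite eq2 eq; split=> [[F0 Fi] i|Fi]; last by split=> // i.
by case: (unliftP ord0 i) => [i' ->|->].
Qed.

Lemma mine_ge_eq (x y : \bar int) (a : int) : a%:E <= x -> a%:E <= y ->
  a%:E <= mine x y /\ (mine x y = a%:E <-> x = a%:E \/ y = a%:E).
Proof.
move=> ax ay; split; first by rewrite le_min ax.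
have [xy|yx] := leP x y; split; [by left| |by right|].
  by move=> [//|ya]; apply/eqP; rewrite eq_le ax andbT -ya.
by move=> [xa|//]; apply/eqP; rewrite eq_le ay andbT -xa ltW.
Qed.

Lemma sube_ge_eq (x : \bar int) (a r : int) : a%:E <= x ->
  a%:E - r%:E + 1 <= x - r%:E + 1 /\
  (x - r%:E + 1 = a%:E - r%:E + 1 <-> x = a%:E).
Proof.
case: x => [x||] //=; rewrite ?lee_fin => ax.
  split; first by lia.
  by split=> [[h]|[->]//]; congr EFin; lia.
by rewrite leey; split=> //; split.
Qed.

End ExtendedSums.

(** * The contribution of one branch and its equality case *)

Section Assembly.
Variables (K : closedFieldType) (p : nat).
Hypothesis charK : has_characteristic K p.
Implicit Types (f g h q r u : fps2 K) (s : seq (fps2 K)).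

Lemma natr_char n : (n%:R != 0 :> K) = ~~ (p %| n)%N.
Proof.
case: charK => [[-> char0]|pK]; last by rewrite -(dvdn_pcharf pK).
by rewrite dvd0n; move/pcharf0P: char0 => ->.
Qed.

Lemma nonzero_modE f g n : int_dim f g n -> nonzero_mod p (int_mult f g) <-> n%:R != 0 :> K.
Proof.
move=> /int_dimE ->; rewrite natr_char; split=> [[m [->]]|pn]; first by [].
by exists n.
Qed.

(** The ideal is then generated by f alone, modulo which the powers of x, or those of y if f is
    associated to x, are independent. *)
Lemma int_mult_infinite f g : irreducible f -> divides f g -> int_mult f g = +oo%E.
Proof.
move=> firr [a ->]; have [_ fnu _] := firr.
apply: quot_dim_infinite; first exact: ideal2_subspace.
have [[n freg]|[u uu fE]] := irreducible_yregular firr => m.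
  have n0 : (0 < n)%N.
    rewrite lt0n; apply: contraNneq fnu => n0; apply/fps2_unitP.
    by case: freg; rewrite n0.
  exists (fun i : 'I_m => fps2_x ^+ i) => // c [b [d E]] i.
  pose w := \sum_(i < m) fps1_const (c i) * fps1_X ^+ i.
  have wE : val w = \sum_(i < m) fps2_const (c i) * fps2_x ^+ i.
    by rewrite rmorph_sum; apply: eq_bigr => k _; rewrite rmorphM rmorphXn.
  have w0 : w%:P = 0.
    apply: (weierstrass_poly_uniq (q := b + d * a) freg).
      exact: leq_trans (size_polyC_leq1 _) n0.
    by rewrite toO_C wE E; ring.
  have := congr1 (fun g : fps2 K => g i 0%N) wE.
  move/polyC_inj: w0 => ->; rewrite rmorph0 fps2E0 fps2E_sum (bigD1 i) //= big1.
    by rewrite fps2E_cM fps2_xnE !eqxx mulr1 addr0 => <-.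
  move=> k; rewrite -val_eqE /= fps2E_cM fps2_xnE andbT => ki.
  by rewrite eq_sym (negPf ki) mulr0.
exists (fun i : 'I_m => fps2_y ^+ i) => // c [b [d E]] i.
have := congr1 (fun g : fps2 K => g 0%N i) E.
have -> : b * f + d * (a * f) = fps2_x * (u * (b + d * a)) by rewrite fE; ring.
rewrite fps2E_xM fps2E_sum (bigD1 i) //= big1.
  by rewrite fps2E_cM fps2_ynE !eqxx mulr1 addr0.
move=> k; rewrite -val_eqE /= fps2E_cM fps2_ynE /= => ki.
by rewrite eq_sym (negPf ki) mulr0.
Qed.

Local Open Scope ereal_scope.

(** With n = i(f, z), the value (2 d + n - 1) - n + 1 is 2 d; when p divides n the left side exceeds
    it by at least 1 or is infinite. *)
Lemma polar_index_bound f d n z df : irreducible f -> polar_index f d n z df ->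
  (Posz d.*2)%:E <= int_mult f df - int_mult f z + 1 /\
  (int_mult f df - int_mult f z + 1 = (Posz d.*2)%:E <-> nonzero_mod p (int_mult f z)).
Proof.
move=> firr [fz zn P1 P2]; rewrite (nonzero_modE zn) (int_dimE zn).
have [n0|n0] := eqVneq (n%:R : K) 0%R; last first.
  have [m /int_dimE -> mE] := P1 n0; rewrite -EFinB -EFinD.
  by split; [rewrite lee_fin; lia|split=> // _; congr EFin; lia].
have [fdf|fdf] := pselect (divides f df).
  by rewrite int_mult_infinite //=.
have [m /int_dimE -> mE] := P2 n0 fdf; rewrite -EFinB -EFinD.
split; first by rewrite lee_fin; lia.
by split=> // -[]; lia.
Qed.

Lemma dx_unit u : u \is a GRing.unit -> fps2_dx (u * fps2_x)%R \is a GRing.unit.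
Proof.
move=> /fps2_unitP u0; apply/fps2_unitP.
by rewrite FPS2E mulr1n mulrC fps2E_xM.
Qed.

Lemma dy_unit u : u \is a GRing.unit -> fps2_dy (u * fps2_y)%R \is a GRing.unit.
Proof.
move=> /fps2_unitP u0; apply/fps2_unitP.
by rewrite FPS2E mulr1n mulrC fps2E_yM.
Qed.

(** For n = 1 the relation i(f, df) + 1 = 2 d + 1 with i(f, df) = 0 forces d = 0: this is the smooth
    branch given by a coordinate axis. *)
Lemma polar_index_unit f d z df : polar_index f d 1 z df -> df \is a GRing.unit ->
  d = 0%N /\ nonzero_mod p (int_mult f z).
Proof.
move=> [fz z1 P1 _] dfu.
have [m fm mE] := P1 (oner_neq0 K).
split; first by have := int_dim_unit dfu fm; lia.
by rewrite (nonzero_modE z1) oner_neq0.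
Qed.

(** Each term of the minimum is at least 2 d, with equality governed by its own coordinate. The
    branches associated to x or y, where [gammat_irr] is 0 by convention, have d = 0 and meet the
    other axis with multiplicity 1. *)
Lemma gammat_irr_bound f d : irreducible f ->
  (forall n, yregular n f -> polar_index f d n fps2_x (fps2_dy f)) ->
  (forall n, yregular n (fps2_swap f) -> polar_index f d n fps2_y (fps2_dx f)) ->
  (Posz d.*2)%:E <= gammat_irr f /\
  (gammat_irr f = (Posz d.*2)%:E <->
   nonzero_mod p (int_mult f fps2_x) \/ nonzero_mod p (int_mult f fps2_y)).
Proof.
move=> firr Px Py.
have [[n freg]|[u uu fE]] := irreducible_yregular firr; last first.
  have fx : divides f fps2_x by exists (u^-1)%R; rewrite fE mulKr.
  have sreg : yregular 1 (fps2_swap f).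
    rewrite fE rmorphM /= fps2_swap_x; apply: yregular_unitM (yregular_y _).
    by rewrite fps2_swap_unit.
  have [|d0 gy] := polar_index_unit (Py 1%N sreg); first by rewrite fE dx_unit.
  rewrite /gammat_irr /convenient int_mult_infinite // ltxx d0.
  by split=> //; split=> // _; right.
have [[m sreg]|[u uu sE]] := irreducible_yregular (irreducible_swap firr); last first.
  have fE : f = (fps2_swap u * fps2_y)%R.
    by rewrite -[f]fps2_swapK sE rmorphM /= fps2_swap_x.
  have fy : divides f fps2_y.
    by exists (fps2_swap u)^-1%R; rewrite fE mulKr // fps2_swap_unit.
  have f1 : yregular 1 f.
    by rewrite fE; apply: yregular_unitM (yregular_y _); rewrite fps2_swap_unit.
  have [|d0 gx] := polar_index_unit (Px 1%N f1).
    by rewrite fE dy_unit // fps2_swap_unit.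
  rewrite /gammat_irr /convenient (int_mult_infinite firr fy) ltxx andbF d0.
  by split=> //; split=> // _; left.
have px := Px n freg; have py := Py m sreg.
have -> : gammat_irr f =
    mine (int_mult f (fps2_dx f) - int_mult f fps2_y + 1)
         (int_mult f (fps2_dy f) - int_mult f fps2_x + 1).
  rewrite /gammat_irr /convenient; case: px py => _ xn _ _ [_ yn _ _].
  by rewrite (int_dimE xn) (int_dimE yn) !ltry.
have [lex eqx] := polar_index_bound firr px.
have [ley eqy] := polar_index_bound firr py.
have [le eq] := mine_ge_eq ley lex; split=> //.
by rewrite eq eqx eqy; split=> -[]; [right|left|right|left].
Qed.

End Assembly.

(** * Factorization into branches and summation over pairs *)

Section Factorization.
Variable K : closedFieldType.
Implicit Types (f g h q r u : fps2 K) (s : seq (fps2 K)).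

(** Membership in the N-th power of the maximal ideal (x, y). *)
Definition in_maxpow N f := forall i j, (i + j < N)%N -> f i j = 0.

Lemma in_maxpowM N f g : f 0%N 0%N = 0 -> in_maxpow N g -> in_maxpow N.+1 (f * g).
Proof.
move=> f0 gN m n mn; rewrite fps2EM big1 // => i _; rewrite big1 // => k _.
have im := ltn_ord i; have kn := ltn_ord k.
have [i0|i0] := posnP i; last by rewrite gN ?mulr0 //; lia.
have [k0|k0] := posnP k; last by rewrite gN ?mulr0 //; lia.
by rewrite i0 k0 f0 mul0r.
Qed.

Lemma nonunit_c0 f : f \isn't a GRing.unit -> f 0%N 0%N = 0.
Proof. by move=> fu; apply/eqP; apply: contraNT fu => /fps2_unitP. Qed.

(** If f lies outside the power N + 1 of the maximal ideal, both factors of a proper factorization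
    lie outside the power N; hence the induction. *)
Lemma irreducible_factors f : f != 0 -> f \isn't a GRing.unit ->
  exists2 s, forall q, q \in s -> irreducible q & f = \prod_(q <- s) q.
Proof.
move=> f0 fu.
have [N fN] : exists N, ~ in_maxpow N f.
  have [m [n [fmn _ _]]] := fps2_lexmin f0; exists (m + n).+1 => fN.
  by rewrite fN ?eqxx // ltnS in fmn.
elim: N f f0 fu fN => [|N IH] f f0 fu fN; first by case: fN => i j.
have [firr|Nirr] := pselect (irreducible f).
  by exists [:: f]; [move=> q; rewrite inE => /eqP ->|rewrite big_seq1].
have [a [b [fE au bu]]] : exists a b,
    [/\ f = a * b, a \isn't a GRing.unit & b \isn't a GRing.unit].
  apply: contrapT => Nab; apply: Nirr; split=> // a b fE.
  have [au|au] := boolP (a \is a GRing.unit); [by left|right].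
  by apply: contrapT => /negP bu; apply: Nab; exists a, b.
have /andP[a0 b0] : (a != 0) && (b != 0) by move: f0; rewrite fE mulf_eq0 negb_or.
have [|s1 s1irr aE] := IH a a0 au.
  by move=> aN; apply: fN; rewrite fE mulrC; apply: in_maxpowM (nonunit_c0 bu) aN.
have [|s2 s2irr bE] := IH b b0 bu.
  by move=> bN; apply: fN; rewrite fE; apply: in_maxpowM (nonunit_c0 au) bN.
exists (s1 ++ s2); last by rewrite big_cat /= -aE -bE.
by move=> q; rewrite mem_cat => /orP[/s1irr|/s2irr].
Qed.

Lemma branches_factorization f : f != 0 -> factorization f (branches f).
Proof.
move=> f0; apply: xgetPex; have [fu|fu] := boolP (f \is a GRing.unit).
  by exists [::]; split=> //; right.
by have [s sirr fE] := irreducible_factors f0 fu; exists s; split=> //; left.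
Qed.

Fixpoint noncommon s : Prop := if s is q :: s' then
  (forall r, r \in s' -> ~ divides q r /\ ~ divides r q) /\ noncommon s' else True.

(** Between irreducible series divisibility means association, so two associated members of the list
    would put a square into the product. *)
Lemma noncommon_squarefree s : (forall q, q \in s -> irreducible q) ->
  (forall q, irreducible q -> ~ divides (q ^+ 2) (\prod_(r <- s) r)) -> noncommon s.
Proof.
elim: s => [//|q s IH] sirr sq; split; last first.
  apply: IH => [r rs|r rirr [b bE]]; first by apply: sirr; rewrite inE rs orbT.
  by apply: (sq r rirr); exists (q * b); rewrite big_cons bE mulrA.
have qirr : irreducible q by apply: sirr; rewrite mem_head.
have aux (a b : fps2 K) : irreducible a -> irreducible b -> divides a b -> exists2 u, u \is a GRing.unit & b = u * a.
  move=> [_ au _] [_ _ birr] [u uE]; have [uu|//] := birr _ _ uE; first by exists u.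
  by rewrite (negPf au).
move=> r rs; have rirr : irreducible r by apply: sirr; rewrite inE rs orbT.
split=> [/(aux q r qirr rirr)[u uu rE]|/(aux r q rirr qirr)[u uu qE]].
  apply: (sq q qirr); exists (u * \prod_(z <- rem r s) z).
  by rewrite big_cons (big_rem r) //= rE; ring.
apply: (sq r rirr); exists (u * \prod_(z <- rem r s) z).
by rewrite big_cons (big_rem r) //= qE; ring.
Qed.

Lemma noncommon_nth s i j : noncommon s -> (i < size s)%N -> (j < size s)%N ->
  i != j -> ~ divides s`_i s`_j.
Proof.
elim: s i j => [//|q s IH] [|i] [|j] //= [qs ss] is' js' ij.
- by case: (qs s`_j (mem_nth 0 js')).
- by case: (qs s`_i (mem_nth 0 is')).
exact: IH.
Qed.

Lemma prime_ndvd_prod q s : prime_fps2 q -> (forall r, r \in s -> ~ divides q r) ->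
  ~ divides q (\prod_(r <- s) r).
Proof.
move=> [qu [q0 qp]]; elim: s => [|r s IH] sr.
  rewrite big_nil => -[b bE]; apply: qu; apply/unitrPr; exists b.
  by rewrite mulrC.
rewrite big_cons => /qp[]; first by apply: sr; rewrite mem_head.
by apply: IH => z zs; apply: sr; rewrite inE zs orbT.
Qed.

(** The quotient by a unit is the zero ring. *)
Lemma delta_dim_unit f : f \is a GRing.unit -> delta_dim f 0.
Proof.
move=> fu; have one0 : 1 = 0 :> tfrac (pquot f).
  rewrite -(rmorph1 (tfrac_map f)); apply/tfrac_map_ker.
  by exists f^-1; rewrite mulVr.
have z0 z : z = 0 :> tfrac (pquot f) by rewrite -[z]mul1r one0 mul0r.
have rE : integral_closure (tfrac_map f) = range (tfrac_map f).
  apply/seteqP; split=> z _; first by exists 0; rewrite ?rmorph0 -?[z]z0 // [z]z0.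
  by exists 0%N, (fun=> 0); rewrite big_ord0 expr0 one0 addr0.
rewrite /delta_dim rE; split; first exact: range_subspace.
exact/has_dim0/range_subspace.
Qed.

Section Counting.
Variable m : fps2 K -> fps2 K -> nat.

Fixpoint pair_sum s : nat :=
  if s is q :: s' then (\sum_(r <- s') m q r + pair_sum s')%N else 0%N.

(** Each unordered pair is counted twice, matching the factor 2 in front of delta. Symmetry is asked
    off the diagonal only, where m is an intersection multiplicity. *)
Lemma sum_pair_sum s :
  (forall i j, (i < size s)%N -> (j < size s)%N -> i != j -> m s`_i s`_j = m s`_j s`_i) ->
  (\sum_(i < size s) \sum_(j < size s | j != i) m (s`_i)%R (s`_j)%R = (pair_sum s).*2)%N.
Proof.
elim: s => [|q s IH] msym /=; first by rewrite big_ord0.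
rewrite big_ord_recl /= doubleD -IH => [|i j is' js' ij]; last exact: (msym i.+1 j.+1).
rewrite -addnn -addnA; congr (_ + _)%N.
  rewrite big_mkcond big_ord_recl /= add0n (big_nth 0) big_mkord.
  by apply: eq_bigr => i _.
rewrite (big_nth 0) big_mkord -big_split; apply: eq_bigr => i _.
rewrite big_mkcond big_ord_recl /=; congr (_ + _)%N.
  by rewrite (msym i.+1 0%N) //= ltnS.
by rewrite [RHS]big_mkcond; apply: eq_bigr => k _; rewrite (inj_eq lift_inj).
Qed.

End Counting.

(** One branch is split off at a time: being prime, it is coprime to the product of the others, and
    its intersection number with that product is additive. *)
Lemma delta_dim_prod (d : fps2 K -> nat) (m : fps2 K -> fps2 K -> nat) s :
  (forall q, q \in s -> irreducible q /\ delta_dim q (d q)) ->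
  (forall q g h k l, q \in s -> ~ divides q g -> ~ divides q h -> int_dim q g k ->
     int_dim q h l -> int_dim q (g * h) (k + l)) ->
  (forall q r, q \in s -> r \in s -> ~ divides q r -> int_dim q r (m q r)) ->
  noncommon s ->
  delta_dim (\prod_(q <- s) q) (\sum_(q <- s) d q + pair_sum m s).
Proof.
elim: s => [|q s IH] sd intM sm ns.
  by rewrite !big_nil; apply: delta_dim_unit; rewrite unitr1.
have [qs ss] := ns; have qmem : q \in q :: s by rewrite mem_head.
have smem r : r \in s -> r \in q :: s by rewrite inE orbC => ->.
have [qirr qd] := sd q qmem; have qprime := irreducible_prime qirr.
have [qu [q0 qp]] := qprime.
have qN t : {subset t <= s} -> ~ divides q (\prod_(r <- t) r).
  by move=> ts; apply: prime_ndvd_prod => // r /ts /qs[].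
have Fd : delta_dim (\prod_(r <- s) r) (\sum_(r <- s) d r + pair_sum m s).
  apply: IH => //.
  - by move=> r /smem; apply: sd.
  - by move=> r g h k l /smem; apply: intM.
  by move=> r r' /smem rs /smem; apply: sm.
have qdim : int_dim q (\prod_(r <- s) r) (\sum_(r <- s) m q r).
  have : {subset s <= s} by [].
  elim: {-2}(s) => [|r t IHt] ts.
    rewrite !big_nil /int_dim; have -> : ideal2 q 1 = setT.
      by apply/seteqP; split=> // h _; exists 0, h; rewrite mul0r add0r mulr1.
    by apply: has_dim0; split.
  have rs : r \in s by apply: ts; rewrite mem_head.
  have ts' : {subset t <= s} by move=> z zt; apply: ts; rewrite inE zt orbT.
  rewrite !big_cons; apply: intM => //.
  - by case: (qs r rs).
  - exact: qN.
  - by apply: sm => //; [exact: smem|case: (qs r rs)].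
  exact: IHt.
have F0 : \prod_(r <- s) r != 0.
  rewrite prodf_seq_neq0; apply/allP => r rs /=; case: (sd r (smem r rs)).
  by case.
have -> : (\sum_(r <- q :: s) d r + pair_sum m (q :: s) =
    d q + (\sum_(r <- s) d r + pair_sum m s) + \sum_(r <- s) m q r)%N.
  by rewrite big_cons /=; lia.
rewrite big_cons; apply: delta_dimM qd Fd qdim => // h.
  by move=> /qp[/qN[]//|].
move=> [b bE]; have [b' b'E] : divides q b.
  have /qp[//|/qN[]//] : divides q (b * \prod_(r <- s) r).
  by exists h; rewrite -bE mulrC.
exists b'; apply: (mulfI q0); rewrite bE b'E; ring.
Qed.

End Factorization.

Local Open Scope ereal_scope.

Theorem theorem2p11 (K : closedFieldType) (p : nat)
    (charK : has_characteristic K p) (f : fps2 K) (redf : reduced f) :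
  2%:E * delta f - (Posz (nbranches f))%:E + 1 <= gammat f
  /\ (gammat f = 2%:E * delta f - (Posz (nbranches f))%:E + 1 <-> im_good p f).
Proof.
have [f0 fsq] := redf.
have [sirr sf] := branches_factorization f0.
rewrite /nbranches /gammat /im_good; set s := branches f in sirr sf *.
have ns : noncommon s.
  case: sf => [fE|[_ ->] //]; apply: noncommon_squarefree => // q qirr [b bE].
  by apply: (fsq q qirr); exists b; rewrite fE.
(* Total functions d and m are chosen once, with irrelevant values off their domain, so that sums
   over s can be formed. *)
have /choice[d dP] (q : fps2 K) : exists d, irreducible q ->
  [/\ delta_dim q d,
   forall g, ~ divides q g -> exists m, int_dim q g m,
   forall g h m k, ~ divides q g -> ~ divides q h -> int_dim q g m ->
     int_dim q h k -> int_dim q (g * h)%R (m + k),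
   forall n, yregular n q -> polar_index q d n fps2_x (fps2_dy q) &
   forall n, yregular n (fps2_swap q) -> polar_index q d n fps2_y (fps2_dx q)].
  have [qirr|Nq] := pselect (irreducible q); last by exists 0%N.
  by have [d dq] := irreducible_invariants qirr; exists d.
have /choice[m mP] (qr : fps2 K * fps2 K) : exists m,
    irreducible qr.1 -> ~ divides qr.1 qr.2 -> int_dim qr.1 qr.2 m.
  have [qirr|Nq] := pselect (irreducible qr.1); last by exists 0%N.
  have [qr0|qr0] := pselect (divides qr.1 qr.2); first by exists 0%N.
  by have [_ /(_ _ qr0)[k kE] _ _ _] := dP _ qirr; exists k.
pose mm q r := m (q, r).
have mmP q r : q \in s -> ~ divides q r -> int_dim q r (mm q r).
  by move=> /sirr qirr; apply: (mP (q, r)).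
pose D := (\sum_(q <- s) d q + pair_sum mm s)%N.
have deltaE : delta f = (Posz D)%:E.
  apply: delta_dimE; case: sf => [->|[fu sE]].
    apply: delta_dim_prod => //.
    - by move=> q qs; have qirr := sirr q qs; case: (dP q qirr).
    - by move=> q g h k l qs; case: (dP q (sirr q qs)) => _ _ qM _ _; apply: qM.
    by move=> q r qs _; apply: mmP.
  by rewrite /D sE big_nil; apply: delta_dim_unit.
pose N i := (\sum_(j < size s | j != i :> nat) mm (s`_i)%R (s`_j)%R)%N.
have nth_mem i : (i < size s)%N -> (s`_i)%R \in s by apply: mem_nth.
have ND i j : (i < size s)%N -> (j < size s)%N -> i != j -> ~ divides (s`_i)%R (s`_j)%R.
  by move=> *; apply: noncommon_nth.
have NE (i : 'I_(size s)) :
    \sum_(j < size s | j != i) int_mult (s`_i)%R (s`_j)%R = (Posz (N i))%:E.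
  rewrite (eq_bigr (fun j : 'I__ => (Posz (mm (s`_i)%R (s`_j)%R))%:E)) => [|j ji].
    rewrite sumEFin; congr EFin; rewrite /N.
    by rewrite (big_morph Posz PoszD (erefl _)).
  apply: int_dimE; apply: mmP; first exact: nth_mem.
  by apply: ND => //; rewrite eq_sym.
have sumN : (\sum_(i < size s) N i = (pair_sum mm s).*2)%N.
  apply: sum_pair_sum => i j is' js' ij.
  have ji := ij; rewrite eq_sym in ji.
  apply: (@int_dim_uniq _ (s`_i)%R (s`_j)%R).
    exact: mmP (nth_mem _ is') (ND _ _ is' js' ij).
  exact: int_dimC (mmP _ _ (nth_mem _ js') (ND _ _ js' is' ji)).
(* The finite lower bound for the i-th summand: twice its delta plus its intersections with the
   other branches. These bounds add up to 2 delta(f). *)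
pose a i := Posz ((d (s`_i)%R).*2 + N i).
pose F i := gammat_irr (s`_i)%R + (Posz (N i))%:E.
have aF (i : 'I_(size s)) : (a i)%:E <= F i /\
    (F i = (a i)%:E <-> nonzero_mod p (int_mult (s`_i)%R fps2_x) \/
                        nonzero_mod p (int_mult (s`_i)%R fps2_y)).
  have [_ _ _ Px Py] := dP _ (sirr _ (nth_mem _ (ltn_ord i))).
  have [le eq] := gammat_irr_bound charK (sirr _ (nth_mem _ (ltn_ord i))) Px Py.
  have [le2 eq2] := adde_ge_eq le (lexx (Posz (N i))%:E).
  split; first by rewrite /a PoszD.
  by rewrite /a PoszD eq2 -eq; split=> [[]|].
have sumaE : (\sum_(i < size s) a i)%R = Posz D.*2.
  rewrite -(big_morph Posz PoszD (erefl _)) big_split /= sumN; congr Posz.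
  rewrite /D doubleD (big_nth 0%R) big_mkord; congr (_ + _)%N.
  by rewrite -mul2n big_distrr; apply: eq_bigr => i _; rewrite /= mul2n.
have [leF eqF] := sume_ge_eq (fun i => (aF i).1).
rewrite (eq_bigr (fun i : 'I__ => F i)) => [|i _]; last by rewrite NE.
have -> : 2%:E * delta f = (\sum_(i < size s) a i)%R%:E.
  by rewrite deltaE sumaE -EFinM -mul2n PoszM.
have [le eq] := sube_ge_eq (Posz (size s)) leF; split=> //.
rewrite eq eqF; split=> [Fi q /(nthP 0%R)[i is' <-]|good i].
  by have /(aF (Ordinal is')).2 := Fi (Ordinal is').
by apply/(aF i).2/good/nth_mem.
Qed.
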